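(* Let $\alpha\in\mathbb{C}$ and let $\beta,\gamma>-1$ be real numbers such that if $\beta,\gamma\in(-1,0)$ then $\beta+\gamma+1\neq 0$. Let $\rho\in\{z\in\mathbb{C}:|z|<1\}\setminus(-1,0]$, $x\in[-1,1]$, and put $R:=\sqrt{1+\rho^2-2\rho x}$. Then $$\frac{(1+x)^{-\beta/2}}{R^{\alpha+1}}\,P_\alpha^{-\beta}\!\left(\frac{1+\rho}{R}\right)=\frac{\Gamma(\gamma+\beta+1)}{2^{\beta/2}\,\Gamma(\beta+1)\,(1-\rho)^{\alpha-\gamma}\rho^{(\gamma+1)/2}}\sum_{k=0}^\infty\frac{(2k+\gamma+\beta+1)(\gamma+\beta+1)_k(\alpha+\beta+1)_{2k}}{(\beta+1)_k}\,P_{\gamma-\alpha}^{-\gamma-\beta-2k-1}\!\left(\frac{1+\rho}{1-\rho}\right)P_k^{(\gamma,\beta)}(x).$$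
   Context: Square roots and complex powers are principal. $(z)_n:=\prod_{i=1}^n(z+i-1)$ is the Pochhammer symbol. The Jacobi polynomials are $P_n^{(\alpha,\beta)}(z):=\frac{(\alpha+1)_n}{n!}\,{}_2F_1\left(-n,n+\alpha+\beta+1;\alpha+1;\frac{1-z}{2}\right)$, $n\in\mathbb{N}_0=\{0,1,2,\dots\}$. The associated Legendre function of the first kind $P_\nu^\mu:\mathbb{C}\setminus(-\infty,1]\to\mathbb{C}$ is $$P_\nu^\mu(z):=\frac{1}{\Gamma(1-\mu)}\left(\frac{z+1}{z-1}\right)^{\mu/2}{}_2F_1\!\left(-\nu,\nu+1;1-\mu;\frac{1-z}{2}\right),$$ where ${}_2F_1$ denotes the Gauss hypergeometric function, continued analytically to $\mathbb{C}\setminus[1,\infty)$. At $x=-1$, where $(1+\rho)/R=1$, the left-hand side is understood as its limit as $x\to-1^+$. *)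

(* Defs.v *)
From Stdlib Require Import Reals Factorial.
From Coquelicot Require Import Coquelicot.

Open Scope C_scope.

Definition Cexp (z : C) : C :=
  (exp (Re z) * cos (Im z), exp (Re z) * sin (Im z))%R.

(* Principal argument, with values in (-PI, PI] for z <> 0. *)
Definition Carg (z : C) : R :=
  if Rle_dec 0 (Im z) then acos (Re z / Cmod z)
  else (- acos (Re z / Cmod z))%R.

Definition Clog (z : C) : C := (ln (Cmod z), Carg z).

(* Principal power.  The case split is needed because ln 0 = 0 in Stdlib. *)
Definition Cpower (z w : C) : C :=
  if Ceq_dec z 0 then (if Ceq_dec w 0 then 1 else 0)
  else Cexp (w * Clog z).

Definition Csqrt (z : C) : C := Cpower z (1 / 2).

Fixpoint poch (z : C) (n : nat) : C :=
  match n with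
  | O => 1
  | S m => poch z m * (z + INR m)
  end.

(* Gauss's product: n! n^z / (z (z+1) ... (z+n)) converges to the Gamma
   function at every z outside {0, -1, -2, ...}. *)
Definition CGamma (z : C) : C :=
  iota (fun l : C_CompleteNormedModule =>
    filterlim
      (fun n : nat => INR (fact n) * Cpower (INR n) z / poch z (S n))
      eventually (locally (T := C_UniformSpace) l)).

Definition gauss_coef (a b c : C) (n : nat) : C :=
  poch a n * poch b n / (poch c n * INR (fact n)).

Definition is_gauss_series (a b c z l : C) : Prop :=
  is_pseries (K := C_AbsRing) (V := C_NormedModule) (gauss_coef a b c) z l.

Definition analytic_on (D : C -> Prop) (f : C -> C) : Prop :=
  forall z0 : C, D z0 ->
  exists (r : R) (u : nat -> C), (0 < r)%R /\
    forall z : C, (Cmod (z - z0) < r)%R ->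
      is_pseries (K := C_AbsRing) (V := C_NormedModule) u (z - z0) (f z).

Definition hyp_domain (z : C) : Prop := ~ (Im z = 0%R /\ (1 <= Re z)%R).

Definition is_gauss_continuation (a b c : C) (F : C -> C) : Prop :=
  analytic_on hyp_domain F /\
  forall z : C, (Cmod z < 1)%R -> is_gauss_series a b c z (F z).

(* The common value at z of all analytic continuations of the Gauss series
   to the complement of [1, +oo) (c not in {0, -1, -2, ...}). *)
Definition hyp2F1 (a b c z : C) : C :=
  iota (fun w : C_CompleteNormedModule =>
    exists F : C -> C, is_gauss_continuation a b c F /\ F z = w).

(* The Gauss series with first parameter -n terminates.  Its sum is taken
   directly, rather than through [hyp2F1], so that points z with (1 - z) / 2
   in [1, +oo), such as z = -1, are covered as well. *)
Definition jacobiP (n : nat) (a b z : C) : C :=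
  poch (a + 1) n / INR (fact n) *
  iota (fun l : C_CompleteNormedModule =>
    is_gauss_series (- INR n) (INR n + a + b + 1) (a + 1) ((1 - z) / 2) l).

(* Degree nu, order mu; meaningful when 1 - mu is not in {0, -1, -2, ...}. *)
Definition legendreP (nu mu z : C) : C :=
  1 / CGamma (1 - mu) *
  Cpower ((z + 1) / (z - 1)) (mu / 2) *
  hyp2F1 (- nu) (nu + 1) (1 - mu) ((1 - z) / 2).

(* Main.v *)
Require Import Defs.
From Stdlib Require Import Reals Lra Lia Psatz Factorial FunctionalExtensionality.
From Coquelicot Require Import Coquelicot.
(** Write [a = alpha+beta+1], [c = beta+1], [s = gamma+beta+1], [y = (1+x)/2], let [F] be the Gauss
    series and [zeta = (1+rho-R)/(1+rho+R)].

    Every Legendre function in the statement is a hypergeometric function at a point [-w/(1-w)] with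
    [|w| < 1]: [w = zeta] on the left, [w = rho] on the right.  Pfaff's transformation ([pfaff])
    turns it into a Gauss series at [w].  The left-hand side becomes a constant, the power
    [(rho/2)^(beta/2)] over [Gamma(c)], times
      [G(rho) = ((1+rho+R)/2)^(-a) F(alpha+1,a;c;zeta)]
    ([legendre_generating]), and the right-hand side becomes the same constant times the series of
      [(s)_k (a)_{2k} / ((s)_{2k} (c)_k) P_k^(gamma,beta)(x) rho^k F(alpha-gamma,a+2k;s+2k+1;rho)],
    because [Gamma(s+2k+1) = (s)_{2k+1} Gamma(s)].  That all powers combine as principal ones rests
    on two facts about the root [R]: [(1+rho)/R] has positive real part ([ratio_Re_pos]), and the
    imaginary part of [1+rho+R] has the sign of that of [rho] ([Carg_denom]).

    On the right, Jacobi polynomials on [[-1,1]] grow subexponentially, by their three-term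
    recurrence, so the double series in [k] and in the powers of [rho] converges absolutely in the
    whole disk.  Collecting powers of [rho], a very-well-poised terminating sum
    ([connection_sum]) collapses the coefficients to
      [T_n = sum_j (-1)^(n-j) (a)_{n+j} / ((c)_j j! (n-j)!) y^j],
    which no longer involve [gamma] ([jacobi_double_series]).  On the left, [G] is analytic in the
    unit disk, and for small [rho] both [G] and [sum_n T_n rho^n] equal
      [(1+rho)^(-a) sum_j (a)_{2j} / ((c)_j j!) W^j], where
      [W = zeta/(1+zeta)^2 = y rho/(1+rho)^2];
    the identity theorem extends the equality to the disk ([gen_fun_expansion]).  At [x = -1] the
    expansion of [G] still holds, and continuity of [G] in [x] gives the limit.

    A function is called analytic at a point when it is locally the sum of a power series.  Fubini's
    theorem for double series ([Csums_Fubini]) makes this notion stable under composition, the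
    binomial series ([binomial_series]) makes principal powers analytic off the negative axis, and
    [analytic_identity] is the identity theorem on star-shaped sets.  The continuation of the Gauss
    series to the plane cut along [1,+oo) is explicit: [z = -4v/(1-v)^2] maps the disk [|v| < 1]
    onto the cut plane, and [(1-v)^(-2a) F(a,b;c;z)] is a power series in [v] whose coefficients
    obey a three-term recurrence with limiting characteristic roots [1] and [-1], hence converges
    in the whole disk ([cut_fun], [hyp2F1_spec]). *)

Local Open Scope C_scope.

(** * Limits and sums of complex sequences *)

Fixpoint csum (f : nat -> C) (n : nat) : C :=
  match n with O => 0 | S m => csum f m + f m end.

Fixpoint rsum (f : nat -> R) (n : nat) : R :=
  match n with O => 0%R | S m => (rsum f m + f m)%R end.

Lemma Cmod_minus_triangle (y x z : C) : (Cmod (x - z) <= Cmod (y - x) + Cmod (y - z))%R.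
Proof.
  replace (x - z) with (- (y - x) + (y - z)) by ring.
  eapply Rle_trans; [apply Cmod_triangle|]. rewrite Cmod_opp. lra.
Qed.

(** Stated with [Cmod]: the filters of the two uniform structures on [C] agree only up to
    [locally_C], and [tends_filterlim] crosses over once and for all. *)
Definition tends (u : nat -> C) (l : C) : Prop :=
  forall eps : R, (0 < eps)%R -> exists N, forall n, (N <= n)%nat -> (Cmod (u n - l) < eps)%R.

Lemma tends_ext (u v : nat -> C) (l : C) : (forall n, u n = v n) -> tends u l -> tends v l.
Proof. intros E H eps He. destruct (H eps He) as [N HN]. exists N. intros n Hn. rewrite <- E. auto. Qed.

Lemma tends_const (c : C) : tends (fun _ => c) c.
Proof. intros eps He. exists O. intros n _. replace (c - c) with (RtoC 0) by ring. rewrite Cmod_0. exact He. Qed.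

Lemma tends_plus (u v : nat -> C) (l l' : C) : tends u l -> tends v l' -> tends (fun n => u n + v n) (l + l').
Proof.
  intros H H' eps He. destruct (H (eps / 2)%R ltac:(lra)) as [N HN]. destruct (H' (eps / 2)%R ltac:(lra)) as [N' HN'].
  exists (N + N')%nat. intros n Hn. specialize (HN n ltac:(lia)). specialize (HN' n ltac:(lia)).
  replace (u n + v n - (l + l')) with ((u n - l) + (v n - l')) by ring.
  eapply Rle_lt_trans; [apply Cmod_triangle|lra].
Qed.

Lemma tends_mult (u v : nat -> C) (l l' : C) : tends u l -> tends v l' -> tends (fun n => u n * v n) (l * l').
Proof.
  intros H H' eps He. pose proof (Cmod_ge_0 l) as Hl. pose proof (Cmod_ge_0 l') as Hl'.
  set (d := Rmin 1 (eps / (Cmod l + Cmod l' + 2))).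
  assert (Hd : (0 < d <= 1)%R) by (split; [apply Rmin_pos; [lra|apply Rdiv_lt_0_compat; lra]|apply Rmin_l]).
  assert (Hd2 : (d * (Cmod l + Cmod l' + 2) <= eps)%R).
  { apply Rle_trans with (eps / (Cmod l + Cmod l' + 2) * (Cmod l + Cmod l' + 2))%R.
    - apply Rmult_le_compat_r; [lra|apply Rmin_r].
    - right; field; lra. }
  destruct (H d ltac:(lra)) as [N HN]. destruct (H' d ltac:(lra)) as [N' HN'].
  exists (N + N')%nat. intros n Hn. specialize (HN n ltac:(lia)). specialize (HN' n ltac:(lia)).
  replace (u n * v n - l * l') with ((u n - l) * (v n - l') + (u n - l) * l' + l * (v n - l')) by ring.
  eapply Rle_lt_trans; [apply Cmod_triangle|].
  eapply Rle_lt_trans; [apply Rplus_le_compat_r, Cmod_triangle|]. rewrite !Cmod_mult.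
  pose proof (Cmod_ge_0 (u n - l)). pose proof (Cmod_ge_0 (v n - l')). nra.
Qed.

Lemma Cmod_ball (l z : C) (eps : R) :
  ball (M := AbsRing_UniformSpace C_AbsRing) l eps z <-> (Cmod (z - l) < eps)%R.
Proof. reflexivity. Qed.

Lemma tends_filterlim (u : nat -> C) (l : C) :
  tends u l <-> filterlim u eventually (locally (T := C_UniformSpace) l).
Proof.
  split.
  - intros H P HP. apply (proj1 (locally_C _ _)) in HP. destruct HP as [eps Heps].
    destruct (H eps (cond_pos eps)) as [N HN]. exists N. intros n Hn. apply Heps, Cmod_ball, HN, Hn.
  - intros H eps Heps.
    assert (HP : locally (T := C_UniformSpace) l (fun z => (Cmod (z - l) < eps)%R)).
    { apply (proj2 (locally_C _ _)). exists (mkposreal eps Heps). intros z Hz. exact Hz. }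
    destruct (H _ HP) as [N HN]. exists N. exact HN.
Qed.

Lemma tends_unique (u : nat -> C) (l l' : C) : tends u l -> tends u l' -> l = l'.
Proof.
  intros H H'. apply Ceq_minus, Cmod_eq_0, Rle_antisym; [|apply Cmod_ge_0].
  apply le_epsilon. intros eps He.
  destruct (H (eps / 2)%R ltac:(lra)) as [N HN]. destruct (H' (eps / 2)%R ltac:(lra)) as [N' HN'].
  specialize (HN (N + N')%nat ltac:(lia)). specialize (HN' (N + N')%nat ltac:(lia)).
  pose proof (Cmod_minus_triangle (u (N + N')%nat) l l'). lra.
Qed.

Lemma tends_ext_S (u v : nat -> C) (l : C) : (forall n, u (S n) = v (S n)) -> tends u l -> tends v l.
Proof.
  intros E H eps He. destruct (H eps He) as [N HN]. exists (S N). intros n Hn.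
  destruct n as [|n]; [lia|]. rewrite <- E. apply HN. lia.
Qed.

Definition Csums (a : nat -> C) (l : C) : Prop := tends (csum a) l.

(** Absolute summability as a bound on finite sums, so that it passes to double families and
    to rearrangements without forming any real series. *)
Definition abs_bounded (a : nat -> C) (B : R) : Prop :=
  forall n, (rsum (fun k => Cmod (a k)) n <= B)%R.

Definition CSeries (a : nat -> C) : C :=
  (Series (fun n => Re (a n)), Series (fun n => Im (a n))).

Lemma csum_ext (f g : nat -> C) (n : nat) :
  (forall k, (k < n)%nat -> f k = g k) -> csum f n = csum g n.
Proof.
  induction n as [|n IH]; intros H; simpl; [reflexivity|].
  rewrite IH by (intros; apply H; lia). rewrite H by lia. reflexivity.
Qed.

Lemma rsum_ext (f g : nat -> R) (n : nat) :
  (forall k, (k < n)%nat -> f k = g k) -> rsum f n = rsum g n.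
Proof.
  induction n as [|n IH]; intros H; simpl; [reflexivity|].
  rewrite IH by (intros; apply H; lia). rewrite H by lia. reflexivity.
Qed.

Lemma csum_plus (f g : nat -> C) (n : nat) :
  csum (fun k => f k + g k) n = csum f n + csum g n.
Proof. induction n as [|n IH]; simpl; [ring|]. rewrite IH; ring. Qed.

Lemma csum_minus (f g : nat -> C) (n : nat) :
  csum (fun k => f k - g k) n = csum f n - csum g n.
Proof. induction n as [|n IH]; simpl; [ring|]. rewrite IH; ring. Qed.

Lemma csum_scal (c : C) (f : nat -> C) (n : nat) :
  csum (fun k => c * f k) n = c * csum f n.
Proof. induction n as [|n IH]; simpl; [ring|]. rewrite IH; ring. Qed.

Lemma csum_0 (f : nat -> C) (n : nat) :
  (forall k, (k < n)%nat -> f k = 0) -> csum f n = 0.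
Proof.
  intros H. rewrite (csum_ext f (fun _ => 0)) by exact H.
  clear H; induction n as [|n IH]; simpl; [reflexivity|]. rewrite IH; ring.
Qed.

Lemma csum_shift (f : nat -> C) (n : nat) :
  csum f (S n) = f O + csum (fun k => f (S k)) n.
Proof.
  induction n as [|n IH]; [simpl; ring|].
  change (csum f (S (S n))) with (csum f (S n) + f (S n)). rewrite IH. simpl. ring.
Qed.

Lemma rsum_shift (f : nat -> R) (n : nat) :
  (rsum f (S n) = f O + rsum (fun k => f (S k)) n)%R.
Proof.
  induction n as [|n IH]; [simpl; ring|].
  change (rsum f (S (S n))) with (rsum f (S n) + f (S n))%R. rewrite IH. simpl. ring.
Qed.

Lemma csum_add (f : nat -> C) (n m : nat) :
  csum f (n + m) = csum f n + csum (fun k => f (n + k)%nat) m.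
Proof.
  induction m as [|m IH]; simpl.
  - rewrite Nat.add_0_r; ring.
  - rewrite Nat.add_succ_r; simpl. rewrite IH; ring.
Qed.

Lemma rsum_add (f : nat -> R) (n m : nat) :
  (rsum f (n + m) = rsum f n + rsum (fun k => f (n + k)%nat) m)%R.
Proof.
  induction m as [|m IH]; simpl.
  - rewrite Nat.add_0_r; ring.
  - rewrite Nat.add_succ_r; simpl. rewrite IH; ring.
Qed.

Lemma rsum_plus (f g : nat -> R) (n : nat) :
  (rsum (fun k => f k + g k) n = rsum f n + rsum g n)%R.
Proof. induction n as [|n IH]; simpl; [ring|]. rewrite IH; ring. Qed.

Lemma rsum_scal (c : R) (f : nat -> R) (n : nat) :
  (rsum (fun k => c * f k) n = c * rsum f n)%R.
Proof. induction n as [|n IH]; simpl; [ring|]. rewrite IH; ring. Qed.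

Lemma rsum_le (f g : nat -> R) (n : nat) :
  (forall k, (k < n)%nat -> (f k <= g k)%R) -> (rsum f n <= rsum g n)%R.
Proof.
  induction n as [|n IH]; intros H; simpl; [lra|].
  specialize (H n) as Hn. assert (rsum f n <= rsum g n)%R by (apply IH; intros; apply H; lia).
  specialize (Hn ltac:(lia)). lra.
Qed.

Lemma rsum_pos (f : nat -> R) (n : nat) :
  (forall k, (k < n)%nat -> (0 <= f k)%R) -> (0 <= rsum f n)%R.
Proof.
  induction n as [|n IH]; intros H; simpl; [lra|].
  specialize (H n) as Hn. assert (0 <= rsum f n)%R by (apply IH; intros; apply H; lia).
  specialize (Hn ltac:(lia)). lra.
Qed.

Lemma rsum_mono (f : nat -> R) (n m : nat) :
  (forall k, (0 <= f k)%R) -> (n <= m)%nat -> (rsum f n <= rsum f m)%R.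
Proof.
  intros H Hnm. replace m with (n + (m - n))%nat by lia. rewrite rsum_add.
  assert (0 <= rsum (fun k => f (n + k)%nat) (m - n))%R by (apply rsum_pos; auto). lra.
Qed.

Lemma rsum_swap (x : nat -> nat -> R) (K M : nat) :
  rsum (fun k => rsum (x k) M) K = rsum (fun m => rsum (fun k => x k m) K) M.
Proof.
  induction K as [|K IH]; simpl.
  - induction M as [|M IHM]; simpl; [reflexivity|]. rewrite <- IHM; ring.
  - rewrite IH. symmetry. apply rsum_plus.
Qed.

Lemma csum_swap (x : nat -> nat -> C) (K M : nat) :
  csum (fun k => csum (x k) M) K = csum (fun m => csum (fun k => x k m) K) M.
Proof.
  induction K as [|K IH]; simpl.
  - induction M as [|M IHM]; simpl; [reflexivity|]. rewrite <- IHM; ring.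
  - rewrite IH. symmetry. apply csum_plus.
Qed.

Lemma Cmod_csum (f : nat -> C) (n : nat) :
  (Cmod (csum f n) <= rsum (fun k => Cmod (f k)) n)%R.
Proof.
  induction n as [|n IH]; simpl; [rewrite Cmod_0; lra|].
  eapply Rle_trans; [apply Cmod_triangle|]. lra.
Qed.

Lemma Cmod_csum_diff (f : nat -> C) (n m : nat) : (n <= m)%nat ->
  (Cmod (csum f m - csum f n) <=
   rsum (fun k => Cmod (f k)) m - rsum (fun k => Cmod (f k)) n)%R.
Proof.
  intros H. replace m with (n + (m - n))%nat by lia.
  rewrite csum_add, rsum_add.
  replace (csum f n + csum (fun k => f (n + k)%nat) (m - n) - csum f n)
    with (csum (fun k => f (n + k)%nat) (m - n)) by ring.
  pose proof (Cmod_csum (fun k => f (n + k)%nat) (m - n)). simpl in H0. lra.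
Qed.

Lemma Re_csum f n : Re (csum f n) = rsum (fun k => Re (f k)) n.
Proof. induction n as [|n IH]; simpl; [reflexivity|]. rewrite <- IH. reflexivity. Qed.
Lemma Im_csum f n : Im (csum f n) = rsum (fun k => Im (f k)) n.
Proof. induction n as [|n IH]; simpl; [reflexivity|]. rewrite <- IH. reflexivity. Qed.

Lemma csum_sum_n (a : nat -> C) (n : nat) :
  sum_n (G := C_AbelianMonoid) a n = csum a (S n).
Proof.
  induction n as [|n IH].
  - rewrite sum_O. simpl. ring.
  - rewrite sum_Sn, IH. reflexivity.
Qed.

Lemma rsum_sum_n (a : nat -> R) (n : nat) : sum_n a n = rsum a (S n).
Proof.
  induction n as [|n IH].
  - rewrite sum_O. simpl. ring.
  - rewrite sum_Sn, IH. reflexivity.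
Qed.

Lemma Csums_is_series (a : nat -> C) (l : C) :
  Csums a l <-> is_series (K := C_AbsRing) (V := C_NormedModule) a l.
Proof.
  unfold Csums, is_series. rewrite <- tends_filterlim. split; intros H eps He; destruct (H eps He) as [N HN].
  - exists N. intros n Hn. rewrite csum_sum_n. apply HN. lia.
  - exists (S N). intros n Hn. specialize (HN (pred n) ltac:(lia)).
    rewrite csum_sum_n in HN. replace (S (pred n)) with n in HN by lia. exact HN.
Qed.

Lemma Cpow_pow_n (z : C) (n : nat) : pow_n (K := C_Ring) z n = z ^ n.
Proof. induction n as [|n IH]; simpl; [reflexivity|]. rewrite IH. reflexivity. Qed.

Lemma Csums_ext (a b : nat -> C) (l : C) :
  (forall n, a n = b n) -> Csums a l -> Csums b l.
Proof.
  intros H. apply tends_ext. intros n. apply csum_ext. intros; apply H.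
Qed.

Lemma Csums_is_pseries (u : nat -> C) (z l : C) :
  Csums (fun n => u n * z ^ n) l <-> is_pseries (K := C_AbsRing) (V := C_NormedModule) u z l.
Proof.
  unfold is_pseries. rewrite <- Csums_is_series.
  assert (E : forall n, scal (pow_n (K := C_Ring) z n) (u n) = u n * z ^ n).
  { intros n. rewrite Cpow_pow_n. unfold scal. simpl. unfold mult; simpl. ring. }
  split; apply Csums_ext; intros n; [symmetry|]; apply E.
Qed.

Lemma Csums_unique (a : nat -> C) (l l' : C) : Csums a l -> Csums a l' -> l = l'.
Proof. apply tends_unique. Qed.

Lemma Csums_plus (a b : nat -> C) (la lb : C) : Csums a la -> Csums b lb ->
  Csums (fun n => a n + b n) (la + lb).
Proof.
  intros Ha Hb. apply tends_ext with (fun n => csum a n + csum b n); [intros; symmetry; apply csum_plus|].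
  apply tends_plus; assumption.
Qed.

Lemma Csums_scal (c : C) (a : nat -> C) (l : C) : Csums a l -> Csums (fun n => c * a n) (c * l).
Proof.
  intros Ha. apply tends_ext with (fun n => c * csum a n); [intros; symmetry; apply csum_scal|].
  apply tends_mult; [apply tends_const|exact Ha].
Qed.

Lemma Csums_minus (a b : nat -> C) (la lb : C) : Csums a la -> Csums b lb ->
  Csums (fun n => a n - b n) (la - lb).
Proof.
  intros Ha Hb. replace (la - lb) with (la + (-(1)) * lb) by ring.
  apply Csums_ext with (fun n => a n + (-(1)) * b n); [intros; ring|].
  apply Csums_plus; [|apply Csums_scal]; assumption.
Qed.

Lemma Csums_shift (a : nat -> C) (l : C) : Csums a l -> Csums (fun n => a (S n)) (l - a O).
Proof.
  intros Ha eps He. destruct (Ha eps He) as [N HN]. exists N. intros n Hn.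
  specialize (HN (S n) ltac:(lia)). rewrite csum_shift in HN.
  replace (csum (fun n0 => a (S n0)) n - (l - a O)) with (a O + csum (fun k => a (S k)) n - l) by ring.
  exact HN.
Qed.

Lemma Csums_unshift (a : nat -> C) (l : C) : Csums (fun n => a (S n)) l -> Csums a (a O + l).
Proof.
  intros Ha. apply (tends_ext_S (fun n => a O + csum (fun k => a (S k)) (pred n))).
  - intros n. simpl pred. rewrite csum_shift. reflexivity.
  - apply tends_plus; [apply tends_const|]. intros eps He. destruct (Ha eps He) as [N HN].
    exists (S N). intros n Hn. apply HN. lia.
Qed.

Lemma Csums_finite (a : nat -> C) N : (forall n, (N <= n)%nat -> a n = 0) -> Csums a (csum a N).
Proof.
  intros H eps He. exists N. intros n Hn. replace n with (N + (n - N))%nat by lia.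
  rewrite csum_add. rewrite (csum_0 (fun k => a (N + k)%nat)) by (intros; apply H; lia).
  replace (csum a N + 0 - csum a N) with (RtoC 0) by ring. rewrite Cmod_0. exact He.
Qed.

Lemma Csums_Cmod_le (a : nat -> C) (l z : C) (B : R) : Csums a l ->
  (exists N, forall n, (N <= n)%nat -> (Cmod (csum a n - z) <= B)%R) -> (Cmod (l - z) <= B)%R.
Proof.
  intros Ha [N0 H]. destruct (Rle_or_lt (Cmod (l - z)) B) as [|Hlt]; [assumption|exfalso].
  destruct (Ha (Cmod (l - z) - B)%R) as [N HN]; [lra|].
  specialize (HN (N0 + N)%nat ltac:(lia)). specialize (H (N0 + N)%nat ltac:(lia)).
  pose proof (Cmod_minus_triangle (csum a (N0 + N)) l z). lra.
Qed.

Lemma abs_bounded_Cmod_le (a : nat -> C) (l : C) (B : R) : abs_bounded a B -> Csums a l -> (Cmod l <= B)%R.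
Proof.
  intros Hb Hl. replace l with (l - 0) by ring.
  apply (Csums_Cmod_le a l 0 B Hl). exists O. intros n _.
  replace (csum a n - 0) with (csum a n) by ring.
  eapply Rle_trans; [apply Cmod_csum|apply Hb].
Qed.

Lemma ex_series_bounded (a : nat -> R) (B : R) :
  (forall n, (0 <= a n)%R) -> (forall n, (rsum a n <= B)%R) -> ex_series a.
Proof.
  intros Hp Hb.
  destruct (ex_finite_lim_seq_incr (fun n => sum_n a n) B) as [l Hl].
  - intros n. rewrite !rsum_sum_n. apply rsum_mono; auto.
  - intros n. rewrite rsum_sum_n. apply Hb.
  - exists l. exact Hl.
Qed.

Lemma is_series_rsum (a : nat -> R) (l : R) : is_series a l ->
  forall eps : R, (0 < eps)%R -> exists N, forall n, (N <= n)%nat -> (Rabs (rsum a n - l) < eps)%R.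
Proof.
  intros H eps He.
  assert (H' : is_lim_seq (sum_n a) l) by exact H.
  apply is_lim_seq_spec in H'. destruct (H' (mkposreal eps He)) as [N HN].
  exists (S N). intros n Hn. specialize (HN (n - 1)%nat ltac:(lia)).
  rewrite rsum_sum_n in HN. replace (S (n - 1)) with n in HN by lia. exact HN.
Qed.

Lemma Csums_Re_Im (a : nat -> C) (x y : R) :
  is_series (fun n => Re (a n)) x -> is_series (fun n => Im (a n)) y -> Csums a (x, y).
Proof.
  intros Hx Hy eps He.
  destruct (is_series_rsum _ _ Hx (eps / 2)) as [N HN]; [lra|].
  destruct (is_series_rsum _ _ Hy (eps / 2)) as [N' HN']; [lra|].
  exists (N + N')%nat. intros n Hn.
  specialize (HN n ltac:(lia)). specialize (HN' n ltac:(lia)).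
  rewrite <- Re_csum in HN. rewrite <- Im_csum in HN'.
  set (s := csum a n) in *.
  replace (s - (x, y)) with (RtoC (Re s - x) + Ci * RtoC (Im s - y))%C.
  2:{ destruct s as [u v]. apply injective_projections; simpl; ring. }
  eapply Rle_lt_trans; [apply Cmod_triangle|].
  rewrite Cmod_mult, Cmod_Ci, !Cmod_R. lra.
Qed.

Lemma Re_Cmod_le (z : C) : (Rabs (Re z) <= Cmod z)%R.
Proof. eapply Rle_trans; [|apply Rmax_Cmod]. apply Rmax_l. Qed.
Lemma Im_Cmod_le (z : C) : (Rabs (Im z) <= Cmod z)%R.
Proof. eapply Rle_trans; [|apply Rmax_Cmod]. apply Rmax_r. Qed.

Lemma abs_bounded_CSeries (a : nat -> C) (B : R) : abs_bounded a B -> Csums a (CSeries a).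
Proof.
  intros H.
  assert (E : ex_series (fun n => Cmod (a n))).
  { apply ex_series_bounded with B; [intros; apply Cmod_ge_0|exact H]. }
  apply Csums_Re_Im; apply Series_correct; apply (@ex_series_le R_AbsRing R_CompleteNormedModule _ (fun n => Cmod (a n))); auto;
    intros n; [apply Re_Cmod_le|apply Im_Cmod_le].
Qed.

Lemma Csums_CSeries (a : nat -> C) (l : C) : Csums a l -> CSeries a = l.
Proof.
  intros H. unfold CSeries. destruct l as [x y]. f_equal; apply is_series_unique.
  - assert (G : is_lim_seq (sum_n (fun n => Re (a n))) x); [|exact G].
    apply is_lim_seq_spec. intros eps. destruct (H eps (cond_pos eps)) as [N HN].
    exists N. intros n Hn. rewrite rsum_sum_n, <- Re_csum.
    specialize (HN (S n) ltac:(lia)). eapply Rle_lt_trans; [|exact HN].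
    apply (Re_Cmod_le (csum a (S n) - (x, y))).
  - assert (G : is_lim_seq (sum_n (fun n => Im (a n))) y); [|exact G].
    apply is_lim_seq_spec. intros eps. destruct (H eps (cond_pos eps)) as [N HN].
    exists N. intros n Hn. rewrite rsum_sum_n, <- Im_csum.
    specialize (HN (S n) ltac:(lia)). eapply Rle_lt_trans; [|exact HN].
    apply (Im_Cmod_le (csum a (S n) - (x, y))).
Qed.

Lemma abs_bounded_ex a B : abs_bounded a B -> exists l, Csums a l.
Proof. intros H; eexists; eapply abs_bounded_CSeries; exact H. Qed.

(** * Double series *)

Lemma csum_limit (x : nat -> nat -> C) (r : nat -> C) (K : nat) :
  (forall k, (k < K)%nat -> Csums (x k) (r k)) ->
  forall eps, (0 < eps)%R -> exists M, forall m, (M <= m)%nat ->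
    (Cmod (csum (fun k => csum (x k) m) K - csum r K) < eps)%R.
Proof.
  induction K as [|K IH]; intros H eps He.
  - exists O. intros m _. simpl. replace (0 - 0) with (RtoC 0) by ring. rewrite Cmod_0. exact He.
  - destruct (IH (fun k Hk => H k ltac:(lia)) (eps / 2)%R) as [M HM]; [lra|].
    destruct (H K ltac:(lia) (eps / 2)%R) as [M' HM']; [lra|].
    exists (M + M')%nat. intros m Hm. simpl.
    specialize (HM m ltac:(lia)). specialize (HM' m ltac:(lia)).
    replace (csum (fun k => csum (x k) m) K + csum (x K) m - (csum r K + r K))
      with ((csum (fun k => csum (x k) m) K - csum r K) + (csum (x K) m - r K)) by ring.
    eapply Rle_lt_trans; [apply Cmod_triangle|]. lra.
Qed.

Lemma rsum_limit_le (x : nat -> nat -> C) (r : nat -> C) (B : R) :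
  (forall k, Csums (x k) (r k)) ->
  (forall K M, (rsum (fun k => Cmod (csum (x k) M)) K <= B)%R) -> abs_bounded r B.
Proof.
  intros Hr HB K. apply le_epsilon. intros eps He.
  assert (Hlim : forall K' d, (0 < d)%R -> exists M, forall m, (M <= m)%nat ->
     (rsum (fun k => Cmod (r k)) K' <= rsum (fun k => Cmod (csum (x k) m)) K' + d)%R).
  { intros K'. induction K' as [|K' IH]; intros d Hd.
    - exists O. intros; simpl; lra.
    - destruct (IH (d / 2)%R ltac:(lra)) as [M HM]. destruct (Hr K' (d / 2)%R ltac:(lra)) as [M' HM'].
      exists (M + M')%nat. intros m Hm. specialize (HM m ltac:(lia)). specialize (HM' m ltac:(lia)).
      simpl.
      assert (Cmod (r K') <= Cmod (csum (x K') m) + Cmod (csum (x K') m - r K'))%R.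
      { replace (r K') with (csum (x K') m + - (csum (x K') m - r K')) at 1 by ring.
        eapply Rle_trans; [apply Cmod_triangle|]. rewrite Cmod_opp. lra. }
      lra. }
  destruct (Hlim K eps He) as [M HM]. specialize (HM M (le_n _)). specialize (HB K M). lra.
Qed.

(** Rectangular partial sums of absolute values are bounded, hence almost attain
    their supremum on one rectangle; all larger rectangles then differ little, and
    so do both iterated sums. *)
Theorem Csums_Fubini (x : nat -> nat -> C) (B : R) (r c : nat -> C) :
  (forall K M, (rsum (fun k => rsum (fun m => Cmod (x k m)) M) K <= B)%R) ->
  (forall k, Csums (x k) (r k)) ->
  (forall m, Csums (fun k => x k m) (c m)) ->
  exists T, Csums r T /\ Csums c T.
Proof.
  intros HB Hr Hc.
  set (A := fun K M => rsum (fun k => rsum (fun m => Cmod (x k m)) M) K) in *.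
  set (s := fun K M => csum (fun k => csum (x k) M) K).
  assert (HA0 : forall K M K' M', (K <= K')%nat -> (M <= M')%nat ->
    (Cmod (s K' M' - s K M) <= A K' M' - A K M)%R).
  { intros K M K' M' HK HM.
    replace (s K' M' - s K M) with ((s K' M' - s K M') + (s K M' - s K M)) by ring.
    eapply Rle_trans; [apply Cmod_triangle|].
    assert (H1 : (Cmod (s K' M' - s K M') <= A K' M' - A K M')%R).
    { unfold s. eapply Rle_trans; [apply Cmod_csum_diff; exact HK|].
      unfold A. replace K' with (K + (K' - K))%nat by lia. rewrite !rsum_add.
      assert (rsum (fun k => Cmod (csum (x (K + k)%nat) M')) (K' - K) <=
              rsum (fun k => rsum (fun m => Cmod (x (K + k)%nat m)) M') (K' - K))%R
        by (apply rsum_le; intros; apply Cmod_csum). lra. }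
    assert (H2 : (Cmod (s K M' - s K M) <= A K M' - A K M)%R).
    { unfold s, A. rewrite <- csum_minus. eapply Rle_trans; [apply Cmod_csum|].
      clear - HM. induction K as [|K IH]; simpl; [lra|].
      pose proof (Cmod_csum_diff (x K) M M' HM). lra. }
    lra. }
  (* a rectangle on which the absolute sums are nearly maximal *)
  assert (Hsup : forall eps, (0 < eps)%R -> exists K0 M0, forall K M, (A K M <= A K0 M0 + eps)%R).
  { set (E := fun v => exists K M, v = A K M).
    destruct (completeness E) as [L [HL1 HL2]].
    - exists B. intros v [K [M ->]]. apply HB.
    - exists (A O O). exists O, O; reflexivity.
    - intros eps He.
      destruct (Classical_Prop.classic (exists K0 M0, (L - eps < A K0 M0)%R)) as [[K0 [M0 H0]]|Hn].
      + exists K0, M0. intros K M. assert (A K M <= L)%R by (apply HL1; exists K, M; reflexivity). lra.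
      + exfalso. assert (L <= L - eps)%R; [|lra]. apply HL2. intros v [K [M ->]].
        apply Rnot_lt_le. intros Hlt. apply Hn. exists K, M. exact Hlt. }
  assert (HAm : forall K M K' M', (K <= K')%nat -> (M <= M')%nat -> (A K M <= A K' M')%R).
  { intros K M K' M' HK HM. pose proof (HA0 K M K' M' HK HM).
    pose proof (Cmod_ge_0 (s K' M' - s K M)). lra. }
  assert (Hnear : forall eps, (0 < eps)%R -> exists N z,
    (forall K, (N <= K)%nat -> (Cmod (csum r K - z) <= eps)%R) /\
    (forall M, (N <= M)%nat -> (Cmod (csum c M - z) <= eps)%R)).
  { intros eps He. destruct (Hsup eps He) as [K0 [M0 H0]].
    exists (K0 + M0)%nat, (s K0 M0).
    assert (Hs : forall K M, (K0 <= K)%nat -> (M0 <= M)%nat -> (Cmod (s K M - s K0 M0) <= eps)%R).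
    { intros K M HK HM. pose proof (HA0 _ _ _ _ HK HM). specialize (H0 K M). lra. }
    split.
    - intros K HK. apply Rnot_lt_le. intros Hlt.
      destruct (csum_limit x r K (fun k _ => Hr k) (Cmod (csum r K - s K0 M0) - eps)%R) as [M HM]; [lra|].
      specialize (HM (M + M0)%nat ltac:(lia)). specialize (Hs K (M + M0)%nat ltac:(lia) ltac:(lia)).
      fold (s K (M + M0)%nat) in HM.
      pose proof (Cmod_minus_triangle (s K (M + M0)%nat) (csum r K) (s K0 M0)). lra.
    - intros M HM. apply Rnot_lt_le. intros Hlt.
      destruct (csum_limit (fun m k => x k m) c M (fun k _ => Hc k) (Cmod (csum c M - s K0 M0) - eps)%R) as [K HK]; [lra|].
      specialize (HK (K + K0)%nat ltac:(lia)). specialize (Hs (K + K0)%nat M ltac:(lia) ltac:(lia)).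
      rewrite <- csum_swap in HK. fold (s (K + K0)%nat M) in HK.
      pose proof (Cmod_minus_triangle (s (K + K0)%nat M) (csum c M) (s K0 M0)). lra. }
  assert (Hrb : abs_bounded r B).
  { intros K. apply (rsum_limit_le x r B Hr). intros K' M.
    apply Rle_trans with (A K' M); [|apply HB]. apply rsum_le. intros; apply Cmod_csum. }
  exists (CSeries r). pose proof (abs_bounded_CSeries r B Hrb) as HT. split; [exact HT|].
  intros eps He. destruct (Hnear (eps / 4)%R ltac:(lra)) as [N [z [H1 H2]]].
  assert (Cmod (CSeries r - z) <= eps / 4)%R.
  { apply (Csums_Cmod_le r _ z _ HT). exists N. exact H1. }
  exists N. intros M HM. specialize (H2 M HM).
  replace (csum c M - CSeries r) with ((csum c M - z) + - (CSeries r - z)) by ring.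
  eapply Rle_lt_trans; [apply Cmod_triangle|]. rewrite Cmod_opp. lra.
Qed.

Definition rect_bounded (y : nat -> nat -> C) (B : R) : Prop :=
  forall K M, (rsum (fun k => rsum (fun m => Cmod (y k m)) M) K <= B)%R.

Lemma Csums_delay (f : nat -> C) (l : C) (k : nat) : Csums f l ->
  Csums (fun n => if (k <=? n)%nat then f (n - k)%nat else 0) l.
Proof.
  revert f l; induction k as [|k IH]; intros f l H.
  - apply Csums_ext with f; [|exact H]. intros n. simpl. rewrite Nat.sub_0_r. reflexivity.
  - replace l with (0 + l) by ring.
    apply (Csums_unshift (fun n => if (S k <=? n)%nat then f (n - S k)%nat else 0)).
    apply Csums_ext with (fun n => if (k <=? n)%nat then f (n - k)%nat else 0); [|apply IH; exact H].
    intros n. reflexivity.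
Qed.

Lemma rsum_delay (f : nat -> R) (k M : nat) : (forall n, (0 <= f n)%R) ->
  (rsum (fun n => if (k <=? n)%nat then f (n - k)%nat else 0%R) M <= rsum f M)%R.
Proof.
  intros Hf. revert M; induction k as [|k IH]; intros M.
  - right. apply rsum_ext. intros n _. simpl. rewrite Nat.sub_0_r. reflexivity.
  - destruct M as [|M]; [simpl; lra|]. rewrite rsum_shift.
    apply Rle_trans with (0 + rsum f M)%R.
    + apply Rplus_le_compat; [simpl; lra|]. exact (IH M).
    + simpl. specialize (Hf M). lra.
Qed.

(** [Csums_Fubini] for the family whose rows are delayed by their index: its columns are the
    antidiagonals, which are finite. *)
Theorem Csums_antidiagonal (y : nat -> nat -> C) (B : R) (r : nat -> C) :
  rect_bounded y B -> (forall k, Csums (y k) (r k)) ->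
  exists T, Csums r T /\ Csums (fun n => csum (fun k => y k (n - k)%nat) (S n)) T.
Proof.
  intros HB Hr.
  set (x := fun k n => if (k <=? n)%nat then y k (n - k)%nat else 0).
  destruct (Csums_Fubini x B r (fun n => csum (fun k => y k (n - k)%nat) (S n))) as [T [H1 H2]].
  - intros K M. eapply Rle_trans; [|apply (HB K M)]. apply rsum_le. intros k _.
    eapply Rle_trans; [|apply (rsum_delay (fun m => Cmod (y k m)) k M); intros; apply Cmod_ge_0].
    right. apply rsum_ext. intros n _. unfold x. destruct (k <=? n)%nat; [reflexivity|apply Cmod_0].
  - intros k. apply Csums_delay, Hr.
  - intros n. replace (csum (fun k => y k (n - k)%nat) (S n)) with (csum (fun k => x k n) (S n)).
    + apply Csums_finite. intros k Hk. unfold x.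
      destruct (Nat.leb_spec k n); [lia|reflexivity].
    + apply csum_ext. intros k Hk. unfold x. destruct (Nat.leb_spec k n); [reflexivity|lia].
  - exists T. split; assumption.
Qed.

Lemma abs_bounded_antidiagonal (y : nat -> nat -> C) (B : R) : rect_bounded y B ->
  abs_bounded (fun n => csum (fun k => y k (n - k)%nat) (S n)) B.
Proof.
  intros HB N.
  apply Rle_trans with (rsum (fun n => rsum (fun k => if (k <=? n)%nat then Cmod (y k (n - k)%nat) else 0%R) N) N).
  - apply rsum_le. intros n Hn. eapply Rle_trans; [apply Cmod_csum|].
    replace N with (S n + (N - S n))%nat by lia. rewrite rsum_add.
    apply Rle_trans with (rsum (fun k => if (k <=? n)%nat then Cmod (y k (n - k)%nat) else 0%R) (S n) + 0)%R.
    + rewrite Rplus_0_r. right. apply rsum_ext. intros k Hk. destruct (Nat.leb_spec k n); [reflexivity|lia].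
    + apply Rplus_le_compat_l, rsum_pos. intros k _. destruct (_ <=? _)%nat; [apply Cmod_ge_0|lra].
  - rewrite rsum_swap. eapply Rle_trans; [|apply (HB N N)]. apply rsum_le. intros k _.
    apply (rsum_delay (fun m => Cmod (y k m)) k N). intros; apply Cmod_ge_0.
Qed.

Lemma rect_bounded_prod (a b : nat -> C) (A B : R) : abs_bounded a A -> abs_bounded b B ->
  rect_bounded (fun k m => a k * b m) (A * B).
Proof.
  intros HA HB K M.
  apply Rle_trans with (rsum (fun k => B * Cmod (a k))%R K).
  - apply rsum_le. intros k _.
    rewrite (rsum_ext _ (fun m => Cmod (a k) * Cmod (b m))%R) by (intros; apply Cmod_mult).
    rewrite rsum_scal, (Rmult_comm B). apply Rmult_le_compat_l; [apply Cmod_ge_0|apply HB].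
  - rewrite rsum_scal, (Rmult_comm A). apply Rmult_le_compat_l; [|apply HA].
    exact (HB O).
Qed.

Definition conv (a b : nat -> C) (n : nat) : C := csum (fun k => a k * b (n - k)%nat) (S n).

Lemma Csums_conv (a b : nat -> C) (A B : R) (la lb : C) :
  abs_bounded a A -> abs_bounded b B -> Csums a la -> Csums b lb -> Csums (conv a b) (la * lb).
Proof.
  intros HA HB Ha Hb.
  destruct (Csums_antidiagonal (fun k m => a k * b m) (A * B)%R (fun k => a k * lb)) as [T [H1 H2]].
  - apply rect_bounded_prod; assumption.
  - intros k. apply Csums_scal, Hb.
  - replace (la * lb) with T; [exact H2|].
    apply (Csums_unique (fun k => a k * lb)); [exact H1|].
    apply Csums_ext with (fun k => lb * a k); [intros; ring|].
    rewrite (Cmult_comm la). apply Csums_scal, Ha.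
Qed.

Lemma abs_bounded_conv (a b : nat -> C) (A B : R) :
  abs_bounded a A -> abs_bounded b B -> abs_bounded (conv a b) (A * B).
Proof.
  intros HA HB. apply (abs_bounded_antidiagonal (fun k m => a k * b m)).
  apply rect_bounded_prod; assumption.
Qed.

Lemma conv_pow (u v : nat -> C) (h : C) (n : nat) :
  conv (fun k => u k * h ^ k) (fun k => v k * h ^ k) n = conv u v n * h ^ n.
Proof.
  unfold conv. rewrite Cmult_comm, <- csum_scal. apply csum_ext. intros k Hk.
  replace (h ^ n) with (h ^ k * h ^ (n - k)) by (rewrite <- Cpow_add_r; f_equal; lia). ring.
Qed.

Lemma abs_bounded_le (a b : nat -> C) (B : R) :
  (forall n, (Cmod (a n) <= Cmod (b n))%R) -> abs_bounded b B -> abs_bounded a B.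
Proof. intros H Hb n. eapply Rle_trans; [|apply (Hb n)]. apply rsum_le. intros; apply H. Qed.

Lemma abs_bounded_term (a : nat -> C) (B : R) (n : nat) : abs_bounded a B -> (Cmod (a n) <= B)%R.
Proof.
  intros H. specialize (H (S n)). simpl in H.
  assert (0 <= rsum (fun k => Cmod (a k)) n)%R by (apply rsum_pos; intros; apply Cmod_ge_0). lra.
Qed.

Lemma rsum_geom (M q : R) (n : nat) : (0 <= M)%R -> (0 <= q < 1)%R ->
  (rsum (fun k => M * q ^ k) n <= M / (1 - q))%R.
Proof.
  intros HM Hq.
  assert (E : (rsum (fun k => M * q ^ k) n = M * (1 - q ^ n) / (1 - q))%R).
  { induction n as [|n IH]; simpl; [field; lra|]. rewrite IH. field. lra. }
  rewrite E. unfold Rdiv. apply Rmult_le_compat_r.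
  - left; apply Rinv_0_lt_compat; lra.
  - assert (0 <= q ^ n)%R by (apply pow_le; lra). nra.
Qed.

Lemma abs_bounded_geom (a : nat -> C) (M q : R) : (0 <= q < 1)%R ->
  (forall n, (Cmod (a n) <= M * q ^ n)%R) -> abs_bounded a (M / (1 - q)).
Proof.
  intros Hq H n. eapply Rle_trans; [apply rsum_le; intros k _; apply H|].
  apply rsum_geom; [|exact Hq]. specialize (H O). simpl in H. pose proof (Cmod_ge_0 (a O)). lra.
Qed.

Lemma Csums_term_bounded (a : nat -> C) (l : C) : Csums a l -> exists M, forall n, (Cmod (a n) <= M)%R.
Proof.
  intros H. destruct (H 1%R ltac:(lra)) as [N HN].
  exists (rsum (fun k => Cmod (a k)) N + 2)%R. intros n.
  destruct (Nat.lt_ge_cases n N) as [Hlt|Hge].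
  - assert (Cmod (a n) <= rsum (fun k => Cmod (a k)) N)%R; [|lra].
    apply Rle_trans with (rsum (fun k => Cmod (a k)) (S n)).
    + simpl. assert (0 <= rsum (fun k => Cmod (a k)) n)%R by (apply rsum_pos; intros; apply Cmod_ge_0). lra.
    + apply rsum_mono; [intros; apply Cmod_ge_0|lia].
  - pose proof (HN n Hge) as H1. pose proof (HN (S n) ltac:(lia)) as H2.
    replace (a n) with ((csum a (S n) - l) + - (csum a n - l)) by (simpl; ring).
    assert (0 <= rsum (fun k => Cmod (a k)) N)%R by (apply rsum_pos; intros; apply Cmod_ge_0).
    eapply Rle_trans; [apply Cmod_triangle|]. rewrite Cmod_opp. lra.
Qed.

Lemma pseries_geom_bound (u : nat -> C) (s : R) (l : C) : Csums (fun n => u n * (RtoC s) ^ n) l ->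
  forall t z, (0 <= t < s)%R -> (Cmod z <= t)%R ->
  exists M, forall n, (Cmod (u n * z ^ n) <= M * (t / s) ^ n)%R.
Proof.
  intros H t z Ht Hz. destruct (Csums_term_bounded _ _ H) as [M HM]. exists M. intros n.
  rewrite Cmod_mult, Cmod_pow. specialize (HM n). rewrite Cmod_mult, Cmod_pow, Cmod_R, Rabs_pos_eq in HM by lra.
  assert (0 < s ^ n)%R by (apply pow_lt; lra).
  unfold Rdiv. rewrite Rpow_mult_distr, pow_inv.
  apply Rle_trans with (Cmod (u n) * t ^ n)%R.
  - apply Rmult_le_compat_l; [apply Cmod_ge_0|]. apply pow_incr. split; [apply Cmod_ge_0|lra].
  - replace (Cmod (u n) * t ^ n)%R with (Cmod (u n) * s ^ n * (t ^ n * / s ^ n))%R by (field; lra).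
    rewrite (Rmult_comm M). rewrite (Rmult_comm (_ * _)%R).
    apply Rmult_le_compat_l; [|exact HM].
    apply Rmult_le_pos; [apply pow_le; lra|left; apply Rinv_0_lt_compat; lra].
Qed.

(** The terms are bounded at a slightly larger radius, whence a geometric majorant. *)
Lemma pseries_abs_bounded (u : nat -> C) (r t : R) :
  (forall z, (Cmod z < r)%R -> exists l, Csums (fun n => u n * z ^ n) l) -> (0 <= t < r)%R ->
  exists B, abs_bounded (fun n => u n * (RtoC t) ^ n) B.
Proof.
  intros H Ht. set (s := ((t + r) / 2)%R).
  destruct (H (RtoC s)) as [l Hl]; [rewrite Cmod_R, Rabs_pos_eq; unfold s; lra|].
  destruct (pseries_geom_bound u s l Hl t (RtoC t)) as [M HM].
  - unfold s; lra.
  - rewrite Cmod_R, Rabs_pos_eq; lra.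
  - exists (M / (1 - t / s))%R. apply abs_bounded_geom; [|exact HM].
    assert (0 < s)%R by (unfold s; lra).
    split; [apply Rdiv_le_0_compat; lra|].
    apply Rmult_lt_reg_r with s; [lra|]. unfold Rdiv. rewrite Rmult_assoc, Rinv_l by lra. unfold s; lra.
Qed.

Lemma abs_bounded_pow_le (u : nat -> C) (z : C) (t B : R) : (Cmod z <= t)%R ->
  abs_bounded (fun n => u n * (RtoC t) ^ n) B -> abs_bounded (fun n => u n * z ^ n) B.
Proof.
  intros Hz. apply abs_bounded_le. intros n. rewrite !Cmod_mult, !Cmod_pow, Cmod_R.
  pose proof (Cmod_ge_0 z). rewrite Rabs_pos_eq by lra.
  apply Rmult_le_compat_l; [apply Cmod_ge_0|]. apply pow_incr. lra.
Qed.

(** * Analytic functions *)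

Definition analytic_at (f : C -> C) (z0 : C) : Prop :=
  exists (r : R) (u : nat -> C), (0 < r)%R /\
    forall z : C, (Cmod (z - z0) < r)%R ->
      is_pseries (K := C_AbsRing) (V := C_NormedModule) u (z - z0) (f z).

Lemma analytic_at_intro (f : C -> C) (z0 : C) (r : R) (u : nat -> C) : (0 < r)%R ->
  (forall h, (Cmod h < r)%R -> Csums (fun n => u n * h ^ n) (f (z0 + h))) -> analytic_at f z0.
Proof.
  intros Hr H. exists r, u. split; [exact Hr|]. intros z Hz. apply Csums_is_pseries.
  replace (f z) with (f (z0 + (z - z0))) by (f_equal; ring). apply H, Hz.
Qed.

Lemma analytic_at_elim (f : C -> C) (z0 : C) : analytic_at f z0 ->
  exists r u, (0 < r)%R /\ forall h, (Cmod h < r)%R -> Csums (fun n => u n * h ^ n) (f (z0 + h)).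
Proof.
  intros [r [u [Hr H]]]. exists r, u. split; [exact Hr|]. intros h Hh.
  assert (E : z0 + h - z0 = h) by ring.
  specialize (H (z0 + h)). rewrite E in H. apply Csums_is_pseries, H, Hh.
Qed.

Lemma Csums_pow0 (u : nat -> C) : Csums (fun n => u n * 0 ^ n) (u O).
Proof.
  replace (u O) with (csum (fun n => u n * 0 ^ n) 1) by (simpl; ring).
  apply Csums_finite. intros n Hn. destruct n as [|n]; [lia|]. simpl. ring.
Qed.

Lemma pseries_coef0 (u : nat -> C) (l : C) : Csums (fun n => u n * 0 ^ n) l -> l = u O.
Proof. intros H. exact (Csums_unique _ _ _ H (Csums_pow0 u)). Qed.

Lemma analytic_at_ext_loc (f g : C -> C) (z0 : C) (e : R) : (0 < e)%R ->
  (forall h, (Cmod h < e)%R -> f (z0 + h) = g (z0 + h)) -> analytic_at f z0 -> analytic_at g z0.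
Proof.
  intros He Hfg Hf. apply analytic_at_elim in Hf. destruct Hf as [r [u [Hr H]]].
  apply (analytic_at_intro g z0 (Rmin r e) u); [apply Rmin_pos; assumption|].
  intros h Hh. rewrite <- Hfg.
  - apply H. eapply Rlt_le_trans; [exact Hh|apply Rmin_l].
  - eapply Rlt_le_trans; [exact Hh|apply Rmin_r].
Qed.

Lemma analytic_at_ext (f g : C -> C) (z0 : C) : (forall z, f z = g z) -> analytic_at f z0 -> analytic_at g z0.
Proof. intros H. apply (analytic_at_ext_loc f g z0 1); [lra|auto]. Qed.

Lemma analytic_at_const (c z0 : C) : analytic_at (fun _ => c) z0.
Proof.
  apply (analytic_at_intro _ z0 1 (fun n => match n with O => c | _ => 0 end)); [lra|].
  intros h _.
  pose proof (Csums_finite (fun n => match n with O => c | _ => 0 end * h ^ n) 1) as E.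
  replace (csum _ 1) with c in E by (simpl; ring).
  apply E. intros [|n] Hn; [lia|ring].
Qed.

Lemma analytic_at_id (z0 : C) : analytic_at (fun z => z) z0.
Proof.
  apply (analytic_at_intro _ z0 1 (fun n => match n with O => z0 | S O => 1 | _ => 0 end)); [lra|].
  intros h _.
  replace (z0 + h) with (csum (fun n => match n with O => z0 | S O => 1 | _ => 0 end * h ^ n) 2) by (simpl; ring).
  apply Csums_finite. intros [|[|n]] Hn; [lia|lia|ring].
Qed.

Lemma analytic_at_plus (f g : C -> C) (z0 : C) :
  analytic_at f z0 -> analytic_at g z0 -> analytic_at (fun z => f z + g z) z0.
Proof.
  intros Hf Hg. apply analytic_at_elim in Hf, Hg.
  destruct Hf as [r [u [Hr H]]]. destruct Hg as [r' [v [Hr' H']]].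
  apply (analytic_at_intro _ z0 (Rmin r r') (fun n => u n + v n)); [apply Rmin_pos; assumption|].
  intros h Hh. apply Csums_ext with (fun n => u n * h ^ n + v n * h ^ n); [intros; ring|].
  apply Csums_plus; [apply H|apply H']; (eapply Rlt_le_trans; [exact Hh|]); [apply Rmin_l|apply Rmin_r].
Qed.

Lemma analytic_at_mult (f g : C -> C) (z0 : C) :
  analytic_at f z0 -> analytic_at g z0 -> analytic_at (fun z => f z * g z) z0.
Proof.
  intros Hf Hg. apply analytic_at_elim in Hf, Hg.
  destruct Hf as [r [u [Hr H]]]. destruct Hg as [r' [v [Hr' H']]].
  set (t := (Rmin r r' / 2)%R).
  assert (Ht : (0 < t)%R /\ (t < r)%R /\ (t < r')%R).
  { pose proof (Rmin_pos r r' Hr Hr'). pose proof (Rmin_l r r'). pose proof (Rmin_r r r'). unfold t. lra. }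
  destruct (pseries_abs_bounded u r t) as [A HA]; [intros z Hz; eexists; apply H, Hz|lra|].
  destruct (pseries_abs_bounded v r' t) as [B HB]; [intros z Hz; eexists; apply H', Hz|lra|].
  apply (analytic_at_intro _ z0 t (conv u v)); [lra|].
  intros h Hh. apply Csums_ext with (conv (fun k => u k * h ^ k) (fun k => v k * h ^ k)); [intros; apply conv_pow|].
  apply Csums_conv with A B.
  - apply abs_bounded_pow_le with t; [lra|exact HA].
  - apply abs_bounded_pow_le with t; [lra|exact HB].
  - apply H. lra.
  - apply H'. lra.
Qed.

Lemma analytic_at_opp (f : C -> C) (z0 : C) : analytic_at f z0 -> analytic_at (fun z => - f z) z0.
Proof.
  intros H. apply (analytic_at_ext (fun z => (-(1)) * f z)); [intros; ring|].
  apply analytic_at_mult; [apply analytic_at_const|exact H].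
Qed.

Lemma analytic_at_minus (f g : C -> C) (z0 : C) :
  analytic_at f z0 -> analytic_at g z0 -> analytic_at (fun z => f z - g z) z0.
Proof. intros Hf Hg. apply analytic_at_plus; [exact Hf|apply analytic_at_opp, Hg]. Qed.

Fixpoint conv_power (b : nat -> C) (n : nat) : nat -> C :=
  match n with
  | O => fun m => match m with O => 1 | _ => 0 end
  | S p => conv b (conv_power b p)
  end.

Lemma conv_power_bounded (b : nat -> C) (t A : R) :
  abs_bounded (fun m => b m * (RtoC t) ^ m) A ->
  forall n, abs_bounded (fun m => conv_power b n m * (RtoC t) ^ m) (A ^ n).
Proof.
  intros H n. induction n as [|n IH].
  - intros N. simpl. destruct N as [|N]; [simpl; lra|]. rewrite rsum_shift.
    simpl. rewrite Cmult_1_l, Cmod_1.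
    rewrite (rsum_ext _ (fun _ => 0%R)) by (intros; rewrite Cmult_0_l; apply Cmod_0).
    assert (E : rsum (fun _ => 0%R) N = 0%R) by (clear; induction N; simpl; lra). rewrite E. lra.
  - pose proof (abs_bounded_conv _ _ _ _ H IH) as G.
    apply abs_bounded_le with (2 := G). intros m. simpl conv_power. rewrite conv_pow. lra.
Qed.

Lemma conv_power_sums (b : nat -> C) (t A : R) (h l : C) : (Cmod h <= t)%R ->
  abs_bounded (fun m => b m * (RtoC t) ^ m) A -> Csums (fun m => b m * h ^ m) l ->
  forall n, Csums (fun m => conv_power b n m * h ^ m) (l ^ n).
Proof.
  intros Hh HA Hl n. induction n as [|n IH].
  - replace (l ^ 0) with (csum (fun m => conv_power b 0 m * h ^ m) 1) by (simpl; ring).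
    apply Csums_finite. intros [|m] Hm; [lia|simpl; ring].
  - simpl conv_power. rewrite Cpow_S.
    apply Csums_ext with (conv (fun k => b k * h ^ k) (fun k => conv_power b n k * h ^ k));
      [intros; apply conv_pow|].
    apply Csums_conv with A (A ^ n)%R; [| |exact Hl|exact IH].
    + apply abs_bounded_pow_le with t; assumption.
    + apply abs_bounded_pow_le with t; [exact Hh|]. apply conv_power_bounded, HA.
Qed.

(** Substitution of a power series into a power series: near the base point the sum of
    the absolute values of the inner series stays inside the outer disk, so the double
    series of the powers may be reordered. *)
Lemma analytic_at_pseries_comp (d : nat -> C) (rho : R) (f g : C -> C) (z0 : C) :
  (forall w, (Cmod w < rho)%R -> Csums (fun n => d n * w ^ n) (f w)) ->
  (Cmod (g z0) < rho)%R -> analytic_at g z0 -> analytic_at (fun z => f (g z)) z0.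
Proof.
  intros Hf H0 Hg. apply analytic_at_elim in Hg. destruct Hg as [r [b [Hr Hg]]].
  assert (Hb0 : g z0 = b O).
  { apply pseries_coef0. replace (g z0) with (g (z0 + 0)) by (f_equal; ring).
    apply Hg. rewrite Cmod_0; lra. }
  destruct (pseries_abs_bounded b r (r / 2)) as [B HB]; [intros z Hz; eexists; apply Hg, Hz|lra|].
  assert (HBpos : (0 <= B)%R) by (exact (HB O)).
  set (A := ((Cmod (b O) + rho) / 2)%R).
  assert (HA : (Cmod (b O) < A < rho)%R) by (rewrite Hb0 in H0; unfold A; lra).
  (* on the disk of radius q r/2 the inner absolute sum exceeds |b 0| by at most q B *)
  set (q := Rmin 1 ((A - Cmod (b O)) / (B + 1))%R).
  assert (Hq : (0 < q <= 1)%R /\ (q * B <= A - Cmod (b O))%R).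
  { assert (0 < (A - Cmod (b O)) / (B + 1))%R by (apply Rdiv_lt_0_compat; lra).
    unfold q. split; [split; [apply Rmin_pos; lra|apply Rmin_l]|].
    apply Rle_trans with ((A - Cmod (b O)) / (B + 1) * B)%R.
    - apply Rmult_le_compat_r; [lra|apply Rmin_r].
    - apply Rle_trans with ((A - Cmod (b O)) / (B + 1) * (B + 1))%R.
      + apply Rmult_le_compat_l; lra.
      + right; field; lra. }
  set (t := (q * (r / 2))%R).
  assert (Ht : (0 < t < r)%R) by (unfold t; nra).
  assert (HAt : abs_bounded (fun m => b m * (RtoC t) ^ m) A).
  { intros n. destruct n as [|n]; [simpl; pose proof (Cmod_ge_0 (b O)); lra|].
    rewrite rsum_shift. simpl (Cmod (b 0%nat * _)). rewrite Cmult_1_r.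
    assert (rsum (fun k => Cmod (b (S k) * RtoC t ^ S k)) n <= q * B)%R; [|lra].
    apply Rle_trans with (q * rsum (fun k => Cmod (b (S k) * RtoC (r / 2) ^ S k)) n)%R.
    - rewrite <- rsum_scal. apply rsum_le. intros k _.
      rewrite !Cmod_mult, !Cmod_pow, !Cmod_R, !Rabs_pos_eq by lra.
      rewrite (Rmult_comm q), Rmult_assoc. apply Rmult_le_compat_l; [apply Cmod_ge_0|].
      unfold t. rewrite Rpow_mult_distr, (Rmult_comm (q ^ _)%R).
      apply Rmult_le_compat_l; [apply pow_le; lra|].
      simpl. assert (q ^ k <= 1)%R by (rewrite <- (pow1 k); apply pow_incr; lra).
      assert (0 <= q ^ k)%R by (apply pow_le; lra). nra.
    - apply Rmult_le_compat_l; [lra|]. specialize (HB (S n)). rewrite rsum_shift in HB.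
      pose proof (Cmod_ge_0 (b 0%nat * RtoC (r / 2) ^ 0)). lra. }
  destruct (pseries_abs_bounded d rho A) as [Dd HDd];
    [intros z Hz; eexists; apply Hf, Hz|pose proof (Cmod_ge_0 (b O)); lra|].
  assert (HA0 : (0 <= A)%R) by (pose proof (Cmod_ge_0 (b O)); lra).
  apply (analytic_at_intro _ z0 t (fun m => CSeries (fun n => d n * conv_power b n m))); [lra|].
  intros h Hh.
  assert (Hgl : Csums (fun m => b m * h ^ m) (g (z0 + h))) by (apply Hg; lra).
  assert (Hgm : (Cmod (g (z0 + h)%C) <= A)%R).
  { apply abs_bounded_Cmod_le with (2 := Hgl). apply abs_bounded_pow_le with t; [lra|exact HAt]. }
  assert (Hpb : forall n, abs_bounded (fun m => conv_power b n m * (RtoC t) ^ m) (A ^ n))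
    by (apply conv_power_bounded, HAt).
  destruct (Csums_Fubini (fun n m => d n * (conv_power b n m * h ^ m)) Dd
    (fun n => d n * g (z0 + h) ^ n)
    (fun m => CSeries (fun n => d n * conv_power b n m) * h ^ m)) as [T [H1 H2]].
  - intros K M. eapply Rle_trans; [|apply (HDd K)]. apply rsum_le. intros n _.
    rewrite (rsum_ext _ (fun m => Cmod (d n) * Cmod (conv_power b n m * h ^ m))%R) by (intros; apply Cmod_mult).
    rewrite rsum_scal, Cmod_mult, Cmod_pow, Cmod_R, Rabs_pos_eq by lra.
    apply Rmult_le_compat_l; [apply Cmod_ge_0|].
    apply (abs_bounded_pow_le _ h t); [lra|apply Hpb].
  - intros n. apply Csums_scal. apply conv_power_sums with t A; [lra|exact HAt|exact Hgl].
  - intros m. apply Csums_ext with (fun n => h ^ m * (d n * conv_power b n m)); [intros; ring|].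
    rewrite Cmult_comm. apply Csums_scal.
    assert (Htm : (0 < t ^ m)%R) by (apply pow_lt; lra).
    apply abs_bounded_CSeries with (/ t ^ m * Dd)%R. intros N.
    apply Rle_trans with (rsum (fun n => / t ^ m * Cmod (d n * (RtoC A) ^ n))%R N).
    + apply rsum_le. intros n _. rewrite !Cmod_mult, Cmod_pow, Cmod_R, Rabs_pos_eq by lra.
      rewrite (Rmult_comm (/ _)%R), Rmult_assoc. apply Rmult_le_compat_l; [apply Cmod_ge_0|].
      pose proof (abs_bounded_term _ _ m (Hpb n)) as E. cbv beta in E. rewrite Cmod_mult, Cmod_pow, Cmod_R, Rabs_pos_eq in E by lra.
      apply Rmult_le_reg_r with (t ^ m)%R; [exact Htm|].
      rewrite Rmult_assoc, Rinv_l by lra. lra.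
    + rewrite rsum_scal. apply Rmult_le_compat_l; [left; apply Rinv_0_lt_compat; exact Htm|apply HDd].
  - replace (f (g (z0 + h))) with T; [exact H2|].
    apply (Csums_unique _ _ _ H1). apply Hf. lra.
Qed.

Lemma analytic_at_comp (f g : C -> C) (z0 : C) :
  analytic_at f (g z0) -> analytic_at g z0 -> analytic_at (fun z => f (g z)) z0.
Proof.
  intros Hf Hg. apply analytic_at_elim in Hf. destruct Hf as [r [u [Hr H]]].
  apply (analytic_at_ext (fun z => f (g z0 + (g z - g z0)))); [intros; f_equal; ring|].
  apply (analytic_at_pseries_comp u r (fun w => f (g z0 + w)) (fun z => g z - g z0)); [exact H| |].
  - replace (g z0 - g z0) with (RtoC 0) by ring. rewrite Cmod_0. exact Hr.
  - apply analytic_at_minus; [exact Hg|apply analytic_at_const].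
Qed.

(** Recentring at [z0] is substitution of the series [z0 + h]. *)
Lemma analytic_at_pseries (d : nat -> C) (rho : R) (f : C -> C) (z0 : C) :
  (forall w, (Cmod w < rho)%R -> Csums (fun n => d n * w ^ n) (f w)) ->
  (Cmod z0 < rho)%R -> analytic_at f z0.
Proof.
  intros Hf H0. apply (analytic_at_pseries_comp d rho f (fun z => z) z0 Hf H0), analytic_at_id.
Qed.

Lemma Csums_geom (q : C) : (Cmod q < 1)%R -> Csums (fun n => q ^ n) (/ (1 - q)).
Proof.
  intros Hq. pose proof (Cmod_ge_0 q) as Hq0.
  assert (Hn : 1 - q <> 0).
  { intros E. apply (proj2 (Ceq_minus 1 q)) in E. rewrite <- E, Cmod_1 in Hq. lra. }
  assert (E : forall n, csum (fun k => q ^ k) n = (1 - q ^ n) / (1 - q)).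
  { induction n as [|n IH]; simpl; [field; exact Hn|]. rewrite IH. field. exact Hn. }
  assert (Hb : abs_bounded (fun n => q ^ n) (1 / (1 - Cmod q))).
  { apply abs_bounded_geom; [lra|]. intros n. rewrite Cmod_pow. lra. }
  destruct (abs_bounded_ex _ _ Hb) as [l Hl].
  replace (/ (1 - q)) with l; [exact Hl|].
  assert (Hs : Csums (fun n => q ^ n) (1 + q * l)).
  { apply (Csums_unshift (fun n => q ^ n)). apply Csums_ext with (fun n => q * q ^ n); [intros; reflexivity|].
    apply Csums_scal, Hl. }
  pose proof (Csums_unique _ _ _ Hl Hs) as El.
  assert (El' : l * (1 - q) = 1) by (replace (l * (1 - q)) with (l - q * l) by ring; rewrite El at 1; ring).
  apply (f_equal (fun z => z * / (1 - q))) in El'. rewrite Cmult_1_l in El'. rewrite <- El'. field. exact Hn.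
Qed.

Lemma analytic_at_Cinv_id (w0 : C) : w0 <> 0 -> analytic_at Cinv w0.
Proof.
  intros Hw. assert (H0 : (0 < Cmod w0)%R) by (apply Cmod_gt_0; exact Hw).
  apply (analytic_at_intro _ w0 (Cmod w0) (fun n => / w0 * (- / w0) ^ n)); [exact H0|].
  intros h Hh.
  apply Csums_ext with (fun n => / w0 * (- / w0 * h) ^ n); [intros n; rewrite Cpow_mult_l; ring|].
  assert (Hq : (Cmod (- / w0 * h) < 1)%R).
  { rewrite Cmod_mult, Cmod_opp, Cmod_inv by exact Hw.
    apply Rmult_lt_reg_l with (Cmod w0); [exact H0|]. rewrite <- Rmult_assoc, Rinv_r by lra. lra. }
  assert (Hs : w0 + h <> 0).
  { intros E. assert (h = - w0) by (replace h with (w0 + h - w0) by ring; rewrite E; ring).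
    subst h. rewrite Cmod_opp in Hh. lra. }
  replace (/ (w0 + h)) with (/ w0 * / (1 - - / w0 * h)).
  - apply Csums_scal, Csums_geom, Hq.
  - field. split; [exact Hs|exact Hw].
Qed.

Lemma analytic_at_inv (f : C -> C) (z0 : C) :
  f z0 <> 0 -> analytic_at f z0 -> analytic_at (fun z => / f z) z0.
Proof. intros H Hf. apply (analytic_at_comp Cinv f); [apply analytic_at_Cinv_id, H|exact Hf]. Qed.

Lemma analytic_at_div (f g : C -> C) (z0 : C) : g z0 <> 0 ->
  analytic_at f z0 -> analytic_at g z0 -> analytic_at (fun z => f z / g z) z0.
Proof. intros H Hf Hg. apply analytic_at_mult; [exact Hf|apply analytic_at_inv; assumption]. Qed.

Lemma pseries_remainder (u : nat -> C) (r t : R) (f : C -> C) :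
  (forall h, (Cmod h < r)%R -> Csums (fun n => u n * h ^ n) (f h)) -> (0 < t < r)%R ->
  exists K, (0 <= K)%R /\ forall h, (Cmod h <= t)%R -> (Cmod (f h - u O) <= K * Cmod h)%R.
Proof.
  intros H Ht.
  destruct (pseries_abs_bounded u r t) as [B HB]; [intros z Hz; eexists; apply H, Hz|lra|].
  exists (B / t)%R. pose proof (HB O) as HB0; simpl in HB0.
  split; [apply Rdiv_le_0_compat; lra|]. intros h Hh.
  pose proof (Cmod_ge_0 h) as Hh0.
  pose proof (Csums_shift _ _ (H h ltac:(lra))) as Hs. simpl in Hs. rewrite Cmult_1_r in Hs.
  apply abs_bounded_Cmod_le with (2 := Hs). intros n.
  apply Rle_trans with (rsum (fun k => Cmod h / t * Cmod (u (S k) * RtoC t ^ S k))%R n).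
  - apply rsum_le. intros k _. rewrite !Cmod_mult, Cmod_pow, Cpow_S, Cmod_mult, Cmod_pow, Cmod_R, Rabs_pos_eq by lra.
    replace (Cmod h / t * (Cmod (u (S k)) * (t * t ^ k)))%R with (Cmod (u (S k)) * (Cmod h * t ^ k))%R by (field; lra).
    apply Rmult_le_compat_l; [apply Cmod_ge_0|]. apply Rmult_le_compat_l; [lra|]. apply pow_incr; lra.
  - rewrite rsum_scal. replace (B / t * Cmod h)%R with (Cmod h / t * B)%R by (field; lra).
    apply Rmult_le_compat_l; [apply Rdiv_le_0_compat; lra|].
    specialize (HB (S n)). rewrite rsum_shift in HB. pose proof (Cmod_ge_0 (u O * RtoC t ^ 0)). lra.
Qed.

Lemma analytic_at_continuous (f : C -> C) (z0 : C) : analytic_at f z0 ->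
  forall eps, (0 < eps)%R -> exists d, (0 < d)%R /\
    forall z, (Cmod (z - z0) < d)%R -> (Cmod (f z - f z0) < eps)%R.
Proof.
  intros Hf eps He. apply analytic_at_elim in Hf. destruct Hf as [r [u [Hr H]]].
  destruct (pseries_remainder u r (r / 2) (fun h => f (z0 + h)) H) as [K [HK HKb]]; [lra|].
  assert (E : f z0 = u O).
  { apply pseries_coef0. replace (f z0) with (f (z0 + 0)) by (f_equal; ring). apply H. rewrite Cmod_0; lra. }
  exists (Rmin (r / 2) (eps / (K + 1))).
  split; [apply Rmin_pos; [lra|apply Rdiv_lt_0_compat; lra]|].
  intros z Hz. pose proof (Rmin_l (r / 2) (eps / (K + 1))). pose proof (Rmin_r (r / 2) (eps / (K + 1))).
  specialize (HKb (z - z0) ltac:(lra)). replace (z0 + (z - z0)) with z in HKb by ring. rewrite E.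
  eapply Rle_lt_trans; [exact HKb|]. pose proof (Cmod_ge_0 (z - z0)).
  apply Rle_lt_trans with ((K + 1) * Cmod (z - z0))%R; [nra|].
  replace eps with ((K + 1) * (eps / (K + 1)))%R by (field; lra). apply Rmult_lt_compat_l; lra.
Qed.

(** Zeros accumulating at the centre annihilate all coefficients: after division by
    a power of [h] the first nonzero coefficient would be a limit of zeros. *)
Lemma pseries_zeros (u : nat -> C) (r : R) (f : C -> C) : (0 < r)%R ->
  (forall h, (Cmod h < r)%R -> Csums (fun n => u n * h ^ n) (f h)) ->
  (forall d, (0 < d)%R -> exists h : C, h <> 0 /\ (Cmod h < d)%R /\ f h = 0) ->
  forall n, u n = 0.
Proof.
  intros Hr H Hz n. revert u f H Hz. induction n as [|n IH]; intros u f H Hz.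
  all: assert (H0 : u O = 0).
  1, 3: (destruct (pseries_remainder u r (r / 2) f H) as [K [HK HKb]]; [lra|];
    apply Cmod_eq_0, Rle_antisym; [|apply Cmod_ge_0];
    apply Rnot_lt_le; intros Hlt;
    destruct (Hz (Rmin (r / 2) (Cmod (u O) / (K + 1)))) as [h [_ [Hh Hf]]];
      [apply Rmin_pos; [lra|apply Rdiv_lt_0_compat; lra]|];
    pose proof (Rmin_l (r / 2) (Cmod (u O) / (K + 1)));
    pose proof (Rmin_r (r / 2) (Cmod (u O) / (K + 1)));
    specialize (HKb h ltac:(lra)); rewrite Hf in HKb;
    replace (0 - u O) with (- u O) in HKb by ring; rewrite Cmod_opp in HKb;
    pose proof (Cmod_ge_0 h);
    assert ((K + 1) * Cmod h < (K + 1) * (Cmod (u O) / (K + 1)))%R by (apply Rmult_lt_compat_l; lra);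
    replace ((K + 1) * (Cmod (u O) / (K + 1)))%R with (Cmod (u O)) in * by (field; lra); nra).
  - exact H0.
  - set (g := fun h => if Ceq_dec h 0 then u 1%nat else f h / h).
    apply (IH (fun k => u (S k)) g).
    + intros h Hh. unfold g. destruct (Ceq_dec h 0) as [->|Hn].
      * apply (Csums_pow0 (fun k => u (S k))).
      * pose proof (Csums_scal (/ h) _ _ (Csums_shift _ _ (H h Hh))) as E.
        cbv beta in E. rewrite H0 in E. replace (f h / h) with (/ h * (f h - 0 * h ^ 0)) by (field; exact Hn).
        apply Csums_ext with (2 := E). intros k. rewrite Cpow_S. field. exact Hn.
    + intros d Hd. destruct (Hz d Hd) as [h [Hn [Hh Hf]]]. exists h. split; [exact Hn|split; [exact Hh|]].
      unfold g. destruct (Ceq_dec h 0) as [E0|_]; [exfalso; exact (Hn E0)|]. rewrite Hf. field. exact Hn.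
Qed.

(** Along each segment from the origin, the set of parameters up to which the two
    functions agree is closed, and open by [pseries_zeros]. *)
Theorem analytic_identity (D : C -> Prop) (f g : C -> C) (e : R) :
  (forall z (t : R), D z -> (0 <= t <= 1)%R -> D (t * z)) ->
  (forall z, D z -> analytic_at f z) -> (forall z, D z -> analytic_at g z) -> (0 < e)%R ->
  (forall z, (Cmod z < e)%R -> f z = g z) -> forall z, D z -> f z = g z.
Proof.
  intros HD Hf Hg He Heq z Hz.
  set (p := fun w => f w - g w).
  assert (Hp : forall w, D w -> analytic_at p w) by (intros w Hw; apply analytic_at_minus; auto).
  assert (Hp0 : forall w, (Cmod w < e)%R -> p w = 0) by (intros w Hw; unfold p; rewrite Heq by exact Hw; ring).
  apply Ceq_minus. change (p z = 0).
  destruct (Ceq_dec z 0) as [->|Hz0]; [apply Hp0; rewrite Cmod_0; exact He|].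
  assert (Hmz : (0 < Cmod z)%R) by (apply Cmod_gt_0; exact Hz0).
  set (E := fun t : R => (0 <= t <= 1)%R /\ forall s : R, (0 <= s <= t)%R -> p (s * z) = 0).
  destruct (completeness E) as [t0 [Ht1 Ht2]].
  - exists 1%R. intros t [Ht _]. lra.
  - exists 0%R. split; [lra|]. intros s Hs. replace s with 0%R by lra.
    apply Hp0. rewrite Cmult_0_l, Cmod_0. exact He.
  - assert (Hlow : (0 < t0)%R).
    { set (t := Rmin 1 (e / (2 * Cmod z))).
      assert (Ht : (0 < t)%R) by (apply Rmin_pos; [lra|apply Rdiv_lt_0_compat; lra]).
      apply Rlt_le_trans with t; [exact Ht|]. apply Ht1. split; [split; [lra|apply Rmin_l]|].
      intros s Hs. apply Hp0. rewrite Cmod_mult, Cmod_R, Rabs_pos_eq by lra.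
      apply Rle_lt_trans with (e / (2 * Cmod z) * Cmod z)%R.
      - apply Rmult_le_compat_r; [lra|]. pose proof (Rmin_r 1 (e / (2 * Cmod z))). fold t in H. lra.
      - replace (e / (2 * Cmod z) * Cmod z)%R with (e / 2)%R by (field; lra). lra. }
    assert (Hup : (t0 <= 1)%R) by (apply Ht2; intros t [Ht _]; lra).
    assert (Hbelow : forall s : R, (0 <= s < t0)%R -> p (s * z) = 0).
    { intros s Hs. destruct (Classical_Prop.classic (exists t, E t /\ (s < t)%R)) as [[t [[Ht Hpt] Hst]]|Hn].
      - apply Hpt. lra.
      - exfalso. assert (t0 <= s)%R; [|lra]. apply Ht2. intros t Ht. apply Rnot_lt_le. intros Hlt.
        apply Hn. exists t. split; assumption. }
    assert (HDt : D (t0 * z)) by (apply HD; [exact Hz|lra]).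
    destruct (analytic_at_elim _ _ (Hp _ HDt)) as [r [u [Hr Hu]]].
    assert (Hu0 : forall n, u n = 0).
    { apply (pseries_zeros u r (fun h => p (t0 * z + h)) Hr Hu). intros d Hd.
      set (dd := Rmin t0 (d / (2 * Cmod z))).
      assert (Hdd : (0 < dd)%R) by (apply Rmin_pos; [lra|apply Rdiv_lt_0_compat; lra]).
      exists (- (RtoC dd) * z). split; [|split].
      - apply Cmult_neq_0; [|exact Hz0]. intros Ez.
        apply (f_equal Cmod) in Ez. rewrite Cmod_opp, Cmod_R, Rabs_pos_eq, Cmod_0 in Ez by lra. lra.
      - rewrite Cmod_mult, Cmod_opp, Cmod_R, Rabs_pos_eq by lra.
        apply Rle_lt_trans with (d / (2 * Cmod z) * Cmod z)%R.
        + apply Rmult_le_compat_r; [lra|apply Rmin_r].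
        + replace (d / (2 * Cmod z) * Cmod z)%R with (d / 2)%R by (field; lra). lra.
      - replace (t0 * z + - dd * z) with ((t0 - dd)%R * z) by (rewrite RtoC_minus; ring).
        apply Hbelow. pose proof (Rmin_l t0 (d / (2 * Cmod z))). fold dd in H. lra. }
    assert (Hnear : forall h, (Cmod h < r)%R -> p (t0 * z + h) = 0).
    { intros h Hh. apply (Csums_unique _ _ _ (Hu h Hh)).
      apply Csums_ext with (fun _ => 0); [intros; rewrite Hu0; ring|].
      apply (Csums_finite (fun _ => 0) O). reflexivity. }
    assert (Hall : forall s : R, (0 <= s)%R -> (s < t0 + r / Cmod z)%R -> p (s * z) = 0).
    { intros s Hs Hs'. destruct (Rlt_or_le s t0) as [|Hge]; [apply Hbelow; lra|].
      replace (s * z) with (t0 * z + (s - t0)%R * z) by (rewrite RtoC_minus; ring).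
      apply Hnear. rewrite Cmod_mult, Cmod_R, Rabs_pos_eq by lra.
      replace r with (r / Cmod z * Cmod z)%R by (field; lra). apply Rmult_lt_compat_r; lra. }
    assert (Hrz : (0 < r / Cmod z)%R) by (apply Rdiv_lt_0_compat; lra).
    destruct (Rlt_or_le t0 1) as [Hlt|Hge].
    + exfalso. set (t := Rmin 1 (t0 + r / Cmod z / 2)).
      assert (t0 < t)%R by (apply Rmin_glb_lt; lra).
      pose proof (Rmin_r 1 (t0 + r / Cmod z / 2)). pose proof (Rmin_l 1 (t0 + r / Cmod z / 2)). fold t in H0, H1.
      assert (t <= t0)%R; [|lra]. apply Ht1. split; [lra|]. intros s Hs. apply Hall; lra.
    + replace z with (1%R * z) by ring. apply Hall; lra.
Qed.

(** * Exponential, logarithm and powers *)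

Lemma Cexp_plus (z w : C) : Cexp (z + w) = Cexp z * Cexp w.
Proof.
  unfold Cexp. destruct z as [a b], w as [c d]. simpl.
  rewrite exp_plus, cos_plus, sin_plus. unfold Cmult; simpl.
  apply injective_projections; simpl; ring.
Qed.

Lemma Cexp_0 : Cexp 0 = 1.
Proof. unfold Cexp. simpl. rewrite exp_0, cos_0, sin_0. apply injective_projections; simpl; ring. Qed.

Lemma Cexp_opp_l (z : C) : Cexp (- z) * Cexp z = 1.
Proof. rewrite <- Cexp_plus. replace (- z + z) with (RtoC 0) by ring. apply Cexp_0. Qed.

Lemma Cexp_neq_0 (z : C) : Cexp z <> 0.
Proof. intros E. pose proof (Cexp_opp_l z) as H. rewrite E in H. apply C1_nz. rewrite <- H. ring. Qed.

Lemma Cexp_opp (z : C) : Cexp (- z) = / Cexp z.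
Proof.
  replace (/ Cexp z) with ((Cexp (- z) * Cexp z) / Cexp z) by (rewrite Cexp_opp_l; field; apply Cexp_neq_0).
  field. apply Cexp_neq_0.
Qed.

Lemma Cmod_Cexp (z : C) : Cmod (Cexp z) = exp (Re z).
Proof.
  unfold Cmod, Cexp. simpl.
  replace (_ + _)%R with ((exp (Re z)) ^ 2 * ((sin (Im z))² + (cos (Im z))²))%R by (unfold Rsqr; ring).
  rewrite sin2_cos2, Rmult_1_r. apply sqrt_pow2. left; apply exp_pos.
Qed.

Lemma Cmod_sqr (z : C) : (Cmod z ^ 2 = Re z ^ 2 + Im z ^ 2)%R.
Proof. unfold Cmod. rewrite pow2_sqrt; [reflexivity|]. nra. Qed.

Lemma Re_over_Cmod (z : C) : z <> 0 -> (-1 <= Re z / Cmod z <= 1)%R.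
Proof.
  intros H. apply Cmod_gt_0 in H. pose proof (Re_Cmod_le z) as E. apply Rabs_le_between in E.
  split; apply (Rmult_le_reg_r (Cmod z)); try exact H; unfold Rdiv; rewrite Rmult_assoc, Rinv_l by lra; lra.
Qed.

Lemma sin_acos_Re (z : C) : z <> 0 -> sin (acos (Re z / Cmod z)) = (Rabs (Im z) / Cmod z)%R.
Proof.
  intros H. rewrite sin_acos by (apply Re_over_Cmod, H). apply Cmod_gt_0 in H.
  rewrite <- (sqrt_Rsqr (Rabs (Im z) / Cmod z)).
  - f_equal. unfold Rsqr.
    replace (Rabs (Im z) / Cmod z * (Rabs (Im z) / Cmod z))%R with (Rabs (Im z) * Rabs (Im z) / Cmod z ^ 2)%R by (field; lra).
    rewrite <- Rabs_mult, Rabs_pos_eq by nra.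
    replace (Im z * Im z)%R with (Cmod z ^ 2 - Re z ^ 2)%R by (rewrite Cmod_sqr; ring). field. lra.
  - apply Rdiv_le_0_compat; [apply Rabs_pos|exact H].
Qed.

Lemma cos_Carg (z : C) : z <> 0 -> cos (Carg z) = (Re z / Cmod z)%R.
Proof.
  intros H. unfold Carg. destruct (Rle_dec 0 (Im z)); [|rewrite cos_neg]; apply cos_acos, Re_over_Cmod, H.
Qed.

Lemma sin_Carg (z : C) : z <> 0 -> sin (Carg z) = (Im z / Cmod z)%R.
Proof.
  intros H. unfold Carg. destruct (Rle_dec 0 (Im z)) as [Hi|Hi].
  - rewrite sin_acos_Re by exact H. rewrite Rabs_pos_eq by exact Hi. reflexivity.
  - rewrite sin_neg, sin_acos_Re by exact H. rewrite Rabs_left by lra. unfold Rdiv; ring.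
Qed.

Lemma Carg_bounds (z : C) : z <> 0 -> (- PI < Carg z <= PI)%R.
Proof.
  intros H. pose proof (acos_bound (Re z / Cmod z)) as Hb. pose proof PI_RGT_0.
  unfold Carg. destruct (Rle_dec 0 (Im z)) as [Hi|Hi]; [lra|].
  assert (acos (Re z / Cmod z) <> PI); [|lra]. intros E.
  pose proof (sin_acos_Re z H) as Hs. rewrite E, sin_PI in Hs. apply Cmod_gt_0 in H.
  rewrite Rabs_left in Hs by lra. assert (0 < - Im z / Cmod z)%R by (apply Rdiv_lt_0_compat; lra). lra.
Qed.

Lemma Cexp_Clog (z : C) : z <> 0 -> Cexp (Clog z) = z.
Proof.
  intros H. unfold Cexp, Clog. simpl. rewrite cos_Carg, sin_Carg by exact H.
  apply Cmod_gt_0 in H. rewrite exp_ln by exact H.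
  apply injective_projections; simpl; [unfold Re|unfold Im]; field; lra.
Qed.

Lemma Clog_Cexp (w : C) : (- PI < Im w <= PI)%R -> Clog (Cexp w) = w.
Proof.
  intros H. unfold Clog. rewrite Cmod_Cexp, ln_exp. destruct w as [x t]. simpl in H |- *. f_equal.
  unfold Carg. rewrite Cmod_Cexp. unfold Cexp. simpl.
  pose proof (exp_pos x) as Hx. replace (exp x * cos t / exp x)%R with (cos t) by (field; lra).
  destruct (Rle_dec 0 (exp x * sin t)) as [Hs|Hs].
  - destruct (Rle_or_lt 0 t) as [Ht|Ht]; [apply acos_cos; lra|].
    exfalso. pose proof (sin_lt_0_var t ltac:(lra) Ht). nra.
  - destruct (Rle_or_lt 0 t) as [Ht|Ht].
    + exfalso. apply Hs. pose proof (sin_ge_0 t Ht ltac:(lra)). nra.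
    + rewrite <- cos_neg, acos_cos by lra. ring.
Qed.

(** Every later evaluation of a logarithm goes through this criterion: exhibit a candidate and
    check that its imaginary part lies in the principal strip. *)
Lemma Clog_unique (z w : C) : Cexp w = z -> (- PI < Im w <= PI)%R -> Clog z = w.
Proof. intros <-. apply Clog_Cexp. Qed.

Lemma Clog_mult (z w : C) : z <> 0 -> w <> 0 -> (- PI < Carg z + Carg w <= PI)%R ->
  Clog (z * w) = Clog z + Clog w.
Proof.
  intros Hz Hw H. apply Clog_unique; [|exact H].
  rewrite Cexp_plus, !Cexp_Clog by assumption. reflexivity.
Qed.

Lemma Cpower_E (z p : C) : z <> 0 -> Cpower z p = Cexp (p * Clog z).
Proof. intros H. unfold Cpower. destruct (Ceq_dec z 0); [contradiction|reflexivity]. Qed.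

Lemma Cpower_neq_0 (z p : C) : z <> 0 -> Cpower z p <> 0.
Proof. intros H. rewrite Cpower_E by exact H. apply Cexp_neq_0. Qed.

Lemma Cpower_plus (z p q : C) : z <> 0 -> Cpower z (p + q) = Cpower z p * Cpower z q.
Proof. intros H. rewrite !Cpower_E by exact H. rewrite <- Cexp_plus. f_equal. ring. Qed.

Lemma Cpower_opp (z p : C) : z <> 0 -> Cpower z (- p) = / Cpower z p.
Proof. intros H. rewrite !Cpower_E by exact H. rewrite <- Cexp_opp. f_equal. ring. Qed.

Lemma Cpower_0 (z : C) : z <> 0 -> Cpower z 0 = 1.
Proof. intros H. rewrite Cpower_E by exact H. rewrite Cmult_0_l. apply Cexp_0. Qed.

Lemma Cpower_1 (z : C) : z <> 0 -> Cpower z 1 = z.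
Proof. intros H. rewrite Cpower_E by exact H. rewrite Cmult_1_l. apply Cexp_Clog, H. Qed.

Lemma Cpower_nat (z p : C) (n : nat) : z <> 0 -> Cpower z (p * INR n) = Cpower z p ^ n.
Proof.
  intros H. induction n as [|n IH].
  - simpl. rewrite Cmult_0_r. apply Cpower_0, H.
  - rewrite S_INR, RtoC_plus. replace (p * (INR n + 1)) with (p + p * INR n) by ring.
    rewrite Cpower_plus, IH by exact H. reflexivity.
Qed.

(** The domain on which the principal logarithm is continuous. *)
Definition slit (z : C) : Prop := (0 < Re z)%R \/ Im z <> 0%R.

Lemma slit_neq_0 (z : C) : slit z -> z <> 0.
Proof. intros [H|H] E; rewrite E in H; simpl in H; lra. Qed.

Lemma Re_pos_slit (z : C) : (0 < Re z)%R -> slit z.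
Proof. left; assumption. Qed.

Lemma Carg_slit (z : C) : slit z -> (- PI < Carg z < PI)%R.
Proof.
  intros H. pose proof (slit_neq_0 z H) as Hz. destruct (Carg_bounds z Hz) as [H1 H2].
  split; [exact H1|]. destruct H2 as [H2|H2]; [exact H2|exfalso].
  pose proof (cos_Carg z Hz) as Hc. pose proof (sin_Carg z Hz) as Hs.
  rewrite H2, cos_PI in Hc. rewrite H2, sin_PI in Hs. apply Cmod_gt_0 in Hz.
  assert (Re z = - Cmod z)%R by (apply (Rmult_eq_reg_r (/ Cmod z)); [unfold Rdiv in Hc; rewrite <- Hc; field; lra|apply Rinv_neq_0_compat; lra]).
  assert (Im z = 0)%R by (apply (Rmult_eq_reg_r (/ Cmod z)); [unfold Rdiv in Hs; rewrite <- Hs; ring|apply Rinv_neq_0_compat; lra]).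
  destruct H as [H|H]; lra.
Qed.

Lemma Carg_Re_pos (z : C) : (0 < Re z)%R -> (- (PI / 2) < Carg z < PI / 2)%R.
Proof.
  intros H. pose proof (slit_neq_0 z (Re_pos_slit z H)) as Hz. destruct (Carg_bounds z Hz) as [H1 H2].
  pose proof (cos_Carg z Hz) as Hc. apply Cmod_gt_0 in Hz.
  assert (0 < cos (Carg z))%R by (rewrite Hc; apply Rdiv_lt_0_compat; assumption).
  pose proof PI_RGT_0. split; apply Rnot_le_lt; intros Hle.
  - pose proof (cos_le_0 (- Carg z) ltac:(lra) ltac:(lra)) as E. rewrite cos_neg in E. lra.
  - pose proof (cos_le_0 (Carg z) ltac:(lra) ltac:(lra)). lra.
Qed.

Lemma Carg_Im_nonneg (z : C) : (0 <= Im z)%R -> (0 <= Carg z)%R.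
Proof. intros H. unfold Carg. destruct (Rle_dec 0 (Im z)); [apply acos_bound|contradiction]. Qed.

Lemma Carg_Im_neg (z : C) : (Im z < 0)%R -> (Carg z <= 0)%R.
Proof.
  intros H. unfold Carg. destruct (Rle_dec 0 (Im z)); [lra|].
  pose proof (acos_bound (Re z / Cmod z)). lra.
Qed.

Lemma Carg_pos_real (x : R) : (0 < x)%R -> Carg x = 0%R.
Proof.
  intros H. unfold Carg. simpl. destruct (Rle_dec 0 0); [|lra].
  rewrite Cmod_R, Rabs_pos_eq by lra. unfold Rdiv. rewrite Rinv_r by lra. apply acos_1.
Qed.

Lemma Cpower_mult_arg (z w p : C) : z <> 0 -> w <> 0 -> (- PI < Carg z + Carg w <= PI)%R ->
  Cpower (z * w) p = Cpower z p * Cpower w p.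
Proof.
  intros Hz Hw H. rewrite !Cpower_E; try assumption; [|apply Cmult_neq_0; assumption].
  rewrite Clog_mult by assumption. rewrite <- Cexp_plus. f_equal. ring.
Qed.

Lemma Cpower_mult (z w p : C) : (0 < Re z)%R -> (0 < Re w)%R -> Cpower (z * w) p = Cpower z p * Cpower w p.
Proof.
  intros Hz Hw. pose proof (Carg_Re_pos z Hz). pose proof (Carg_Re_pos w Hw).
  apply Cpower_mult_arg; try (apply slit_neq_0; left; assumption). lra.
Qed.

Lemma Clog_inv (z : C) : slit z -> Clog (/ z) = - Clog z.
Proof.
  intros H. apply Clog_unique.
  - rewrite Cexp_opp, Cexp_Clog by (apply slit_neq_0, H). reflexivity.
  - simpl. pose proof (Carg_slit z H). lra.
Qed.

Lemma Cinv_neq_0 (z : C) : z <> 0 -> / z <> 0.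
Proof.
  intros H E. apply C1_nz. rewrite <- (Cinv_r z H), E. ring.
Qed.

Lemma Cpower_inv (z p : C) : slit z -> Cpower (/ z) p = Cpower z (- p).
Proof.
  intros H. pose proof (slit_neq_0 z H) as Hz.
  rewrite !Cpower_E; [|exact Hz|apply Cinv_neq_0, Hz].
  rewrite Clog_inv by exact H. f_equal. ring.
Qed.

Lemma Csqrt_sqr (z : C) : z <> 0 -> Csqrt z * Csqrt z = z.
Proof.
  intros H. unfold Csqrt. rewrite <- Cpower_plus by exact H.
  replace (1 / 2 + 1 / 2) with (RtoC 1) by (rewrite <- RtoC_div, <- RtoC_plus by lra; f_equal; lra).
  apply Cpower_1, H.
Qed.

Lemma half_RtoC : 1 / 2 = RtoC (1 / 2).
Proof. rewrite RtoC_div by lra. reflexivity. Qed.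

Lemma Csqrt_Re_pos (z : C) : slit z -> (0 < Re (Csqrt z))%R.
Proof.
  intros H. unfold Csqrt. rewrite Cpower_E by (apply slit_neq_0, H). rewrite half_RtoC.
  unfold Cexp, Clog, RtoC, Cmult. simpl. apply Rmult_lt_0_compat; [apply exp_pos|].
  pose proof (Carg_slit z H). apply cos_gt_0; lra.
Qed.

Lemma Clog_Re_pos (z : C) : (0 < Re z)%R -> Clog z = (ln (Cmod z), atan (Im z / Re z)).
Proof.
  intros H. pose proof (slit_neq_0 z (Re_pos_slit z H)) as Hz. apply Cmod_gt_0 in Hz.
  apply Clog_unique.
  - unfold Cexp. simpl. rewrite exp_ln by exact Hz. rewrite cos_atan, sin_atan.
    assert (E : sqrt (1 + (Im z / Re z)²) = (Cmod z / Re z)%R).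
    { rewrite <- (sqrt_Rsqr (Cmod z / Re z)) by (apply Rdiv_le_0_compat; lra). f_equal.
      unfold Rsqr. replace (Cmod z / Re z * (Cmod z / Re z))%R with (Cmod z ^ 2 / Re z ^ 2)%R by (field; lra).
      rewrite Cmod_sqr. field. lra. }
    rewrite E. apply injective_projections; simpl; unfold Re, Im in *; field; split; lra.
  - simpl. pose proof (atan_bound (Im z / Re z)). pose proof PI_RGT_0. lra.
Qed.

(** * Differentiation along rays *)

(** Componentwise, so that real calculus applies. *)
Definition Cderiv (f : R -> C) (t : R) (d : C) : Prop :=
  is_derive (fun s => Re (f s)) t (Re d) /\ is_derive (fun s => Im (f s)) t (Im d).

Lemma Cderiv_mult (f g : R -> C) (t : R) (df dg : C) :
  Cderiv f t df -> Cderiv g t dg -> Cderiv (fun s => f s * g s) t (df * g t + f t * dg).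
Proof.
  intros [Hf1 Hf2] [Hg1 Hg2].
  assert (P : forall a b : R -> R, forall da db, is_derive a t da -> is_derive b t db ->
    is_derive (fun s => a s * b s)%R t (da * b t + a t * db)%R).
  { intros a b da db Ha Hb. apply (is_derive_mult a b t da db Ha Hb). intros; apply Rmult_comm. }
  split; simpl.
  - apply (is_derive_ext (fun s => Re (f s) * Re (g s) - Im (f s) * Im (g s))%R); [reflexivity|].
    match goal with |- is_derive _ _ ?v =>
      replace v with (minus (Re df * Re (g t) + Re (f t) * Re dg)%R (Im df * Im (g t) + Im (f t) * Im dg)%R)
    end.
    + apply (is_derive_minus (V := R_NormedModule)); apply P; assumption.
    + unfold minus, plus, opp; simpl. unfold Re, Im. ring.
  - apply (is_derive_ext (fun s => Re (f s) * Im (g s) + Im (f s) * Re (g s))%R); [reflexivity|].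
    match goal with |- is_derive _ _ ?v =>
      replace v with (plus (Re df * Im (g t) + Re (f t) * Im dg)%R (Im df * Re (g t) + Im (f t) * Re dg)%R)
    end.
    + apply (is_derive_plus (V := R_NormedModule)); apply P; assumption.
    + unfold plus; simpl. unfold Re, Im. ring.
Qed.

Lemma Cderiv_Cexp (f : R -> C) (t : R) (d : C) :
  Cderiv f t d -> Cderiv (fun s => Cexp (f s)) t (d * Cexp (f t)).
Proof.
  intros [H1 H2].
  assert (P : forall a b : R -> R, forall da db, is_derive a t da -> is_derive b t db ->
    is_derive (fun s => exp (a s) * cos (b s))%R t (exp (a t) * (da * cos (b t) - db * sin (b t)))%R /\
    is_derive (fun s => exp (a s) * sin (b s))%R t (exp (a t) * (da * sin (b t) + db * cos (b t)))%R).
  { intros a b da db Ha Hb.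
    assert (Ea : ex_derive a t) by (eexists; exact Ha). assert (Eb : ex_derive b t) by (eexists; exact Hb).
    split; (evar_last; [auto_derive; [split; [exact Ea|split; [exact Eb|exact I]]|reflexivity]|]);
    replace (Derive (fun x : R => a x) t) with da by (symmetry; apply is_derive_unique, Ha); replace (Derive (fun x : R => b x) t) with db by (symmetry; apply is_derive_unique, Hb); ring. }
  destruct (P _ _ _ _ H1 H2) as [P1 P2].
  split; (evar_last; [first [exact P1|exact P2]|]); simpl; unfold Re, Im; ring.
Qed.

Lemma Cderiv_scal (c : C) (f : R -> C) (t : R) (d : C) : Cderiv f t d -> Cderiv (fun s => c * f s) t (c * d).
Proof.
  intros H. replace (c * d) with (0 * f t + c * d) by ring.
  apply (Cderiv_mult (fun _ => c) f); [|exact H]. split; simpl; apply (is_derive_const (V := R_NormedModule)).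
Qed.

Lemma Cderiv_Clog_ray (z : C) (t : R) : (0 < Re (1 - t * z)%C)%R ->
  Cderiv (fun s => Clog (1 - s * z)) t (- z / (1 - t * z)).
Proof.
  intros H. destruct z as [x y]. 
  assert (HX : forall s : R, Re (1 - s * (x, y)) = (1 - s * x)%R) by (intros; simpl; ring).
  assert (HY : forall s : R, Im (1 - s * (x, y)) = (- (s * y))%R) by (intros; simpl; ring).
  rewrite HX in H.
  assert (Hloc : locally t (fun s => 0 < 1 - s * x)%R).
  { apply (locally_open (fun s => 0 < 1 - s * x)%R); [|auto|exact H].
    apply (open_comp (fun s => 1 - s * x)%R (fun v => 0 < v)%R); [|apply open_gt].
    intros s _. apply (ex_derive_continuous (fun s => 1 - s * x)%R). auto_derive; exact I. }
  assert (Hd : (0 < (1 - t * x) ^ 2 + (t * y) ^ 2)%R) by nra.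
  assert (Ed : - (x, y) / (1 - t * (x, y)) =
     ((- x * (1 - t * x) + t * y * y) / ((1 - t * x) ^ 2 + (t * y) ^ 2), - y / ((1 - t * x) ^ 2 + (t * y) ^ 2))%R).
  { unfold Cdiv, Cinv. apply injective_projections; simpl; field; nra. }
  rewrite Ed.
  split; [match goal with |- is_derive ?f _ (Re (?u, ?v)) => change (is_derive f t u) end
         |match goal with |- is_derive ?f _ (Im (?u, ?v)) => change (is_derive f t v) end].
  - apply (is_derive_ext_loc (fun s => ln (sqrt ((1 - s * x) ^ 2 + (s * y) ^ 2)))).
    { apply filter_imp with (2 := Hloc). intros s Hs. rewrite Clog_Re_pos by (rewrite HX; exact Hs).
      simpl Re. unfold Cmod. f_equal. f_equal. change (fst ?a) with (Re a). change (snd ?a) with (Im a).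
      rewrite HX, HY. ring. }
    evar_last.
    + auto_derive; [|reflexivity]. split; [simpl in *; lra|]. split; [apply sqrt_lt_R0; simpl in *; lra|exact I].
    + replace ((1 + - (t * x)) * ((1 + - (t * x)) * 1) + t * y * (t * y * 1))%R
        with ((1 - t * x) ^ 2 + (t * y) ^ 2)%R by ring.
      set (Q := ((1 - t * x) ^ 2 + (t * y) ^ 2)%R) in *.
      assert (Hs : (sqrt Q * sqrt Q = Q)%R) by (apply sqrt_sqrt; lra).
      assert (Hp : (0 < sqrt Q)%R) by (apply sqrt_lt_R0; lra).
      rewrite <- Hs at 3. field. lra.
  - apply (is_derive_ext_loc (fun s => atan ((- (s * y)) / (1 - s * x)))%R).
    { apply filter_imp with (2 := Hloc). intros s Hs. rewrite Clog_Re_pos by (rewrite HX; exact Hs).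
      change (atan (- (s * y) / (1 - s * x)) = atan (Im (1 - s * (x, y))%C / Re (1 - s * (x, y))%C))%R.
      rewrite HX, HY. reflexivity. }
    evar_last.
    + auto_derive; [|reflexivity]. lra.
    + field. repeat split; nra.
Qed.

Lemma Cderiv_const_eq (f : R -> C) : (forall t, (0 <= t <= 1)%R -> Cderiv f t 0) -> f 0%R = f 1%R.
Proof.
  intros H. apply injective_projections.
  - apply (eq_is_derive (fun s => Re (f s)) 0 1); [|lra]. intros t Ht. apply (proj1 (H t Ht)).
  - apply (eq_is_derive (fun s => Im (f s)) 0 1); [|lra]. intros t Ht. apply (proj2 (H t Ht)).
Qed.

(** * Subexponential sequences *)

(** Equivalently, the power series with these coefficients has radius of convergence at least 1.
    This form is plainly stable under products. *)
Definition subexp (u : nat -> C) : Prop :=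
  forall q : R, (1 < q)%R -> exists M, forall n, (Cmod (u n) <= M * q ^ n)%R.

Lemma geom_growth (u : nat -> R) (q : R) (N : nat) : (0 < q)%R -> (forall n, (0 <= u n)%R) ->
  (forall n, (N <= n)%nat -> (u (S n) <= q * u n)%R) -> exists M, (0 <= M)%R /\ forall n, (u n <= M * q ^ n)%R.
Proof.
  intros Hq Hu H. exists (rsum (fun k => u k / q ^ k) (S N))%R.
  assert (Hpos : forall k, (0 <= u k / q ^ k)%R) by (intros; apply Rdiv_le_0_compat; [apply Hu|apply pow_lt; lra]).
  split; [apply rsum_pos; auto|].
  assert (Hsm : forall n, (n <= N)%nat -> (u n <= rsum (fun k => u k / q ^ k) (S N) * q ^ n)%R).
  { intros n Hn. assert (Hqn : (0 < q ^ n)%R) by (apply pow_lt; lra).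
    replace (u n) with (u n / q ^ n * q ^ n)%R by (field; lra). apply Rmult_le_compat_r; [lra|].
    apply Rle_trans with (rsum (fun k => u k / q ^ k) (S n))%R; [|apply rsum_mono; [exact Hpos|lia]].
    simpl. assert (0 <= rsum (fun k => u k / q ^ k) n)%R by (apply rsum_pos; auto). lra. }
  intros n. destruct (Nat.le_ge_cases n N) as [Hn|Hn]; [apply Hsm, Hn|].
  induction n as [|n IH]; [apply Hsm; lia|].
  destruct (Nat.eq_dec (S n) N) as [E|E]; [apply Hsm; lia|].
  assert (IH' := IH ltac:(lia)). specialize (H n ltac:(lia)). simpl pow.
  eapply Rle_trans; [exact H|].
  replace (rsum (fun k => u k / q ^ k) (S N) * (q * q ^ n))%R with (q * (rsum (fun k => u k / q ^ k) (S N) * q ^ n))%R by ring.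
  apply Rmult_le_compat_l; lra.
Qed.

Lemma subexp_ratio (u : nat -> C) :
  (forall q : R, (1 < q)%R -> exists N, forall n, (N <= n)%nat -> (Cmod (u (S n)) <= q * Cmod (u n))%R) ->
  subexp u.
Proof.
  intros H q Hq. destruct (H q Hq) as [N HN].
  destruct (geom_growth (fun n => Cmod (u n)) q N) as [M [_ HM]]; [lra|intros; apply Cmod_ge_0|exact HN|].
  exists M. exact HM.
Qed.

Lemma subexp_mult (u v : nat -> C) : subexp u -> subexp v -> subexp (fun n => u n * v n).
Proof.
  intros Hu Hv q Hq. assert (Hs : (1 < sqrt q)%R) by (rewrite <- sqrt_1; apply sqrt_lt_1; lra).
  destruct (Hu _ Hs) as [M HM]. destruct (Hv _ Hs) as [M' HM']. exists (M * M')%R. intros n.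
  rewrite Cmod_mult. replace (M * M' * q ^ n)%R with ((M * sqrt q ^ n) * (M' * sqrt q ^ n))%R.
  - apply Rmult_le_compat; try apply Cmod_ge_0; [apply HM|apply HM'].
  - replace q with (sqrt q * sqrt q)%R at 3 by (apply sqrt_sqrt; lra). rewrite Rpow_mult_distr. ring.
Qed.

Lemma subexp_abs_bounded (u : nat -> C) (z : C) : subexp u -> (Cmod z < 1)%R ->
  exists B, abs_bounded (fun n => u n * z ^ n) B.
Proof.
  intros Hu Hz. pose proof (Cmod_ge_0 z) as H0.
  (* [q > 1] and [q * Cmod z < 1] *)
  set (q := (2 / (1 + Cmod z))%R).
  assert (Hq : (q * (1 + Cmod z) = 2)%R) by (unfold q; field; lra).
  assert (Hq1 : (1 < q)%R) by nra.
  destruct (Hu q Hq1) as [M HM]. exists (M / (1 - q * Cmod z))%R. apply abs_bounded_geom; [nra|].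
  intros n. rewrite Cmod_mult, Cmod_pow, Rpow_mult_distr, <- Rmult_assoc.
  apply Rmult_le_compat_r; [apply pow_le; lra|apply HM].
Qed.

Lemma subexp_Csums (u : nat -> C) (z : C) : subexp u -> (Cmod z < 1)%R ->
  Csums (fun n => u n * z ^ n) (CSeries (fun n => u n * z ^ n)).
Proof. intros Hu Hz. destruct (subexp_abs_bounded u z Hu Hz) as [B HB]. exact (abs_bounded_CSeries _ _ HB). Qed.

(** The values of [b] at which no Pochhammer symbol vanishes. *)
Definition nonpole (b : C) : Prop := forall n : nat, b + INR n <> 0.

Lemma poch_neq_0 (b : C) (n : nat) : nonpole b -> poch b n <> 0.
Proof. intros H. induction n as [|n IH]; simpl; [apply C1_nz|apply Cmult_neq_0; auto]. Qed.

Lemma INR_fact_C (n : nat) : RtoC (INR (fact (S n))) = RtoC (INR (fact n)) * (1 + INR n).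
Proof.
  rewrite fact_simpl, mult_INR, S_INR, RtoC_mult, RtoC_plus. ring.
Qed.

Lemma poch_1 (n : nat) : poch 1 n = INR (fact n).
Proof. induction n as [|n IH]; [reflexivity|]. rewrite INR_fact_C, <- IH. reflexivity. Qed.

Lemma nonpole_1 : nonpole 1.
Proof.
  intros n E. rewrite <- RtoC_plus in E. apply RtoC_inj in E. pose proof (pos_INR n). lra.
Qed.

Lemma fact_neq_0_C (n : nat) : RtoC (INR (fact n)) <> 0.
Proof. rewrite <- poch_1. apply poch_neq_0, nonpole_1. Qed.

Lemma Cmod_INR (n : nat) : Cmod (INR n) = INR n.
Proof. rewrite Cmod_R, Rabs_pos_eq; [reflexivity|apply pos_INR]. Qed.

(** The ratio of consecutive terms is [(a + n) / (b + n)], which tends to 1. *)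
Lemma subexp_poch_ratio (a b : C) : nonpole b -> subexp (fun n => poch a n / poch b n).
Proof.
  intros Hb. apply subexp_ratio. intros q Hq.
  destruct (INR_unbounded ((Cmod a + q * Cmod b) / (q - 1))%R) as [N HN].
  exists N. intros n Hn.
  replace (poch a (S n) / poch b (S n)) with ((poch a n / poch b n) * ((a + INR n) / (b + INR n)))
    by (simpl; field; split; [apply Hb|apply poch_neq_0, Hb]).
  rewrite Cmod_mult, Rmult_comm. apply Rmult_le_compat_r; [apply Cmod_ge_0|].
  rewrite Cmod_div by apply Hb.
  assert (0 < Cmod (b + INR n))%R by (apply Cmod_gt_0, Hb).
  apply Rmult_le_reg_r with (Cmod (b + INR n)); [assumption|].
  unfold Rdiv. rewrite Rmult_assoc, Rinv_l, Rmult_1_r by lra.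
  assert (E1 : (Cmod (a + INR n) <= Cmod a + INR n)%R)
    by (eapply Rle_trans; [apply Cmod_triangle|rewrite Cmod_INR; lra]).
  assert (E2 : (INR n <= Cmod (b + INR n) + Cmod b)%R).
  { rewrite <- (Cmod_INR n) at 1. replace (RtoC (INR n)) with ((b + INR n) + - b) at 1 by ring.
    eapply Rle_trans; [apply Cmod_triangle|]. rewrite Cmod_opp. lra. }
  assert (E3 : (Cmod a + q * Cmod b <= (q - 1) * INR n)%R).
  { apply le_INR in Hn. apply Rle_trans with ((q - 1) * ((Cmod a + q * Cmod b) / (q - 1)))%R.
    - right; field; lra.
    - apply Rmult_le_compat_l; lra. }
  nra.
Qed.

(** * The binomial series *)

Lemma RtoC_pow (t : R) (n : nat) : RtoC (t ^ n) = (RtoC t) ^ n.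
Proof. induction n as [|n IH]; [reflexivity|]. simpl. rewrite RtoC_mult, IH. reflexivity. Qed.

Lemma Re_mult_pow (w : C) (t : R) (n : nat) : Re (w * (RtoC t) ^ n) = (Re w * t ^ n)%R.
Proof. rewrite <- RtoC_pow. destruct w as [x y]. simpl. ring. Qed.

Lemma Im_mult_pow (w : C) (t : R) (n : nat) : Im (w * (RtoC t) ^ n) = (Im w * t ^ n)%R.
Proof. rewrite <- RtoC_pow. destruct w as [x y]. simpl. ring. Qed.

Lemma Re_scal (x : R) (w : C) : Re (x * w) = (x * Re w)%R.
Proof. destruct w as [u v]. simpl. ring. Qed.

Lemma Im_scal (x : R) (w : C) : Im (x * w) = (x * Im w)%R.
Proof. destruct w as [u v]. simpl. ring. Qed.

Lemma CV_radius_geom (a : nat -> R) (M theta : R) : (0 <= theta < 1)%R ->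
  (forall n, (Rabs (a n) <= M * theta ^ n)%R) ->
  forall t, (Rabs t <= 1)%R -> Rbar_lt (Rabs t) (CV_radius a).
Proof.
  intros Hth Ha t Ht. set (r := (2 / (1 + theta))%R).
  assert (Hr : (r * (1 + theta) = 2)%R) by (unfold r; field; lra).
  assert (HM : (0 <= M)%R) by (specialize (Ha O); simpl in Ha; pose proof (Rabs_pos (a O)); lra).
  apply Rbar_lt_le_trans with r; [simpl; nra|].
  apply (proj1 (CV_radius_bounded a)). exists M. intros n.
  rewrite Rabs_mult, <- RPow_abs. rewrite (Rabs_pos_eq r) by nra.
  apply Rle_trans with (M * theta ^ n * r ^ n)%R.
  - apply Rmult_le_compat_r; [apply pow_le; nra|apply Ha].
  - rewrite Rmult_assoc, <- Rpow_mult_distr. rewrite <- (Rmult_1_r M) at 2.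
    apply Rmult_le_compat_l; [exact HM|]. rewrite <- (pow1 n). apply pow_incr. nra.
Qed.

(** Along the ray through [z], a complex power series is a pair of real power series in the
    parameter, so that it may be differentiated termwise. *)
Lemma Cderiv_ray_pseries (w : nat -> C) (M theta : R) : (0 <= theta < 1)%R ->
  (forall n, (Cmod (w n) <= M * theta ^ n)%R) -> forall t : R, (0 <= t <= 1)%R ->
  exists f d : R -> C, Csums (fun n => w n * (RtoC t) ^ n) (f t) /\
    (forall s, f s = CSeries (fun n => w n * (RtoC s) ^ n)) /\
    Csums (fun n => INR (S n) * w (S n) * (RtoC t) ^ n) (d t) /\ Cderiv f t (d t).
Proof.
  intros Hth Hw t Ht.
  set (a := fun n => Re (w n)). set (b := fun n => Im (w n)).
  assert (Ha : Rbar_lt (Rabs t) (CV_radius a)).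
  { apply (CV_radius_geom a M theta); [lra| |rewrite Rabs_pos_eq; lra]. intros n.
    eapply Rle_trans; [apply Re_Cmod_le|apply Hw]. }
  assert (Hb : Rbar_lt (Rabs t) (CV_radius b)).
  { apply (CV_radius_geom b M theta); [lra| |rewrite Rabs_pos_eq; lra]. intros n.
    eapply Rle_trans; [apply Im_Cmod_le|apply Hw]. }
  assert (Ha' : Rbar_lt (Rabs t) (CV_radius (PS_derive a))) by (rewrite CV_radius_derive; exact Ha).
  assert (Hb' : Rbar_lt (Rabs t) (CV_radius (PS_derive b))) by (rewrite CV_radius_derive; exact Hb).
  assert (Hs : forall c, Rbar_lt (Rabs t) (CV_radius c) -> is_series (fun n => c n * t ^ n)%R (PSeries c t)).
  { intros c Hc. apply Series_correct, ex_series_Rabs, CV_disk_inside, Hc. }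
  exists (fun s => (PSeries a s, PSeries b s)), (fun s => (PSeries (PS_derive a) s, PSeries (PS_derive b) s)).
  split; [|split; [|split]].
  - apply Csums_Re_Im.
    + apply is_series_ext with (2 := Hs a Ha). intros n. symmetry. apply Re_mult_pow.
    + apply is_series_ext with (2 := Hs b Hb). intros n. symmetry. apply Im_mult_pow.
  - intros s. unfold CSeries, PSeries. f_equal; apply Series_ext; intros n; symmetry;
      [apply Re_mult_pow|apply Im_mult_pow].
  - apply Csums_Re_Im.
    + apply is_series_ext with (2 := Hs _ Ha'). intros n.
      rewrite Re_mult_pow. rewrite Re_scal. reflexivity.
    + apply is_series_ext with (2 := Hs _ Hb'). intros n.
      rewrite Im_mult_pow. rewrite Im_scal. reflexivity.
  - split; simpl; apply is_derive_PSeries; assumption.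
Qed.

Lemma Cderiv_ext (f g : R -> C) (t : R) (d : C) : (forall s, f s = g s) -> Cderiv f t d -> Cderiv g t d.
Proof.
  intros E [H1 H2]. split; [apply is_derive_ext with (2 := H1)|apply is_derive_ext with (2 := H2)];
    intros s; rewrite E; reflexivity.
Qed.

Lemma Re_1_minus (z : C) (t : R) : (0 <= t <= 1)%R -> (Cmod z < 1)%R -> (0 < Re (1 - t * z)%C)%R.
Proof.
  intros Ht Hz. pose proof (Re_Cmod_le z) as H. apply Rabs_le_between in H.
  destruct z as [x y]. simpl in *. nra.
Qed.

Lemma binom_coef_S (b : C) (n : nat) :
  (1 + INR n) * (poch b (S n) / INR (fact (S n))) = (b + INR n) * (poch b n / INR (fact n)).
Proof.
  rewrite INR_fact_C. simpl poch. field. split; [apply fact_neq_0_C|apply nonpole_1].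
Qed.

Lemma subexp_binom (b : C) : subexp (fun n => poch b n / INR (fact n)).
Proof.
  intros q Hq. destruct (subexp_poch_ratio b 1 nonpole_1 q Hq) as [M HM]. exists M.
  intros n. rewrite <- poch_1. apply HM.
Qed.

(** The binomial series: its product with the inverse power is constant along each ray,
    because both logarithmic derivatives equal [b z / (1 - t z)] up to sign. *)
Theorem binomial_series (b z : C) : (Cmod z < 1)%R ->
  Csums (fun n => poch b n / INR (fact n) * z ^ n) (Cpower (1 - z) (- b)).
Proof.
  intros Hz. pose proof (Cmod_ge_0 z) as Hz0.
  set (c := fun n => poch b n / INR (fact n)). set (w := fun n => c n * z ^ n).
  (* [q > 1] and [q * Cmod z < 1] *)
  set (q := (2 / (1 + Cmod z))%R).
  assert (Hq : (q * (1 + Cmod z) = 2)%R) by (unfold q; field; lra).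
  assert (Hq1 : (1 < q)%R) by nra.
  destruct (subexp_binom b q Hq1) as [M HM].
  assert (Hw : forall n, (Cmod (w n) <= M * (q * Cmod z) ^ n)%R).
  { intros n. unfold w. rewrite Cmod_mult, Cmod_pow, Rpow_mult_distr, <- Rmult_assoc.
    apply Rmult_le_compat_r; [apply pow_le; lra|apply HM]. }
  assert (Hth : (0 <= q * Cmod z < 1)%R) by nra.
  set (f := fun s : R => CSeries (fun n => w n * (RtoC s) ^ n)).
  set (g := fun s : R => Cexp (b * Clog (1 - s * z))).
  assert (Hfs : forall t, (0 <= t <= 1)%R -> Csums (fun n => w n * (RtoC t) ^ n) (f t)).
  { intros t Ht. destruct (Cderiv_ray_pseries w M _ Hth Hw t Ht) as [f' [d [H1 [H2 _]]]].
    unfold f. rewrite <- H2. exact H1. }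
  assert (Hf : forall t, (0 <= t <= 1)%R -> Cderiv f t (b * z / (1 - t * z) * f t)).
  { intros t Ht. destruct (Cderiv_ray_pseries w M _ Hth Hw t Ht) as [f' [d [H1 [H2 [H3 H4]]]]].
    apply (Cderiv_ext f' f) in H4; [|intros s; apply H2].
    replace (b * z / (1 - t * z) * f t) with (d t); [exact H4|].
    assert (Hn : 1 - t * z <> 0) by (apply slit_neq_0, Re_pos_slit, Re_1_minus; assumption).
    assert (H5 : Csums (fun n => INR n * w n * (RtoC t) ^ n) (t * d t)).
    { replace (t * d t) with (INR 0 * w O * (RtoC t) ^ 0 + t * d t) by (simpl; ring).
      apply (Csums_unshift (fun n => INR n * w n * (RtoC t) ^ n)).
      apply Csums_ext with (fun n => t * (INR (S n) * w (S n) * (RtoC t) ^ n)); [intros n; rewrite (Cpow_S _ n); ring|].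
      apply Csums_scal, H3. }
    assert (E : d t = z * (b * f t + t * d t)).
    { apply (Csums_unique _ _ _ H3).
      apply Csums_ext with (fun n => z * (b * (w n * (RtoC t) ^ n) + INR n * w n * (RtoC t) ^ n)).
      - intros n. unfold w. rewrite S_INR, RtoC_plus, Cpow_S.
        transitivity ((b + INR n) * c n * (z * z ^ n * RtoC t ^ n)); [ring|].
        unfold c. rewrite <- binom_coef_S. fold (c (S n)). ring.
      - apply Csums_scal, Csums_plus; [apply Csums_scal, Hfs, Ht|exact H5]. }
    assert (E' : d t * (1 - t * z) = b * z * f t)
      by (replace (d t * (1 - t * z)) with (d t - t * z * d t) by ring; rewrite E at 1; ring).
    replace (b * z / (1 - t * z) * f t) with (b * z * f t / (1 - t * z)) by (field; exact Hn).
    rewrite <- E'. field. exact Hn. }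
  assert (Hg : forall t, (0 <= t <= 1)%R -> Cderiv g t (- (b * z / (1 - t * z)) * g t)).
  { intros t Ht. pose proof (Re_1_minus z t Ht Hz) as Hre.
    replace (- (b * z / (1 - t * z)) * g t) with (b * (- z / (1 - t * z)) * Cexp (b * Clog (1 - t * z))).
    - apply (Cderiv_Cexp (fun s => b * Clog (1 - s * z))). apply Cderiv_scal, Cderiv_Clog_ray, Hre.
    - unfold g. field. apply slit_neq_0, Re_pos_slit, Hre. }
  assert (Hc : f 0%R * g 0%R = f 1%R * g 1%R).
  { apply (Cderiv_const_eq (fun s => f s * g s)). intros t Ht.
    match goal with |- Cderiv _ _ ?v =>
      replace v with (b * z / (1 - t * z) * f t * g t + f t * (- (b * z / (1 - t * z)) * g t)) by ring end.
    apply Cderiv_mult; auto. }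
  assert (Hn1 : 1 - z <> 0).
  { replace (1 - z) with (1 - 1%R * z) by ring. apply slit_neq_0, Re_pos_slit, Re_1_minus; [lra|exact Hz]. }
  assert (Hf0 : f 0%R = 1).
  { pose proof (pseries_coef0 w _ (Hfs 0%R ltac:(lra))) as E. rewrite E. unfold w, c. simpl. field. }
  assert (Hg0 : g 0%R = 1).
  { unfold g. replace (1 - 0%R * z) with (RtoC 1) by ring.
    replace (Clog 1) with (RtoC 0); [rewrite Cmult_0_r; apply Cexp_0|]. symmetry. apply Clog_unique; [apply Cexp_0|].
    simpl. pose proof PI_RGT_0. lra. }
  assert (Hg1 : g 1%R * Cpower (1 - z) (- b) = 1).
  { unfold g. replace (1 - 1%R * z) with (1 - z) by ring. rewrite Cpower_E by exact Hn1.
    rewrite <- Cexp_plus. replace (b * Clog (1 - z) + - b * Clog (1 - z)) with (RtoC 0) by ring. apply Cexp_0. }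
  assert (E : f 1%R = Cpower (1 - z) (- b)).
  { replace (f 1%R) with (f 1%R * g 1%R * Cpower (1 - z) (- b)) by (rewrite <- Cmult_assoc, Hg1; ring).
    rewrite <- Hc, Hf0, Hg0. ring. }
  rewrite <- E. apply Csums_ext with (2 := Hfs 1%R ltac:(lra)). intros n. rewrite Cpow_1_l. unfold w, c. ring.
Qed.

Lemma Carg_near_1 (m : R) : (0 < m)%R -> exists d, (0 < d <= 1 / 2)%R /\
  forall h, (Cmod h < d)%R -> (Rabs (Carg (1 + h)) < m)%R.
Proof.
  intros Hm. pose proof PI_RGT_0. pose proof PI2_3_2. set (m' := Rmin m 1).
  assert (Hm' : (0 < m' <= 1)%R /\ (m' <= m)%R)
    by (unfold m'; split; [split; [apply Rmin_pos; lra|apply Rmin_r]|apply Rmin_l]).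
  assert (Hsin : (0 < sin m')%R) by (apply sin_gt_0; lra).
  exists (Rmin (1 / 2) (sin m' / 2))%R.
  split; [split; [apply Rmin_pos; lra|apply Rmin_l]|].
  intros h Hh. pose proof (Rmin_l (1 / 2) (sin m' / 2)). pose proof (Rmin_r (1 / 2) (sin m' / 2)).
  pose proof (Re_Cmod_le h) as H4. pose proof (Im_Cmod_le h) as H5. apply Rabs_le_between in H4, H5.
  assert (Hre : (1 / 2 < Re (1 + h)%C)%R) by (destruct h; simpl in *; lra).
  assert (Him : Im (1 + h)%C = Im h) by (destruct h; simpl; ring).
  assert (Hre0 : (0 < Re (1 + h)%C)%R) by lra.
  pose proof (Carg_Re_pos (1 + h) Hre0) as Hb.
  pose proof (sin_Carg (1 + h) (slit_neq_0 _ (Re_pos_slit _ Hre0))) as Hs.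
  pose proof (Re_Cmod_le (1 + h)) as H6. apply Rabs_le_between in H6.
  rewrite Him in Hs.
  assert (Hmod : (1 / 2 < Cmod (1 + h))%R) by lra.
  assert (E : (Im h / Cmod (1 + h) * Cmod (1 + h) = Im h)%R) by (field; lra).
  rewrite <- Hs in E. set (th := Carg (1 + h)) in *. set (k := Cmod (1 + h)) in *.
  assert (Hs1 : (- sin m' < sin th < sin m')%R) by (split; nra).
  assert (Hlt : (th < m')%R) by (apply sin_increasing_0; lra).
  assert (Hgt : (- m' < th)%R) by (apply sin_increasing_0; try lra; rewrite sin_neg; lra).
  apply Rabs_def1; lra.
Qed.

(** Near [z0], [z^p] is [z0^p] times the binomial series in [(z - z0) / z0], because the arguments
    of [z0] and of [z / z0] still add up inside the principal strip. *)
Lemma analytic_at_Cpower_id (p z0 : C) : slit z0 -> analytic_at (fun z => Cpower z p) z0.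
Proof.
  intros Hs. pose proof (slit_neq_0 _ Hs) as Hz0. pose proof (Carg_slit z0 Hs) as Ha.
  destruct (Carg_near_1 (Rmin (PI - Carg z0) (PI + Carg z0))) as [d [Hd Hnear]]; [apply Rmin_pos; lra|].
  assert (Hm : (0 < Cmod z0)%R) by (apply Cmod_gt_0, Hz0).
  apply (analytic_at_intro _ z0 (d * Cmod z0)%R
    (fun n => Cpower z0 p * (poch (- p) n / INR (fact n) * (- / z0) ^ n))); [nra|].
  intros h Hh.
  assert (Hh' : (Cmod (- / z0 * h) < d)%R).
  { rewrite Cmod_mult, Cmod_opp, Cmod_inv by exact Hz0.
    apply Rmult_lt_reg_l with (Cmod z0); [exact Hm|]. rewrite <- Rmult_assoc, Rinv_r by lra. lra. }
  assert (E : z0 + h = z0 * (1 + / z0 * h)) by (field; exact Hz0).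
  assert (Hh2 : (Cmod (/ z0 * h) < d)%R).
  { replace (/ z0 * h) with (- (- / z0 * h)) by ring. rewrite Cmod_opp. exact Hh'. }
  rewrite E, Cpower_mult_arg; [|exact Hz0| |].
  - apply Csums_ext with (fun n => Cpower z0 p * (poch (- p) n / INR (fact n) * (- / z0 * h) ^ n));
      [intros n; rewrite Cpow_mult_l; ring|].
    apply Csums_scal. replace (1 + / z0 * h) with (1 - (- / z0 * h)) by ring.
    pose proof (binomial_series (- p) (- / z0 * h) ltac:(lra)) as HB.
    replace (- - p) with p in HB by ring. exact HB.
  - replace (1 + / z0 * h) with (1 - 1%R * (- / z0 * h)) by ring.
    apply slit_neq_0, Re_pos_slit, Re_1_minus; lra.
  - specialize (Hnear _ Hh2). apply Rabs_def2 in Hnear.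
    pose proof (Rmin_l (PI - Carg z0) (PI + Carg z0)). pose proof (Rmin_r (PI - Carg z0) (PI + Carg z0)). lra.
Qed.

Lemma analytic_at_Cpower (f : C -> C) (p z0 : C) : slit (f z0) -> analytic_at f z0 ->
  analytic_at (fun z => Cpower (f z) p) z0.
Proof. intros Hs Hf. apply (analytic_at_comp (fun w => Cpower w p) f); [apply analytic_at_Cpower_id, Hs|exact Hf]. Qed.

(** * Pochhammer symbols and the Chu-Vandermonde sum *)

Lemma INR_S_C (n : nat) : RtoC (INR (S n)) = INR n + 1.
Proof. rewrite S_INR, RtoC_plus. reflexivity. Qed.

Lemma INR_add_C (n m : nat) : RtoC (INR (n + m)) = INR n + INR m.
Proof. rewrite plus_INR, RtoC_plus. reflexivity. Qed.

Lemma poch_S_l (z : C) (n : nat) : poch z (S n) = z * poch (z + 1) n.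
Proof.
  induction n as [|n IH]; [simpl; ring|].
  change (poch z (S (S n))) with (poch z (S n) * (z + INR (S n))).
  rewrite IH, INR_S_C. simpl. ring.
Qed.

Lemma poch_add (z : C) (m n : nat) : poch z (m + n) = poch z m * poch (z + INR m) n.
Proof.
  induction n as [|n IH].
  - rewrite Nat.add_0_r. simpl. ring.
  - rewrite Nat.add_succ_r. simpl. rewrite IH, INR_add_C. ring.
Qed.

Lemma poch_reflect (z : C) (n : nat) : poch (1 - z - INR n) n = (-(1)) ^ n * poch z n.
Proof.
  revert z; induction n as [|n IH]; intros z; [simpl; ring|].
  rewrite poch_S_l. replace (1 - z - INR (S n) + 1) with (1 - z - INR n) by (rewrite INR_S_C; ring).
  rewrite IH, INR_S_C. simpl. ring.
Qed.

Lemma nonpole_shift (c : C) (m : nat) : nonpole c -> nonpole (c + INR m).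
Proof. intros H n. replace (c + INR m + INR n) with (c + INR (m + n)) by (rewrite INR_add_C; ring). apply H. Qed.

Lemma nonpole_pos (x : R) : (0 < x)%R -> nonpole x.
Proof. intros H n E. rewrite <- RtoC_plus in E. apply RtoC_inj in E. pose proof (pos_INR n). lra. Qed.

(** Pascal's rule, in the form that drives inductions on [n]: multiplying by [n + 1 = j + (n + 1 - j)]
    lowers one of the two factorials. *)
Lemma csum_pascal (F : nat -> C) (n : nat) :
  INR (S n) * csum (fun j => F j / (INR (fact j) * INR (fact (S n - j)))) (S (S n)) =
  csum (fun j => (F j + F (S j)) / (INR (fact j) * INR (fact (n - j)))) (S n).
Proof.
  assert (E1 : csum (fun j => INR (S n - j) * (F j / (INR (fact j) * INR (fact (S n - j))))) (S (S n)) =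
    csum (fun j => F j / (INR (fact j) * INR (fact (n - j)))) (S n)).
  { change (csum ?f (S (S n))) with (csum f (S n) + f (S n)). cbv beta. rewrite Nat.sub_diag.
    simpl (INR 0). rewrite Cmult_0_l, Cplus_0_r. apply csum_ext. intros j Hj.
    replace (S n - j)%nat with (S (n - j)) by lia. rewrite INR_fact_C, INR_S_C.
    field. repeat split; try apply fact_neq_0_C. apply nonpole_1. }
  assert (E2 : csum (fun j => INR j * (F j / (INR (fact j) * INR (fact (S n - j))))) (S (S n)) =
    csum (fun j => F (S j) / (INR (fact j) * INR (fact (n - j)))) (S n)).
  { rewrite csum_shift. simpl (INR 0). rewrite Cmult_0_l, Cplus_0_l. apply csum_ext. intros j Hj.
    replace (S n - S j)%nat with (n - j)%nat by lia. rewrite INR_fact_C, INR_S_C.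
    field. repeat split; try apply fact_neq_0_C. apply nonpole_1. }
  rewrite <- csum_scal.
  rewrite (csum_ext (fun j => (F j + F (S j)) / _)
    (fun j => F j / (INR (fact j) * INR (fact (n - j))) + F (S j) / (INR (fact j) * INR (fact (n - j))))).
  2:{ intros j _. field. split; apply fact_neq_0_C. }
  rewrite csum_plus, <- E1, <- E2, <- csum_plus. apply csum_ext. intros j Hj.
  replace (INR (S n)) with (INR (S n - j) + INR j)%R by (rewrite <- plus_INR; f_equal; lia).
  rewrite RtoC_plus. ring.
Qed.

(** Induction on [n]: by [csum_pascal] the sum for [n + 1] and [c] is [c - b] times the sum for
    [n] and [c + 1]. *)
Lemma chu_vandermonde_poly (b c : C) (n : nat) :
  csum (fun j => (-(1)) ^ j * poch b j * poch (c + INR j) (n - j) / (INR (fact j) * INR (fact (n - j)))) (S n) =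
  poch (c - b) n / INR (fact n).
Proof.
  revert c; induction n as [|n IH]; intros c.
  - simpl. field.
  - pose proof (csum_pascal (fun j => (-(1)) ^ j * poch b j * poch (c + INR j) (S n - j)) n) as HP.
    cbv beta in HP.
    assert (E : INR (S n) * csum (fun j => (-(1)) ^ j * poch b j * poch (c + INR j) (S n - j) / (INR (fact j) * INR (fact (S n - j)))) (S (S n))
      = (c - b) * (poch (c + 1 - b) n / INR (fact n))).
    { rewrite HP, <- (IH (c + 1)), <- csum_scal. apply csum_ext. intros j Hj.
      replace (S n - S j)%nat with (n - j)%nat by lia. replace (S n - j)%nat with (S (n - j)) by lia.
      rewrite (poch_S_l (c + INR j)), INR_S_C. simpl (poch b (S j)). rewrite Cpow_S.
      replace (c + (INR j + 1)) with (c + INR j + 1) by ring. replace (c + 1 + INR j) with (c + INR j + 1) by ring.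
      field. split; apply fact_neq_0_C. }
    assert (Hn : RtoC (INR (S n)) <> 0) by (rewrite INR_S_C, Cplus_comm; apply nonpole_1).
    apply (f_equal (fun z => / INR (S n) * z)) in E.
    rewrite Cmult_assoc, Cinv_l, Cmult_1_l in E by exact Hn. rewrite E.
    rewrite poch_S_l. replace (c - b + 1) with (c + 1 - b) by ring. rewrite INR_fact_C, INR_S_C.
    field. split; first [apply fact_neq_0_C|apply nonpole_1].
Qed.

Lemma chu_vandermonde (b c : C) (n : nat) : nonpole c ->
  csum (fun j => (-(1)) ^ j * poch b j / (poch c j * INR (fact j) * INR (fact (n - j)))) (S n) =
  poch (c - b) n / (poch c n * INR (fact n)).
Proof.
  intros Hc.
  replace (poch (c - b) n / (poch c n * INR (fact n))) with (/ poch c n * (poch (c - b) n / INR (fact n)))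
    by (field; split; [apply fact_neq_0_C|apply poch_neq_0, Hc]).
  rewrite <- chu_vandermonde_poly, <- csum_scal. apply csum_ext. intros j Hj.
  replace (poch c n) with (poch c j * poch (c + INR j) (n - j)) by (rewrite <- poch_add; f_equal; lia).
  field. repeat split; try apply fact_neq_0_C; apply poch_neq_0; [apply nonpole_shift|]; exact Hc.
Qed.

(** * Growth of sequences defined by a recurrence *)

Lemma tends_inv_INR (b : C) : tends (fun n => / (INR n + b)) 0.
Proof.
  intros eps He. destruct (INR_unbounded (Cmod b + 1 / eps)%R) as [N HN]. exists N. intros n Hn.
  apply le_INR in Hn.
  assert (Hie : (0 < 1 / eps)%R) by (apply Rdiv_lt_0_compat; lra).
  assert (Hlow : (1 / eps < Cmod (INR n + b))%R).
  { assert (INR n <= Cmod (INR n + b) + Cmod b)%R; [|lra].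
    rewrite <- (Cmod_INR n) at 1. replace (RtoC (INR n)) with ((INR n + b) + - b) at 1 by ring.
    eapply Rle_trans; [apply Cmod_triangle|]. rewrite Cmod_opp. lra. }
  replace (/ (INR n + b) - 0) with (/ (INR n + b)) by ring.
  rewrite Cmod_inv by (apply Cmod_gt_0; lra).
  apply Rmult_lt_reg_r with (Cmod (INR n + b)); [lra|]. rewrite Rinv_l by lra.
  apply Rmult_lt_reg_r with (1 / eps)%R; [exact Hie|].
  replace (eps * Cmod (INR n + b) * (1 / eps))%R with (Cmod (INR n + b)) by (field; lra). lra.
Qed.

Lemma tends_ratio (a b : C) : nonpole b -> tends (fun n => (INR n + a) / (INR n + b)) 1.
Proof.
  intros Hb. apply tends_ext with (fun n => 1 + (a - b) * / (INR n + b)).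
  - intros n. field. rewrite Cplus_comm. apply Hb.
  - pose proof (tends_plus _ _ _ _ (tends_const 1)
      (tends_mult _ _ _ _ (tends_const (a - b)) (tends_inv_INR b))) as H.
    replace (1 + (a - b) * 0) with (RtoC 1) in H by ring. exact H.
Qed.

(** Poincare-type bound.  When the roots [l], [m] of the limiting characteristic equation lie in
    the closed unit disk, [K |p (n+1) - l p n| + |p n|] with [K] large grows at most by a factor
    close to 1 at each step. *)
Lemma subexp_recurrence (l m : C) (p e d : nat -> C) : (Cmod l <= 1)%R -> (Cmod m <= 1)%R ->
  tends e (l + m) -> tends d (- (l * m)) ->
  (forall n, p (S (S n)) = e n * p (S n) + d n * p n) -> subexp p.
Proof.
  intros Hl Hm He Hd Hp q Hq.
  (* [K] makes the cross term [|v n|] cost at most half of [q - 1], [eps] the perturbations the rest *)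
  set (K := (2 / (q - 1))%R). set (eps := Rmin ((q - 1) / 2) ((q - 1) / (2 * K))).
  assert (HK : (K * (q - 1) = 2)%R) by (unfold K; field; lra).
  assert (HK0 : (0 < K)%R) by (unfold K; apply Rdiv_lt_0_compat; lra).
  assert (Heps : (0 < eps)%R) by (apply Rmin_pos; apply Rdiv_lt_0_compat; lra).
  assert (Heps1 : (eps <= (q - 1) / 2)%R) by apply Rmin_l.
  assert (Heps2 : (2 * K * eps <= q - 1)%R).
  { replace (q - 1)%R with (2 * K * ((q - 1) / (2 * K)))%R by (field; lra).
    apply Rmult_le_compat_l; [lra|apply Rmin_r]. }
  destruct (He eps Heps) as [N1 HN1]. destruct (Hd eps Heps) as [N2 HN2].
  set (v := fun n => p (S n) - l * p n).
  destruct (geom_growth (fun n => K * Cmod (v n) + Cmod (p n))%R q (N1 + N2)) as [M [HM0 HM]].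
  - lra.
  - intros n. pose proof (Cmod_ge_0 (v n)). pose proof (Cmod_ge_0 (p n)). nra.
  - intros n Hn. specialize (HN1 n ltac:(lia)). specialize (HN2 n ltac:(lia)).
    assert (E : v (S n) = m * v n + ((e n - (l + m)) * p (S n) + (d n - - (l * m)) * p n))
      by (unfold v; rewrite Hp; ring).
    assert (Hps : (Cmod (p (S n)) <= Cmod (v n) + Cmod (p n))%R).
    { replace (p (S n)) with (v n + l * p n) by (unfold v; ring).
      eapply Rle_trans; [apply Cmod_triangle|]. rewrite Cmod_mult. pose proof (Cmod_ge_0 (p n)). nra. }
    assert (Hv : (Cmod (v (S n)) <= Cmod (v n) + eps * (Cmod (v n) + Cmod (p n)) + eps * Cmod (p n))%R).
    { rewrite E. eapply Rle_trans; [apply Cmod_triangle|].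
      eapply Rle_trans; [apply Rplus_le_compat_l, Cmod_triangle|]. rewrite !Cmod_mult.
      pose proof (Cmod_ge_0 (p n)). pose proof (Cmod_ge_0 (v n)). pose proof (Cmod_ge_0 (p (S n))).
      pose proof (Cmod_ge_0 (e n - (l + m))). pose proof (Cmod_ge_0 (d n - - (l * m))).
      assert (Cmod m * Cmod (v n) <= Cmod (v n))%R by nra.
      assert (Cmod (e n - (l + m)) * Cmod (p (S n)) <= eps * (Cmod (v n) + Cmod (p n)))%R
        by (apply Rmult_le_compat; lra).
      assert (Cmod (d n - - (l * m)) * Cmod (p n) <= eps * Cmod (p n))%R by (apply Rmult_le_compat_r; lra).
      lra. }
    pose proof (Cmod_ge_0 (p n)) as P1. pose proof (Cmod_ge_0 (v n)) as P2.
    apply Rle_trans with (K * (Cmod (v n) + eps * (Cmod (v n) + Cmod (p n)) + eps * Cmod (p n)) + (Cmod (v n) + Cmod (p n)))%R.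
    + apply Rplus_le_compat; [apply Rmult_le_compat_l; lra|exact Hps].
    + assert ((2 * K * eps) * Cmod (p n) <= (q - 1) * Cmod (p n))%R by (apply Rmult_le_compat_r; lra).
      assert ((K * eps) * Cmod (v n) <= (K * ((q - 1) / 2)) * Cmod (v n))%R
        by (apply Rmult_le_compat_r; [lra|apply Rmult_le_compat_l; lra]).
      replace (K * ((q - 1) / 2))%R with 1%R in * by lra.
      replace (q * (K * Cmod (v n) + Cmod (p n)))%R with
        (K * Cmod (v n) + (K * (q - 1)) * Cmod (v n) + Cmod (p n) + (q - 1) * Cmod (p n))%R by ring.
      rewrite HK. lra.
  - exists M. intros n. specialize (HM n). pose proof (Cmod_ge_0 (v n)).
    assert (0 <= K * Cmod (v n))%R by (apply Rmult_le_pos; lra). lra.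
Qed.

(** * Substitution of v/(1-v)^d in a power series *)

Lemma Cmod_poch_le (z : C) (x : R) (m : nat) : (Cmod z <= x)%R -> (Cmod (poch z m) <= Re (poch x m))%R /\ poch x m = RtoC (Re (poch x m)).
Proof.
  intros H. pose proof (Cmod_ge_0 z). induction m as [|m [IH1 IH2]]; [simpl; rewrite Cmod_1; split; [lra|reflexivity]|].
  assert (E : poch x (S m) = RtoC (Re (poch x m) * (x + INR m))).
  { simpl. rewrite IH2 at 1. rewrite <- RtoC_plus, <- RtoC_mult. reflexivity. }
  rewrite E. split; [|reflexivity]. simpl (poch z (S m)). rewrite Cmod_mult. simpl Re.
  pose proof (pos_INR m). apply Rmult_le_compat; try apply Cmod_ge_0; [exact IH1|].
  eapply Rle_trans; [apply Cmod_triangle|]. rewrite Cmod_INR. lra.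
Qed.

Lemma Cpower_pos_real (x r : R) : (0 < x)%R -> Cpower x r = RtoC (exp (r * ln x)).
Proof.
  intros Hx. rewrite Cpower_E by (intros E; apply RtoC_inj in E; lra).
  unfold Clog. rewrite Carg_pos_real, Cmod_R, Rabs_pos_eq by lra.
  replace (r * (ln x, 0%R)) with (RtoC (r * ln x)) by (apply injective_projections; simpl; ring).
  unfold Cexp, RtoC. simpl. rewrite cos_0, sin_0. apply injective_projections; simpl; ring.
Qed.

Lemma rsum_binom_le (z : C) (x t : R) (N : nat) : (Cmod z <= x)%R -> (0 <= t < 1)%R ->
  (rsum (fun m => Cmod (poch z m / INR (fact m) * (RtoC t) ^ m)) N <= exp (- x * ln (1 - t)))%R.
Proof.
  intros Hz Ht.
  assert (Hf : forall m, (0 < INR (fact m))%R) by (intros; apply lt_0_INR, lt_O_fact).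
  set (r := fun m => (Re (poch x m) / INR (fact m) * t ^ m)%R).
  assert (Hr0 : forall m, (Cmod (poch z m / INR (fact m) * (RtoC t) ^ m) <= r m)%R).
  { intros m. unfold r. rewrite Cmod_mult, Cmod_div, Cmod_INR, Cmod_pow, Cmod_R, Rabs_pos_eq
      by (try apply fact_neq_0_C; lra).
    apply Rmult_le_compat_r; [apply pow_le; lra|]. unfold Rdiv.
    apply Rmult_le_compat_r; [left; apply Rinv_0_lt_compat, Hf|]. apply Cmod_poch_le, Hz. }
  apply Rle_trans with (rsum r N); [apply rsum_le; intros; apply Hr0|].
  assert (Hb : Csums (fun m => RtoC (r m)) (RtoC (exp (- x * ln (1 - t))))).
  { rewrite <- Cpower_pos_real by lra. rewrite RtoC_minus, RtoC_opp.
    apply Csums_ext with (fun m => poch x m / INR (fact m) * (RtoC t) ^ m).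
    - intros m. unfold r. destruct (Cmod_poch_le z x m Hz) as [_ E]. rewrite E at 1.
      rewrite <- RtoC_pow, RtoC_mult, RtoC_div by (specialize (Hf m); lra). reflexivity.
    - apply binomial_series. rewrite Cmod_R, Rabs_pos_eq; lra. }
  apply Rnot_lt_le. intros Hlt.
  destruct (Hb (rsum r N - exp (- x * ln (1 - t)))%R ltac:(lra)) as [M HM].
  specialize (HM (M + N)%nat ltac:(lia)).
  assert (E : forall n, csum (fun m => RtoC (r m)) n = RtoC (rsum r n)).
  { induction n as [|n IH]; [reflexivity|]. simpl. rewrite IH, RtoC_plus. reflexivity. }
  rewrite E, <- RtoC_minus, Cmod_R in HM.
  assert (rsum r N <= rsum r (M + N))%R.
  { apply rsum_mono; [|lia]. intros k. eapply Rle_trans; [apply Cmod_ge_0|apply Hr0]. }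
  pose proof (Rle_abs (rsum r (M + N) - exp (- x * ln (1 - t))))%R. lra.
Qed.

(** Taylor coefficients of [(1-v)^(-A) * sum_j p j (v/(1-v)^d)^j]. *)
Definition binom_coef (p : nat -> C) (A : C) (d n : nat) : C :=
  csum (fun j => p j * (poch (A + INR d * INR j) (n - j) / INR (fact (n - j)))) (S n).

Lemma Cpower_binom_exponent (z A : C) (d j : nat) : z <> 0 ->
  Cpower z (- (A + INR d * INR j)) = Cpower z (- A) * (/ z ^ d) ^ j.
Proof.
  intros Hz. replace (- (A + INR d * INR j)) with (- A + (- INR d) * INR j) by ring.
  rewrite Cpower_plus, Cpower_nat by exact Hz. f_equal. f_equal.
  rewrite Cpower_opp by exact Hz. f_equal. replace (RtoC (INR d)) with (1 * INR d) by ring.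
  rewrite Cpower_nat, Cpower_1 by exact Hz. reflexivity.
Qed.

(** Each [v^j (1-v)^(-A-d j)] is expanded by the binomial series.  For small [v] the double series is
    dominated by [(M t / (1-t)^d)^j] with [t = |v|], and may be summed along antidiagonals. *)
Lemma binomial_substitution (p : nat -> C) (A : C) (d : nat) (C0 M : R) : (0 <= M)%R ->
  (forall j, (Cmod (p j) <= C0 * M ^ j)%R) ->
  exists e, (0 < e <= 1 / 2)%R /\ forall v, (Cmod v < e)%R -> exists s,
    Csums (fun j => p j * (v / (1 - v) ^ d) ^ j) s /\
    Csums (fun n => binom_coef p A d n * v ^ n) (Cpower (1 - v) (- A) * s).
Proof.
  intros HM Hp.
  assert (HC0 : (0 <= C0)%R) by (specialize (Hp O); simpl in Hp; pose proof (Cmod_ge_0 (p O)); lra).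
  assert (H2d : (0 < (1 / 2) ^ d)%R) by (apply pow_lt; lra).
  exists (Rmin (1 / 2) ((1 / 2) ^ d / (M + 1))).
  split; [split; [apply Rmin_pos; [lra|apply Rdiv_lt_0_compat; lra]|apply Rmin_l]|].
  intros v Hv. set (t := Cmod v) in *. pose proof (Cmod_ge_0 v) as Ht0. fold t in Ht0.
  pose proof (Rmin_l (1 / 2) ((1 / 2) ^ d / (M + 1))) as R1. pose proof (Rmin_r (1 / 2) ((1 / 2) ^ d / (M + 1))) as R2.
  assert (Hn : 1 - v <> 0).
  { replace (1 - v) with (1 - 1%R * v) by ring. apply slit_neq_0, Re_pos_slit, Re_1_minus; fold t; lra. }
  assert (Hpw : ((1 / 2) ^ d <= (1 - t) ^ d)%R) by (apply pow_incr; lra).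
  assert (H1t : (0 < (1 - t) ^ d)%R) by lra.
  set (th := (M * t / (1 - t) ^ d)%R).
  assert (Hth : (0 <= th < 1)%R).
  { unfold th. split; [apply Rdiv_le_0_compat; [nra|lra]|].
    apply Rmult_lt_reg_r with ((1 - t) ^ d)%R; [lra|]. unfold Rdiv. rewrite Rmult_assoc, Rinv_l by lra.
    assert ((M + 1) * t < (M + 1) * ((1 / 2) ^ d / (M + 1)))%R by (apply Rmult_lt_compat_l; lra).
    replace ((M + 1) * ((1 / 2) ^ d / (M + 1)))%R with ((1 / 2) ^ d)%R in * by (field; lra). nra. }
  set (E0 := exp (- Cmod A * ln (1 - t))).
  set (y := fun j m => p j * v ^ j * (poch (A + INR d * INR j) m / INR (fact m) * v ^ m)).
  assert (Hrow : forall j, Csums (y j) (p j * v ^ j * Cpower (1 - v) (- (A + INR d * INR j)))).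
  { intros j. apply Csums_scal, binomial_series. fold t. lra. }
  assert (Hbd : rect_bounded y (C0 * E0 / (1 - th))).
  { intros K N. apply Rle_trans with (rsum (fun j => C0 * E0 * th ^ j)%R K).
    - apply rsum_le. intros j _. unfold y.
      rewrite (rsum_ext _ (fun m => Cmod (p j * v ^ j) * Cmod (poch (A + INR d * INR j) m / INR (fact m) * (RtoC t) ^ m))%R).
      2:{ intros m _. rewrite !Cmod_mult, !Cmod_pow, Cmod_R. fold t. rewrite (Rabs_pos_eq t) by lra. reflexivity. }
      rewrite rsum_scal.
      assert (HA : (Cmod (A + INR d * INR j) <= Cmod A + INR d * INR j)%R).
      { eapply Rle_trans; [apply Cmod_triangle|]. rewrite Cmod_mult, !Cmod_INR. lra. }
      pose proof (rsum_binom_le _ _ t N HA ltac:(lra)) as HB.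
      replace (exp (- (Cmod A + INR d * INR j) * ln (1 - t)))%R with (E0 * / (((1 - t) ^ d) ^ j))%R in HB.
      2:{ unfold E0. rewrite <- pow_mult, <- Rpower_pow by lra. unfold Rpower. rewrite <- exp_Ropp, <- exp_plus.
          f_equal. rewrite mult_INR. ring. }
      rewrite Cmod_mult, Cmod_pow. fold t.
      apply Rle_trans with (C0 * M ^ j * t ^ j * (E0 * / (((1 - t) ^ d) ^ j)))%R.
      + apply Rmult_le_compat; [|apply rsum_pos; intros; apply Cmod_ge_0| |exact HB].
        * apply Rmult_le_pos; [apply Cmod_ge_0|apply pow_le; lra].
        * apply Rmult_le_compat_r; [apply pow_le; lra|apply Hp].
      + right. unfold th, Rdiv. rewrite !Rpow_mult_distr, pow_inv. ring.
    - apply rsum_geom; [|exact Hth]. unfold E0. pose proof (exp_pos (- Cmod A * ln (1 - t))). nra. }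
  destruct (Csums_antidiagonal y _ _ Hbd Hrow) as [T [H1 H2]].
  exists (T / Cpower (1 - v) (- A)). pose proof (Cpower_neq_0 (1 - v) (- A) Hn) as Hcp. split.
  - apply Csums_ext with (fun j => / Cpower (1 - v) (- A) * (p j * v ^ j * Cpower (1 - v) (- (A + INR d * INR j)))).
    + intros j. rewrite Cpower_binom_exponent by exact Hn. unfold Cdiv. rewrite Cpow_mult_l. field. exact Hcp.
    + replace (T / Cpower (1 - v) (- A)) with (/ Cpower (1 - v) (- A) * T) by (unfold Cdiv; ring).
      apply Csums_scal, H1.
  - replace (Cpower (1 - v) (- A) * (T / Cpower (1 - v) (- A))) with T by (field; exact Hcp).
    apply Csums_ext with (2 := H2). intros n. unfold binom_coef. rewrite Cmult_comm, <- csum_scal.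
    apply csum_ext. intros j Hj. unfold y.
    replace (v ^ n) with (v ^ j * v ^ (n - j)) by (rewrite <- Cpow_add_r; f_equal; lia). ring.
Qed.

(** * Continuation of the Gauss series to the cut plane *)

Lemma Re_plus (z w : C) : Re (z + w) = (Re z + Re w)%R. Proof. reflexivity. Qed.
Lemma Im_plus (z w : C) : Im (z + w) = (Im z + Im w)%R. Proof. reflexivity. Qed.
Lemma Re_minus (z w : C) : Re (z - w) = (Re z - Re w)%R. Proof. reflexivity. Qed.
Lemma Im_minus (z w : C) : Im (z - w) = (Im z - Im w)%R. Proof. reflexivity. Qed.
Lemma Re_mult (z w : C) : Re (z * w) = (Re z * Re w - Im z * Im w)%R. Proof. reflexivity. Qed.
Lemma Im_mult (z w : C) : Im (z * w) = (Re z * Im w + Im z * Re w)%R. Proof. reflexivity. Qed.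

Lemma INR_2_C : RtoC (INR 2) = 2.
Proof. reflexivity. Qed.

Lemma nonpole_neq (c : C) (n : nat) : nonpole c -> INR n + c <> 0.
Proof. intros H. rewrite Cplus_comm. apply H. Qed.

Lemma poch_S (z : C) (n : nat) : poch z (S n) = poch z n * (z + INR n).
Proof. reflexivity. Qed.

Lemma poch_0 (z : C) : poch z 0 = 1.
Proof. reflexivity. Qed.

(** Nonvanishing of the denominators met below: pole-free parameters, factorials, and positive
    combinations of natural numbers. *)
Ltac nz :=
  first [ assumption | apply nonpole_neq; assumption | apply poch_neq_0; assumption | apply fact_neq_0_C
        | match goal with H : nonpole ?c |- Cplus ?c (Cplus (RtoC (INR ?n)) _) <> _ => rewrite <- (INR_S_C n); exact (H (S n)) end
        | match goal with H : nonpole ?c |- ?c + _ <> _ => apply H end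
        | let E := fresh in intro E; apply (f_equal Re) in E; simpl in E; revert E;
          repeat match goal with |- context [INR ?k] => generalize (pos_INR k); generalize (INR k) end;
          intros; lra ].

Definition cut_term (a b c : C) (n j : nat) : C :=
  (- (4)) ^ j * gauss_coef a b c j * (poch (2 * a + 2 * INR j) (n - j) / INR (fact (n - j))).

(** Taylor coefficients of [(1-v)^(-2a) F(a,b;c;-4v/(1-v)^2)] at [v = 0]. *)
Definition cut_coef (a b c : C) (n : nat) : C := csum (cut_term a b c n) (S n).

(** Antidifference in [j] of the left-hand side of [cut_cert_step], found by creative telescoping. *)
Definition cut_cert (a b c : C) (n j : nat) : C :=
  match j with
  | O => 0
  | S i => - (2) * (INR n + 1 + a) * (- (4)) ^ (S i) * poch a (S i) * poch b (S i) *
      poch (2 * a + 2 * INR i + 1) (n - i) / (poch c i * INR (fact i) * INR (fact (S n - i)))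
  end.

Lemma cut_cert_step (a b c : C) (j m : nat) : nonpole c -> let n := (j + m)%nat in
  (INR n + 2) * (INR n + 1 + c) * cut_term a b c (S (S n)) j
  - 2 * (c - 2 * b) * (INR n + 1 + a) * cut_term a b c (S n) j
  - (INR n + 2 * a) * (INR n + 1 + 2 * a - c) * cut_term a b c n j =
  cut_cert a b c n (S j) - cut_cert a b c n j.
Proof.
  intros Hc n. unfold cut_term, cut_cert, gauss_coef.
  replace (S (S n) - j)%nat with (S (S m)) by lia. replace (S n - j)%nat with (S m) by lia.
  replace (n - j)%nat with m by lia.
  assert (Hn : RtoC (INR n) = INR j + INR m) by (apply INR_add_C). rewrite Hn.
  set (z := 2 * a + 2 * INR j).
  assert (Hf := fact_neq_0_C). assert (Hi := nonpole_1).
  assert (E3 : poch z (S (S m)) = z * poch (z + 1) m * (z + 1 + INR m))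
    by (rewrite (poch_S_l z (S m)); simpl; ring).
  assert (E2 : poch z (S m) = z * poch (z + 1) m) by apply poch_S_l.
  rewrite E3, E2. clear E3 E2.
  (* all Pochhammer symbols through the shortest one, at [z + 1] *)
  destruct m as [|m].
  - destruct j as [|i].
    + unfold z. replace (n - 0)%nat with O by lia. replace (S n - 0)%nat with 1%nat by lia. rewrite !INR_fact_C, !INR_S_C. simpl. field.
    + replace (n - i)%nat with 1%nat by lia. replace (n - S i)%nat with O by lia.
      replace (S n - i)%nat with 2%nat by lia. replace (S n - S i)%nat with 1%nat by lia.
      replace (2 * a + 2 * INR i + 1) with (z - 1) by (unfold z; rewrite INR_S_C; ring).
      unfold z. rewrite ?INR_fact_C, ?poch_S, ?poch_0, ?Cpow_S, ?INR_S_C. simpl (INR 0). simpl (fact 0). simpl (INR 1).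
      field. repeat split; nz.
  - destruct j as [|i].
    + replace (n - 0)%nat with (S m) by lia. replace (S n - 0)%nat with (S (S m)) by lia.
      replace (2 * a + 2 * INR 0 + 1) with (z + 1) by (unfold z; simpl; ring).
      rewrite (poch_S_l z m), (poch_S (z + 1) m). set (Y := poch (z + 1) m).
      unfold z. rewrite ?INR_fact_C, ?poch_S, ?poch_0, ?Cpow_S, ?INR_S_C. simpl (INR 0). simpl (fact 0). simpl (INR 1).
      field. repeat split; nz.
    + replace (n - i)%nat with (S (S m)) by lia. replace (n - S i)%nat with (S m) by lia.
      replace (S n - i)%nat with (S (S (S m))) by lia. replace (S n - S i)%nat with (S (S m)) by lia.
      replace (2 * a + 2 * INR i + 1) with (z - 1) by (unfold z; rewrite INR_S_C; ring).
      rewrite (poch_S_l (z - 1) (S m)). replace (z - 1 + 1) with z by ring.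
      replace (2 * a + 2 * INR (S i) + 1) with (z + 1) by reflexivity.
      rewrite (poch_S_l z m), (poch_S (z + 1) m). set (Y := poch (z + 1) m).
      unfold z. rewrite ?INR_fact_C, ?poch_S, ?poch_0, ?Cpow_S, ?INR_S_C. simpl (INR 0). simpl (fact 0). simpl (INR 1).
      field. repeat split; nz.
Qed.

Lemma cut_recurrence (a b c : C) (n : nat) : nonpole c ->
  (INR n + 2) * (INR n + 1 + c) * cut_coef a b c (S (S n)) =
  2 * (c - 2 * b) * (INR n + 1 + a) * cut_coef a b c (S n)
  + (INR n + 2 * a) * (INR n + 1 + 2 * a - c) * cut_coef a b c n.
Proof.
  intros Hc. unfold cut_coef.
  change (csum (cut_term a b c (S (S n))) (S (S (S n)))) with
    (csum (cut_term a b c (S (S n))) (S n) + cut_term a b c (S (S n)) (S n) + cut_term a b c (S (S n)) (S (S n))).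
  change (csum (cut_term a b c (S n)) (S (S n))) with
    (csum (cut_term a b c (S n)) (S n) + cut_term a b c (S n) (S n)).
  set (A := (INR n + 2) * (INR n + 1 + c)). set (B := 2 * (c - 2 * b) * (INR n + 1 + a)).
  set (D := (INR n + 2 * a) * (INR n + 1 + 2 * a - c)).
  assert (HT : A * csum (cut_term a b c (S (S n))) (S n) - B * csum (cut_term a b c (S n)) (S n)
     - D * csum (cut_term a b c n) (S n) = cut_cert a b c n (S n)).
  { rewrite <- !csum_scal, <- !csum_minus.
    assert (G : forall k, (k <= S n)%nat -> csum (fun j => A * cut_term a b c (S (S n)) j
       - B * cut_term a b c (S n) j - D * cut_term a b c n j) k = cut_cert a b c n k).
    { induction k as [|k IH]; intros Hk; [reflexivity|].
      simpl csum. rewrite IH by lia.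
      pose proof (cut_cert_step a b c k (n - k) Hc) as E. cbv zeta in E.
      replace (k + (n - k))%nat with n in E by lia. unfold A, B, D. rewrite E. ring. }
    apply G. lia. }
  assert (HE : A * (cut_term a b c (S (S n)) (S n) + cut_term a b c (S (S n)) (S (S n)))
     - B * cut_term a b c (S n) (S n) + cut_cert a b c n (S n) = 0).
  { unfold A, B, cut_term, cut_cert, gauss_coef.
    replace (S (S n) - S n)%nat with 1%nat by lia. replace (S (S n) - S (S n))%nat with 0%nat by lia.
    replace (S n - S n)%nat with 0%nat by lia. replace (n - n)%nat with 0%nat by lia.
    replace (S n - n)%nat with 1%nat by lia.
    rewrite ?INR_fact_C, ?poch_S, ?poch_0, ?Cpow_S, ?INR_S_C. simpl (INR 0). simpl (fact 0).
    field. repeat split; nz. }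
  match goal with |- A * (?x + ?y + ?z) = B * (?u + ?v) + D * ?w =>
    replace (A * (x + y + z)) with ((A * x - B * u - D * w) + (A * (y + z) - B * v) + B * (u + v) + D * w) by ring
  end.
  rewrite HT.
  match goal with |- ?g + ?h + _ + _ = _ => replace (g + h) with (RtoC 0) by (rewrite <- HE; ring) end. ring.
Qed.

(** In the variable [v] the hypergeometric equation is singular only at [0], [1], [-1] and infinity,
    which is why the limiting characteristic roots are [1] and [-1]. *)
Lemma subexp_cut_coef (a b c : C) : nonpole c -> subexp (cut_coef a b c).
Proof.
  intros Hc.
  apply (subexp_recurrence 1 (- (1)) (cut_coef a b c)
    (fun n => 2 * (c - 2 * b) * ((INR n + (1 + a)) / (INR n + 2)) * / (INR n + (1 + c)))
    (fun n => (INR n + 2 * a) / (INR n + 2) * ((INR n + (1 + 2 * a - c)) / (INR n + (1 + c))))).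
  - rewrite Cmod_1; lra.
  - rewrite Cmod_opp, Cmod_1; lra.
  - pose proof (tends_mult _ _ _ _ (tends_mult _ _ _ _ (tends_const (2 * (c - 2 * b)))
      (tends_ratio (1 + a) 2 (nonpole_pos 2 ltac:(lra)))) (tends_inv_INR (1 + c))) as H.
    replace (1 + - (1)) with (2 * (c - 2 * b) * 1 * 0) by ring. exact H.
  - assert (Hc1 : nonpole (1 + c)).
    { intros n. replace (1 + c + INR n) with (c + INR (S n)) by (rewrite INR_S_C; ring). apply Hc. }
    pose proof (tends_mult _ _ _ _ (tends_ratio (2 * a) 2 (nonpole_pos 2 ltac:(lra))) (tends_ratio (1 + 2 * a - c) (1 + c) Hc1)) as H.
    replace (- (1 * - (1))) with (RtoC 1 * 1) by ring. exact H.
  - intros n. pose proof (cut_recurrence a b c n Hc) as E.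
    assert (H1 : INR n + 2 <> 0) by nz.
    assert (H2 : INR n + 1 + c <> 0).
    { replace (INR n + 1 + c) with (c + INR (S n)) by (rewrite INR_S_C; ring). apply Hc. }
    replace (cut_coef a b c (S (S n))) with
      ((INR n + 2) * (INR n + 1 + c) * cut_coef a b c (S (S n)) / ((INR n + 2) * (INR n + 1 + c))) by (field; split; assumption).
    rewrite E. field. split; [|exact H1]. replace (INR n + (1 + c)) with (INR n + 1 + c) by ring. exact H2.
Qed.

Lemma subexp_gauss (a b c : C) : nonpole c -> subexp (gauss_coef a b c).
Proof.
  intros Hc q Hq. destruct (subexp_mult _ _ (subexp_poch_ratio a c Hc) (subexp_binom b) q Hq) as [M HM].
  exists M. intros n. unfold gauss_coef.
  replace (poch a n * poch b n / (poch c n * INR (fact n))) with (poch a n / poch c n * (poch b n / INR (fact n)))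
    by (field; split; [apply fact_neq_0_C|apply poch_neq_0, Hc]). apply HM.
Qed.

(** The Gauss series as a function; meaningful for [|z| < 1]. *)
Definition Phi (a b c z : C) : C := CSeries (fun n => gauss_coef a b c n * z ^ n).

Lemma Phi_Csums (a b c z : C) : nonpole c -> (Cmod z < 1)%R ->
  Csums (fun n => gauss_coef a b c n * z ^ n) (Phi a b c z).
Proof. intros Hc. apply subexp_Csums, subexp_gauss, Hc. Qed.

Lemma Phi_analytic (a b c z : C) : nonpole c -> (Cmod z < 1)%R -> analytic_at (Phi a b c) z.
Proof. intros Hc. apply (analytic_at_pseries (gauss_coef a b c) 1). intros w Hw. apply Phi_Csums; assumption. Qed.

Lemma hyp_domain_slit (z : C) : hyp_domain z -> slit (1 - z).
Proof.
  intros H. destruct z as [x y]. unfold hyp_domain in H. simpl in H. unfold slit. simpl.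
  destruct (Req_dec y 0) as [->|Hy]; [left|right; lra].
  apply Rnot_le_lt. intros Hle. apply H. split; [reflexivity|lra].
Qed.

Lemma hyp_domain_disk (z : C) : (Cmod z < 1)%R -> hyp_domain z.
Proof. intros H [_ H2]. pose proof (Re_Cmod_le z) as E. apply Rabs_le_between in E. lra. Qed.

Lemma hyp_domain_star (z : C) (t : R) : hyp_domain z -> (0 <= t <= 1)%R -> hyp_domain (t * z).
Proof.
  intros H Ht [H1 H2]. rewrite Re_scal in H2. rewrite Im_scal in H1.
  assert (0 < t)%R by (destruct (Req_dec t 0) as [->|]; lra).
  apply H. split; nra.
Qed.

Lemma disk_star (z : C) (t r : R) : (Cmod z < r)%R -> (0 <= t <= 1)%R -> (Cmod (t * z) < r)%R.
Proof.
  intros H Ht. rewrite Cmod_mult, Cmod_R, Rabs_pos_eq by lra. pose proof (Cmod_ge_0 z). nra.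
Qed.

(** [z = -4 v / (1 - v)^2] maps the unit disk conformally onto the cut plane; this is its inverse. *)
Definition cut_var (z : C) : C := (Csqrt (1 - z) - 1) / (Csqrt (1 - z) + 1).

Definition cut_fun (a b c z : C) : C :=
  Cpower (1 - cut_var z) (2 * a) * CSeries (fun n => cut_coef a b c n * cut_var z ^ n).

Lemma Cmod_lt_sqr (z w : C) : (Re z ^ 2 + Im z ^ 2 < Re w ^ 2 + Im w ^ 2)%R -> (Cmod z < Cmod w)%R.
Proof. intros H. unfold Cmod. apply sqrt_lt_1; unfold Re, Im in H; nra. Qed.

Lemma Cayley_disk (q : C) : (0 < Re q)%R -> q + 1 <> 0 /\ (Cmod ((q - 1) / (q + 1)) < 1)%R.
Proof.
  intros H.
  assert (Hn : q + 1 <> 0) by (apply slit_neq_0; left; destruct q; simpl in *; lra).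
  split; [exact Hn|]. rewrite Cmod_div by exact Hn. apply Cmod_gt_0 in Hn as Hn'.
  apply Rmult_lt_reg_r with (Cmod (q + 1)); [exact Hn'|]. unfold Rdiv. rewrite Rmult_assoc, Rinv_l by lra.
  rewrite Rmult_1_r, Rmult_1_l. apply Cmod_lt_sqr. destruct q as [x y]; simpl in *. nra.
Qed.

Lemma disk_1_minus (z : C) : (Cmod z < 1)%R -> (0 < Re (1 - z)%C)%R.
Proof. intros H. replace (1 - z) with (1 - 1%R * z) by ring. apply Re_1_minus; [lra|exact H]. Qed.

Lemma Csqrt_analytic (f : C -> C) (z : C) : slit (f z) -> analytic_at f z -> analytic_at (fun w => Csqrt (f w)) z.
Proof. apply analytic_at_Cpower. Qed.

Lemma cut_var_disk (z : C) : hyp_domain z -> (Cmod (cut_var z) < 1)%R.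
Proof. intros H. apply Cayley_disk, Csqrt_Re_pos, hyp_domain_slit, H. Qed.

Lemma cut_var_analytic (z : C) : hyp_domain z -> analytic_at cut_var z.
Proof.
  intros H. pose proof (hyp_domain_slit z H) as Hs.
  assert (Hq : analytic_at (fun w => Csqrt (1 - w)) z).
  { apply Csqrt_analytic; [exact Hs|]. apply analytic_at_minus; [apply analytic_at_const|apply analytic_at_id]. }
  apply analytic_at_div.
  - apply Cayley_disk, Csqrt_Re_pos, Hs.
  - apply analytic_at_minus; [exact Hq|apply analytic_at_const].
  - apply analytic_at_plus; [exact Hq|apply analytic_at_const].
Qed.

Lemma cut_var_inverse (z : C) : hyp_domain z -> cut_var z / (1 - cut_var z) ^ 2 = - z / 4.
Proof.
  intros H. pose proof (hyp_domain_slit z H) as Hs. unfold cut_var.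
  pose proof (Csqrt_sqr (1 - z) (slit_neq_0 _ Hs)) as E. set (q := Csqrt (1 - z)) in *.
  assert (Hq : q + 1 <> 0) by (apply Cayley_disk, Csqrt_Re_pos, Hs).
  replace z with (1 - q * q) by (rewrite E; ring).
  assert (H4 : (RtoC 4) <> 0) by (intros E4; apply RtoC_inj in E4; lra).
  assert (H2 : (RtoC 2) <> 0) by (intros E4; apply RtoC_inj in E4; lra).
  replace (1 - (q - 1) / (q + 1)) with (2 / (q + 1)) by (field; exact Hq).
  simpl. field. repeat split; assumption.
Qed.

Lemma cut_fun_analytic (a b c z : C) : nonpole c -> hyp_domain z -> analytic_at (cut_fun a b c) z.
Proof.
  intros Hc Hz. pose proof (cut_var_analytic z Hz) as Hv. pose proof (cut_var_disk z Hz) as Hd.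
  apply analytic_at_mult.
  - apply analytic_at_Cpower; [left; apply disk_1_minus, Hd|].
    apply analytic_at_minus; [apply analytic_at_const|exact Hv].
  - apply (analytic_at_pseries_comp (cut_coef a b c) 1 (fun w => CSeries (fun n => cut_coef a b c n * w ^ n)) cut_var z);
      [|exact Hd|exact Hv].
    intros w Hw. apply subexp_Csums; [apply subexp_cut_coef, Hc|exact Hw].
Qed.

Lemma cut_var_0 : cut_var 0 = 0.
Proof.
  unfold cut_var, Csqrt. replace (1 - 0) with (RtoC 1) by ring.
  rewrite half_RtoC, Cpower_pos_real by lra. rewrite ln_1, Rmult_0_r, exp_0. unfold Cdiv. ring.
Qed.

(** [binomial_substitution] with [v/(1-v)^2 = -z/4]. *)
Lemma cut_fun_Phi_near_0 (a b c : C) : nonpole c ->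
  exists e, (0 < e)%R /\ forall z, (Cmod z < e)%R -> cut_fun a b c z = Phi a b c z.
Proof.
  intros Hc. destruct (subexp_gauss a b c Hc 2%R ltac:(lra)) as [M HM].
  destruct (binomial_substitution (fun j => (- (4)) ^ j * gauss_coef a b c j) (2 * a) 2 M 8) as [e [He Hsub]]; [lra| |].
  { intros j. rewrite Cmod_mult, Cmod_pow, Cmod_opp, Cmod_R, Rabs_pos_eq by lra.
    replace (M * 8 ^ j)%R with (4 ^ j * (M * 2 ^ j))%R
      by (replace 8%R with (4 * 2)%R by ring; rewrite Rpow_mult_distr; ring).
    apply Rmult_le_compat_l; [apply pow_le; lra|apply HM]. }
  destruct (analytic_at_continuous cut_var 0 (cut_var_analytic 0 ltac:(apply hyp_domain_disk; rewrite Cmod_0; lra)) e ltac:(lra)) as [d [Hd Hcont]].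
  exists (Rmin d 1). split; [apply Rmin_pos; lra|]. intros z Hz.
  assert (Hz1 : (Cmod z < 1)%R) by (eapply Rlt_le_trans; [exact Hz|apply Rmin_r]).
  pose proof (hyp_domain_disk z Hz1) as Hdom.
  assert (Hv : (Cmod (cut_var z) < e)%R).
  { specialize (Hcont z). rewrite cut_var_0 in Hcont. replace (cut_var z - 0) with (cut_var z) in Hcont by ring.
    apply Hcont. replace (z - 0) with z by ring. eapply Rlt_le_trans; [exact Hz|apply Rmin_l]. }
  destruct (Hsub _ Hv) as [s [H1 H2]].
  assert (H4 : (RtoC 4) <> 0) by (intros E4; apply RtoC_inj in E4; lra).
  assert (Es : s = Phi a b c z).
  { apply (Csums_unique _ _ _ H1). apply Csums_ext with (2 := Phi_Csums a b c z Hc Hz1).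
    intros j. rewrite cut_var_inverse by exact Hdom.
    replace (- z / 4) with (- / (4) * z) by (field; exact H4). rewrite Cpow_mult_l.
    replace ((- (4)) ^ j * gauss_coef a b c j * ((- / (4)) ^ j * z ^ j)) with
      (((- (4)) ^ j * (- / (4)) ^ j) * (gauss_coef a b c j * z ^ j)) by ring.
    rewrite <- Cpow_mult_l. replace (- (4) * - / (4)) with (RtoC 1) by (field; exact H4). rewrite Cpow_1_l. ring. }
  unfold cut_fun. rewrite <- Es.
  assert (E : CSeries (fun n => cut_coef a b c n * cut_var z ^ n) = Cpower (1 - cut_var z) (- (2 * a)) * s).
  { apply Csums_CSeries. apply Csums_ext with (2 := H2). intros n.
    unfold binom_coef, cut_coef, cut_term. rewrite INR_2_C. reflexivity. }
  assert (Hn : 1 - cut_var z <> 0) by (apply slit_neq_0; left; apply disk_1_minus, cut_var_disk, Hdom).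
  rewrite E, Cpower_opp by exact Hn. field. apply Cpower_neq_0, Hn.
Qed.

(** [cut_fun] is a continuation, and by the identity theorem on the star-shaped cut plane it is the
    only one. *)
Theorem hyp2F1_spec (a b c : C) : nonpole c -> exists F,
  (forall z, hyp_domain z -> analytic_at F z) /\ (forall z, (Cmod z < 1)%R -> F z = Phi a b c z) /\
  (forall z, hyp_domain z -> hyp2F1 a b c z = F z).
Proof.
  intros Hc. exists (cut_fun a b c).
  assert (HF : forall z, hyp_domain z -> analytic_at (cut_fun a b c) z) by (intros; apply cut_fun_analytic; assumption).
  destruct (cut_fun_Phi_near_0 a b c Hc) as [e [He Hnear]].
  assert (Hdisk : forall z, (Cmod z < 1)%R -> cut_fun a b c z = Phi a b c z).
  { apply (analytic_identity (fun z => (Cmod z < 1)%R) _ _ e); try assumption.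
    - intros z t Hz Ht. apply disk_star; assumption.
    - intros z Hz. apply HF, hyp_domain_disk, Hz.
    - intros z Hz. apply Phi_analytic; assumption. }
  split; [exact HF|split; [exact Hdisk|]]. intros z Hz.
  unfold hyp2F1. apply (iota_unique (V := C_CompleteNormedModule)).
  - intros w [G [[HG1 HG2] <-]].
    apply (analytic_identity hyp_domain G (cut_fun a b c) 1); try assumption.
    + intros; apply hyp_domain_star; assumption.
    + lra.
    + intros x Hx. rewrite Hdisk by exact Hx. specialize (HG2 x Hx).
      apply Csums_is_pseries in HG2. symmetry. apply Csums_CSeries, HG2.
  - exists (cut_fun a b c). split; [split|reflexivity].
    + exact HF.
    + intros x Hx. apply Csums_is_pseries. rewrite Hdisk by exact Hx. apply Phi_Csums; assumption.
Qed.

Lemma pfaff_coef (a b c : C) (n : nat) : nonpole c ->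
  binom_coef (fun j => (- (1)) ^ j * gauss_coef a b c j) a 1 n = gauss_coef a (c - b) c n.
Proof.
  intros Hc. unfold binom_coef, gauss_coef.
  replace (poch a n * poch (c - b) n / (poch c n * INR (fact n))) with (poch a n * (poch (c - b) n / (poch c n * INR (fact n))))
    by (field; split; [apply fact_neq_0_C|apply poch_neq_0, Hc]).
  rewrite <- (chu_vandermonde b c n Hc), <- csum_scal. apply csum_ext. intros j Hj.
  replace (poch a n) with (poch a j * poch (a + INR j) (n - j)) by (rewrite <- poch_add; f_equal; lia).
  replace (a + INR 1 * INR j) with (a + INR j) by (simpl; ring).
  field. repeat split; nz.
Qed.

(** Both sides are analytic in the unit disk, and near [0] their coefficients agree by
    Chu-Vandermonde.  The argument [-z/(1-z)] fills the half-plane [Re < 1/2], which contains all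
    the arguments at which Legendre functions are evaluated here. *)
Theorem pfaff (a b c z : C) : nonpole c -> (Cmod z < 1)%R ->
  hyp2F1 a b c (- z / (1 - z)) = Cpower (1 - z) a * Phi a (c - b) c z.
Proof.
  intros Hc Hz. destruct (hyp2F1_spec a b c Hc) as [F [HF1 [HF2 HF3]]].
  assert (Hn : forall w, (Cmod w < 1)%R -> 1 - w <> 0) by (intros w Hw; apply slit_neq_0; left; apply disk_1_minus, Hw).
  assert (Hdom : forall w, (Cmod w < 1)%R -> hyp_domain (- w / (1 - w))).
  { intros w Hw [H1 H2].
    pose proof (disk_1_minus w Hw) as Hp.
    assert (E : (1 - - w / (1 - w)) * (1 - w) = 1) by (field; apply Hn, Hw).
    set (k := 1 - - w / (1 - w)) in *.
    assert (Hk1 : Im k = 0%R) by (unfold k; rewrite Im_minus, H1; simpl; ring).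
    assert (Hk2 : (Re k <= 0)%R) by (unfold k; rewrite Re_minus; simpl (Re 1); lra).
    apply (f_equal Re) in E. rewrite Re_mult, Hk1 in E. simpl (Re 1) in E. nra. }
  rewrite HF3 by (apply Hdom, Hz).
  destruct (subexp_gauss a b c Hc 2%R ltac:(lra)) as [M HM].
  destruct (binomial_substitution (fun j => (- (1)) ^ j * gauss_coef a b c j) a 1 M 2) as [e [He Hsub]]; [lra| |].
  { intros j. rewrite Cmod_mult, Cmod_pow, Cmod_opp, Cmod_1, pow1, Rmult_1_l. apply HM. }
  revert z Hz.
  apply (analytic_identity (fun z => (Cmod z < 1)%R) (fun z => F (- z / (1 - z)))
    (fun z => Cpower (1 - z) a * Phi a (c - b) c z) (Rmin e (1 / 3))).
  - intros z t Hz Ht. apply disk_star; assumption.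
  - intros z Hz. apply (analytic_at_comp F (fun z => - z / (1 - z))); [apply HF1, Hdom, Hz|].
    apply analytic_at_div; [apply Hn, Hz|apply analytic_at_opp, analytic_at_id|].
    apply analytic_at_minus; [apply analytic_at_const|apply analytic_at_id].
  - intros z Hz. apply analytic_at_mult; [|apply Phi_analytic; assumption].
    apply analytic_at_Cpower; [left; apply disk_1_minus, Hz|].
    apply analytic_at_minus; [apply analytic_at_const|apply analytic_at_id].
  - apply Rmin_pos; lra.
  - intros z Hz. pose proof (Rmin_l e (1 / 3)). pose proof (Rmin_r e (1 / 3)).
    assert (Hz1 : (Cmod z < 1)%R) by lra.
    destruct (Hsub z ltac:(lra)) as [s [H1 H2]].
    assert (Hw : (Cmod (- z / (1 - z)) < 1)%R).
    { rewrite Cmod_div, Cmod_opp by (apply Hn, Hz1).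
      assert (1 - Cmod z <= Cmod (1 - z))%R.
      { assert (1 <= Cmod (1 - z) + Cmod z)%R; [|lra]. rewrite <- Cmod_1 at 1.
        replace (RtoC 1) with ((1 - z) + z) at 1 by ring. apply Cmod_triangle. }
      apply Rmult_lt_reg_r with (Cmod (1 - z)); [lra|]. unfold Rdiv. rewrite Rmult_assoc, Rinv_l by lra. lra. }
    rewrite HF2 by exact Hw.
    assert (Es : s = Phi a b c (- z / (1 - z))).
    { apply (Csums_unique _ _ _ H1). apply Csums_ext with (2 := Phi_Csums a b c _ Hc Hw).
      intros j. replace (- z / (1 - z)) with (- (1) * (z / (1 - z) ^ 1)) by (simpl; field; apply Hn, Hz1).
      rewrite Cpow_mult_l. ring. }
    rewrite <- Es.
    assert (E : Phi a (c - b) c z = Cpower (1 - z) (- a) * s).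
    { apply Csums_CSeries. apply Csums_ext with (2 := H2). intros n. rewrite pfaff_coef by exact Hc. reflexivity. }
    rewrite E, Cpower_opp by (apply Hn, Hz1). field. apply Cpower_neq_0, Hn, Hz1.
Qed.

(** * The Gamma function on the real line *)

Definition gauss_product (z : C) (n : nat) : C := INR (fact n) * Cpower (INR n) z / poch z (S n).

Lemma CGamma_tends (z l : C) : tends (gauss_product z) l -> CGamma z = l.
Proof.
  intros H. unfold CGamma. apply (iota_unique (V := C_CompleteNormedModule)).
  - intros y Hy. apply (tends_unique (gauss_product z)); [apply tends_filterlim, Hy|exact H].
  - apply (proj1 (tends_filterlim _ _) H).
Qed.

Lemma gauss_product_succ (z : C) (n : nat) : nonpole z ->
  gauss_product (z + 1) (S n) = gauss_product z (S n) * (z * (INR (S n) / (INR (S n) + (z + 1)))).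
Proof.
  intros Hz. unfold gauss_product.
  assert (Hn : RtoC (INR (S n)) <> 0) by (rewrite INR_S_C; nz).
  rewrite Cpower_plus, Cpower_1 by exact Hn.
  assert (E : poch (z + 1) (S (S n)) * z = poch z (S (S n)) * (z + 1 + INR (S n))).
  { rewrite (Cmult_comm _ z), <- poch_S_l. rewrite (poch_S z (S (S n))), (INR_S_C (S n)). ring. }
  assert (H0 : z <> 0) by (specialize (Hz O); simpl in Hz; replace (z + 0) with z in Hz by ring; exact Hz).
  assert (H1 : poch z (S (S n)) <> 0) by (apply poch_neq_0, Hz).
  assert (H2 : z + 1 + INR (S n) <> 0).
  { replace (z + 1 + INR (S n)) with (z + INR (S (S n))) by (rewrite (INR_S_C (S n)); ring). apply Hz. }
  assert (H3 : poch (z + 1) (S (S n)) <> 0).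
  { intros E0. rewrite E0 in E. apply (Cmult_neq_0 _ _ H1 H2). rewrite <- E. ring. }
  replace (poch (z + 1) (S (S n))) with (poch z (S (S n)) * (z + 1 + INR (S n)) / z) by (rewrite <- E; field; exact H0).
  field. repeat split; try assumption. replace (INR (S n) + (z + 1)) with (z + 1 + INR (S n)) by ring. exact H2.
Qed.

Lemma nonpole_real (s : R) : (-1 < s)%R -> s <> 0%R -> nonpole s.
Proof.
  intros H H0 n E. rewrite <- RtoC_plus in E. apply RtoC_inj in E.
  destruct n as [|n]; [simpl in E; lra|]. rewrite S_INR in E. pose proof (pos_INR n). lra.
Qed.

(** For [0 < s <= 1] the Gauss products increase, and after multiplication by [(n+s)/n] they
    decrease: the two estimates of [(1+1/n)^s] are the tangent and the chord of a convex function. *)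
Lemma gauss_product_converges_unit (s : R) : (0 < s <= 1)%R -> exists l : C, l <> 0 /\ tends (gauss_product s) l.
Proof.
  intros Hs.
  set (rp := fix rp n := match n with O => 1%R | S m => (rp m * (s + INR m))%R end).
  assert (Hrp0 : forall n, (0 < rp n)%R).
  { induction n as [|n IH]; simpl; [lra|]. pose proof (pos_INR n). apply Rmult_lt_0_compat; lra. }
  assert (Hrp : forall n, poch s n = RtoC (rp n)).
  { induction n as [|n IH]; [reflexivity|]. rewrite poch_S, IH. simpl rp. rewrite RtoC_mult, RtoC_plus. reflexivity. }
  set (g := fun n => (INR (fact (S n)) * exp (s * ln (INR (S n))) / rp (S (S n)))%R).
  assert (Hg : forall n, gauss_product s (S n) = RtoC (g n)).
  { intros n. unfold gauss_product, g. rewrite Hrp, Cpower_pos_real by (apply lt_0_INR; lia).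
    rewrite RtoC_div, RtoC_mult by (specialize (Hrp0 (S (S n))); lra). reflexivity. }
  assert (Hf : forall m, (0 < INR (fact m))%R) by (intros; apply lt_0_INR, lt_O_fact).
  assert (Hg0 : forall n, (0 < g n)%R).
  { intros n. unfold g. apply Rdiv_lt_0_compat; [|apply Hrp0]. apply Rmult_lt_0_compat; [apply Hf|apply exp_pos]. }
  set (x := fun n => INR (S n)).
  assert (Hx : forall n, (1 <= x n)%R) by (intros n; unfold x; rewrite S_INR; pose proof (pos_INR n); lra).
  set (u := fun n => (ln (x n + 1) - ln (x n))%R).
  assert (Hstep : forall n, g (S n) = (g n * (exp (s * u n) * ((x n + 1) / (s + x n + 1))))%R).
  { intros n. unfold g. rewrite (fact_simpl (S n)), mult_INR. 
    change (rp (S (S (S n)))) with (rp (S (S n)) * (s + INR (S (S n))))%R.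
    rewrite (S_INR (S n)). fold (x n).
    replace (s * ln (x n + 1))%R with (s * ln (x n) + s * u n)%R by (unfold u; ring).
    rewrite exp_plus. specialize (Hx n). specialize (Hrp0 (S (S n))). field. split; lra. }
  assert (Hu : forall n, exp (u n) = (1 + / x n)%R).
  { intros n. specialize (Hx n). unfold u. unfold Rminus. rewrite exp_plus, exp_Ropp, !exp_ln by lra. field. lra. }
  assert (Hlow : forall n, (1 + s / (x n + 1) <= exp (s * u n))%R).
  { intros n. pose proof (Hx n). 
    assert (/ (x n + 1) <= u n)%R.
    { pose proof (exp_ineq1_le (- u n)) as E. rewrite exp_Ropp, Hu in E.
      replace (/ (1 + / x n))%R with (1 - / (x n + 1))%R in E by (field; lra). lra. }
    eapply Rle_trans; [|apply exp_ineq1_le]. unfold Rdiv. apply Rplus_le_compat_l, Rmult_le_compat_l; lra. }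
  assert (Hup : forall n, (exp (s * u n) <= 1 + s / x n)%R).
  { intros n. pose proof (Hx n).
    assert (E1 : (exp (u n) = exp (s * u n) * exp ((1 - s) * u n))%R) by (rewrite <- exp_plus; f_equal; ring).
    assert (E2 : (1 = exp (s * u n) * exp (- (s * u n)))%R) by (rewrite <- exp_plus, Rplus_opp_r, exp_0; ring).
    pose proof (exp_ineq1_le ((1 - s) * u n)). pose proof (exp_ineq1_le (- (s * u n))).
    pose proof (exp_pos (s * u n)) as Hp.
    assert (E3 : (s * exp (u n) + (1 - s) * 1 = exp (s * u n) * (s * exp ((1 - s) * u n) + (1 - s) * exp (- (s * u n))))%R)
      by (rewrite E1; replace ((1 - s) * 1)%R with ((1 - s) * (exp (s * u n) * exp (- (s * u n))))%R by (rewrite <- E2; ring); ring).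
    assert (1 <= s * exp ((1 - s) * u n) + (1 - s) * exp (- (s * u n)))%R by nra.
    rewrite Hu in E3. replace (1 + s / x n)%R with (s * (1 + / x n) + (1 - s) * 1)%R by (field; lra).
    rewrite E3. nra. }
  assert (Hincr : forall n, (g n <= g (S n))%R).
  { intros n. rewrite Hstep. pose proof (Hx n). specialize (Hlow n).
    assert (1 <= exp (s * u n) * ((x n + 1) / (s + x n + 1)))%R.
    { apply Rle_trans with ((1 + s / (x n + 1)) * ((x n + 1) / (s + x n + 1)))%R.
      - right. field. lra.
      - apply Rmult_le_compat_r; [apply Rdiv_le_0_compat; lra|exact Hlow]. }
    specialize (Hg0 n). nra. }
  assert (Hdecr : forall n, (g n * ((x n + s) / x n) <= g O * (1 + s))%R).
  { induction n as [|n IH].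
    - right. unfold x. simpl INR. field.
    - eapply Rle_trans; [|exact IH]. rewrite Hstep. pose proof (Hx n).
      assert (Ex : x (S n) = (x n + 1)%R) by (unfold x; rewrite (S_INR (S n)); reflexivity). rewrite Ex.
      replace (g n * (exp (s * u n) * ((x n + 1) / (s + x n + 1))) * ((x n + 1 + s) / (x n + 1)))%R
        with (g n * exp (s * u n))%R by (field; lra).
      apply Rmult_le_compat_l; [left; apply Hg0|]. eapply Rle_trans; [apply Hup|]. right. field. lra. }
  destruct (ex_finite_lim_seq_incr g (g O * (1 + s))) as [l Hl]; [exact Hincr| |].
  { intros n. eapply Rle_trans; [|apply (Hdecr n)]. rewrite <- (Rmult_1_r (g n)) at 1.
    apply Rmult_le_compat_l; [left; apply Hg0|]. pose proof (Hx n).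
    replace ((x n + s) / x n)%R with (1 + s / x n)%R by (field; lra).
    assert (0 <= s / x n)%R by (apply Rdiv_le_0_compat; lra). lra. }
  exists (RtoC l). split.
  - intros E. apply RtoC_inj in E.
    assert (Hle : Rbar_le (g O) l).
    { apply (is_lim_seq_le (fun _ => g O) g); [|apply is_lim_seq_const|exact Hl].
      induction n as [|n IH]; [lra|]. eapply Rle_trans; [exact IH|apply Hincr]. }
    simpl in Hle. specialize (Hg0 O). lra.
  - intros eps He. apply is_lim_seq_spec in Hl. destruct (Hl (mkposreal eps He)) as [N HN]. simpl in HN.
    exists (S N). intros n Hn. destruct n as [|n]; [lia|]. rewrite Hg, <- RtoC_minus, Cmod_R. apply HN. lia.
Qed.

Lemma gauss_product_converges_succ (z l : C) : nonpole z -> tends (gauss_product z) l ->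
  tends (gauss_product (z + 1)) (z * l).
Proof.
  intros Hz H. assert (Hz1 : nonpole (z + 1)) by (apply (nonpole_shift z 1), Hz).
  apply (tends_ext_S (fun n => gauss_product z n * (z * ((INR n + 0) / (INR n + (z + 1)))))).
  - intros n. rewrite gauss_product_succ by exact Hz. do 2 f_equal. f_equal. ring.
  - replace (z * l) with (l * (z * 1)) by ring.
    apply tends_mult; [exact H|]. apply tends_mult; [apply tends_const|]. apply tends_ratio, Hz1.
Qed.

(** The functional equation carries convergence from [(0,1]] upwards, and down to [(-1,0)]. *)
Lemma gauss_product_converges (s : R) : (-1 < s)%R -> s <> 0%R -> exists l : C, l <> 0 /\ tends (gauss_product s) l.
Proof.
  assert (Hpos : forall m s, (0 < s <= INR m + 1)%R -> exists l : C, l <> 0 /\ tends (gauss_product s) l).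
  { induction m as [|m IH]; intros t Ht.
    - apply gauss_product_converges_unit. simpl in Ht. lra.
    - rewrite S_INR in Ht. destruct (Rle_or_lt t 1) as [H1|H1]; [apply gauss_product_converges_unit; lra|].
      destruct (IH (t - 1)%R) as [l [Hl Hl']]; [lra|].
      assert (Hnp : nonpole (t - 1)%R) by (apply nonpole_pos; lra).
      exists ((t - 1)%R * l). split.
      + apply Cmult_neq_0; [|exact Hl]. intros E. apply RtoC_inj in E. lra.
      + pose proof (gauss_product_converges_succ _ _ Hnp Hl') as H.
        rewrite <- RtoC_plus in H. replace (t - 1 + 1)%R with t in H by ring. exact H. }
  intros Hs H0. destruct (Rlt_or_le 0 s) as [H|H].
  - destruct (INR_unbounded s) as [m Hm]. apply (Hpos m). lra.
  - destruct (Hpos 0%nat (s + 1)%R) as [l [Hl Hl']]; [simpl; lra|].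
    assert (Hs0 : RtoC s <> 0) by (intros E; apply RtoC_inj in E; lra).
    assert (Hnp : nonpole s) by (apply nonpole_real; assumption).
    exists (l / s). split; [apply Cmult_neq_0; [exact Hl|apply Cinv_neq_0, Hs0]|].
    apply (tends_ext_S (fun n => gauss_product (s + 1)%R n * (/ s * (1 + (s + 1) * / (INR n + 0))))).
    + intros n. rewrite RtoC_plus, gauss_product_succ by exact Hnp.
      assert (Hn : RtoC (INR (S n)) <> 0) by (rewrite INR_S_C; nz).
      assert (H2 : INR (S n) + (s + 1) <> 0).
      { rewrite <- !RtoC_plus. intros E. apply RtoC_inj in E. pose proof (pos_INR (S n)). lra. }
      replace (INR (S n) + 0) with (RtoC (INR (S n))) by ring.
      field. repeat split; assumption.
    + replace (l / s) with (l * (/ s * (1 + (s + 1) * 0))) by (unfold Cdiv; ring).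
      apply tends_mult; [exact Hl'|]. apply tends_mult; [apply tends_const|].
      apply tends_plus; [apply tends_const|]. apply tends_mult; [apply tends_const|apply tends_inv_INR].
Qed.

Lemma CGamma_neq_0 (s : R) : (-1 < s)%R -> s <> 0%R -> CGamma s <> 0.
Proof.
  intros Hs H0. destruct (gauss_product_converges s Hs H0) as [l [Hl Hl']].
  rewrite (CGamma_tends _ _ Hl'). exact Hl.
Qed.

Lemma CGamma_succ (s : R) : (-1 < s)%R -> s <> 0%R -> CGamma (s + 1) = s * CGamma s.
Proof.
  intros Hs H0. destruct (gauss_product_converges s Hs H0) as [l [_ Hl]].
  rewrite (CGamma_tends _ _ Hl). apply CGamma_tends, gauss_product_converges_succ; [apply nonpole_real; assumption|exact Hl].
Qed.

Lemma CGamma_add (s : R) (m : nat) : (-1 < s)%R -> s <> 0%R -> CGamma (s + INR m) = poch s m * CGamma s.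
Proof.
  intros Hs H0. induction m as [|m IH].
  - simpl. rewrite Cmult_1_l. f_equal. ring.
  - rewrite INR_S_C, poch_S. replace (s + (INR m + 1)) with ((s + INR m)%R + 1) by (rewrite RtoC_plus; ring).
    rewrite CGamma_succ; [rewrite RtoC_plus, IH; ring| |].
    + pose proof (pos_INR m). lra.
    + pose proof (nonpole_real s Hs H0 m) as E. intros E'. apply E. rewrite <- RtoC_plus, E'. reflexivity.
Qed.

(** * Jacobi polynomials *)

Lemma csum_triangle (X : nat -> nat -> C) (k : nat) :
  csum (fun j => csum (fun i => X i (j - i)%nat) (S j)) (S k) =
  csum (fun i => csum (X i) (S (k - i))) (S k).
Proof.
  induction k as [|k IH]; [reflexivity|].
  change (csum ?f (S (S k))) with (csum f (S k) + f (S k)) at 1. cbv beta. rewrite IH.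
  change (csum ?f (S (S k))) with (csum f (S k) + f (S k)). cbv beta.
  rewrite Nat.sub_diag.
  rewrite (csum_ext (fun i => csum (X i) (S (S k - i)))
    (fun i => csum (X i) (S (k - i)) + X i (S k - i)%nat)).
  2:{ intros i Hi. replace (S k - i)%nat with (S (k - i)) by lia. reflexivity. }
  rewrite csum_plus. simpl csum. rewrite Nat.sub_diag. ring.
Qed.

Lemma poch_opp_nat (k j : nat) : (j <= k)%nat ->
  poch (- INR k) j = (-(1)) ^ j * (INR (fact k) / INR (fact (k - j))).
Proof.
  induction j as [|j IH]; intros Hj.
  - rewrite Nat.sub_0_r. simpl. field. apply fact_neq_0_C.
  - rewrite poch_S, IH by lia. replace (k - j)%nat with (S (k - S j)) by lia. rewrite INR_fact_C, Cpow_S.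
    replace (RtoC (INR k)) with (INR (k - S j) + 1 + INR j)
      by (rewrite <- INR_S_C, <- INR_add_C; do 2 f_equal; lia).
    field. split; nz.
Qed.

Lemma poch_opp_nat_0 (k j : nat) : (k < j)%nat -> poch (- INR k) j = 0.
Proof.
  intros H. replace j with (S k + (j - S k))%nat by lia. rewrite poch_add, poch_S.
  replace (- INR k + INR k) with (RtoC 0) by ring. ring.
Qed.

(** [F(-n,n+s;c;w)], a multiple of [P_n^(c-1,s-c)(1-2w)]. *)
Definition jacobi_sum (c s : C) (n : nat) (w : C) : C :=
  csum (fun j => gauss_coef (- INR n) (INR n + s) c j * w ^ j) (S n).

Lemma jacobi_sum_Csums (c s : C) (n : nat) (w : C) :
  Csums (fun j => gauss_coef (- INR n) (INR n + s) c j * w ^ j) (jacobi_sum c s n w).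
Proof.
  apply Csums_finite. intros j Hj. unfold gauss_coef. rewrite poch_opp_nat_0 by lia. unfold Cdiv. ring.
Qed.

Lemma jacobiP_sum (n : nat) (a b z : C) :
  jacobiP n a b z = poch (a + 1) n / INR (fact n) * jacobi_sum (a + 1) (a + b + 1) n ((1 - z) / 2).
Proof.
  unfold jacobiP. f_equal. pose proof (jacobi_sum_Csums (a + 1) (a + b + 1) n ((1 - z) / 2)) as H.
  replace (INR n + (a + b + 1)) with (INR n + a + b + 1) in H by ring.
  apply (iota_unique (V := C_CompleteNormedModule)).
  - intros l Hl. apply Csums_is_pseries in Hl. apply (Csums_unique _ _ _ Hl H).
  - apply Csums_is_pseries, H.
Qed.

Lemma binomial_theorem_1_minus (y : C) (j : nat) :
  csum (fun i => (- y) ^ i / (INR (fact i) * INR (fact (j - i)))) (S j) = (1 - y) ^ j / INR (fact j).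
Proof.
  induction j as [|j IH]; [simpl; field|].
  pose proof (csum_pascal (fun i => (- y) ^ i) j) as E. cbv beta in E.
  rewrite (csum_ext (fun i => ((- y) ^ i + (- y) ^ S i) / _)
    (fun i => (1 - y) * ((- y) ^ i / (INR (fact i) * INR (fact (j - i)))))) in E.
  2:{ intros i _. rewrite Cpow_S. field. split; apply fact_neq_0_C. }
  rewrite csum_scal, IH in E.
  assert (Hn : RtoC (INR (S j)) <> 0) by (rewrite INR_S_C; nz).
  apply (f_equal (fun z => / INR (S j) * z)) in E.
  rewrite Cmult_assoc, Cinv_l, Cmult_1_l in E by exact Hn. rewrite E.
  rewrite INR_fact_C, Cpow_S, INR_S_C. field. split; nz.
Qed.

(** Reflection [x -> -x]: re-expansion at the other endpoint, by Chu-Vandermonde. *)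
Lemma jacobi_sum_reflect (c s y : C) (k : nat) : nonpole c ->
  poch c k / INR (fact k) * jacobi_sum c s k (1 - y) =
  (-(1)) ^ k * csum (fun i => (-(1)) ^ i * poch (s - c + 1 + INR i) (k - i) * poch (INR k + s) i /
     (INR (fact i) * INR (fact (k - i))) * y ^ i) (S k).
Proof.
  intros Hc. unfold jacobi_sum.
  set (X := fun i m => (-(1)) ^ (i + m) * poch c k * poch (INR k + s) (i + m) / (poch c (i + m) * INR (fact (k - (i + m)))) *
     ((- y) ^ i / (INR (fact i) * INR (fact m)))).
  transitivity (csum (fun j => csum (fun i => X i (j - i)%nat) (S j)) (S k)).
  { rewrite <- csum_scal. apply csum_ext. intros j Hj.
    transitivity ((-(1)) ^ j * poch c k * poch (INR k + s) j / (poch c j * INR (fact (k - j))) * ((1 - y) ^ j / INR (fact j))).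
    - unfold gauss_coef. rewrite poch_opp_nat by lia. field. repeat split; nz.
    - rewrite <- binomial_theorem_1_minus, <- csum_scal. apply csum_ext. intros i Hi. unfold X.
      replace (i + (j - i))%nat with j by lia. reflexivity. }
  rewrite csum_triangle, <- csum_scal. apply csum_ext. intros i Hi.
  set (M := (k - i)%nat). assert (HM : k = (i + M)%nat) by (unfold M; lia).
  assert (Hci : nonpole (c + INR i)) by (apply nonpole_shift, Hc).
  transitivity (poch c k * poch (INR k + s) i / (poch c i * INR (fact i)) * y ^ i *
    csum (fun m => (-(1)) ^ m * poch (INR k + s + INR i) m / (poch (c + INR i) m * INR (fact m) * INR (fact (M - m)))) (S M)).
  { rewrite <- csum_scal. apply csum_ext. intros m Hm. unfold X.
    replace (k - (i + m))%nat with (M - m)%nat by lia. rewrite !poch_add, Cpow_add_r.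
    replace ((- y) ^ i) with ((-(1)) ^ i * y ^ i) by (rewrite <- Cpow_mult_l; f_equal; ring).
    assert (E1 : (-(1)) ^ i * (-(1)) ^ i = 1) by (rewrite <- Cpow_mult_l; replace (-(1) * -(1)) with (RtoC 1) by ring; apply Cpow_1_l).
    transitivity (((-(1)) ^ i * (-(1)) ^ i) * ((-(1)) ^ m * poch c k * (poch (INR k + s) i * poch (INR k + s + INR i) m) /
     (poch c i * poch (c + INR i) m * INR (fact (M - m))) * (y ^ i / (INR (fact i) * INR (fact m))))).
    - field. repeat split; nz.
    - rewrite E1. field. repeat split; nz. }
  rewrite chu_vandermonde by exact Hci.
  replace (c + INR i - (INR k + s + INR i)) with (1 - (s - c + 1 + INR i) - INR M)
    by (rewrite HM, INR_add_C; ring).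
  rewrite poch_reflect.
  replace (poch c k) with (poch c i * poch (c + INR i) M) by (rewrite <- poch_add; f_equal; lia).
  replace ((-(1)) ^ k) with ((-(1)) ^ i * (-(1)) ^ M) by (rewrite <- Cpow_add_r; f_equal; lia).
  assert (E1 : (-(1)) ^ i * (-(1)) ^ i = 1) by (rewrite <- Cpow_mult_l; replace (-(1) * -(1)) with (RtoC 1) by ring; apply Cpow_1_l).
  transitivity (((-(1)) ^ i * (-(1)) ^ i) * ((-(1)) ^ M * poch (s - c + 1 + INR i) M * poch (INR k + s) i / (INR (fact i) * INR (fact M)) * y ^ i)).
  - rewrite E1. field. repeat split; nz.
  - field. repeat split; nz.
Qed.

(** Three-term recurrence of the Jacobi polynomials, coefficient by coefficient in [w = (1-x)/2].
    It is an identity of rational functions, with the shifted term coming from multiplication by [w]. *)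
Lemma jacobi_coef_recurrence (c s : C) (n i : nat) : nonpole c ->
  2 * (INR n + 1 + s) * (2 * INR n + s + 1) * (INR n + 1 + c) * gauss_coef (- INR (S (S n))) (INR (S (S n)) + s) c i =
  (2 * INR n + 2 + s) * (((2 * INR n + s + 3) * (2 * INR n + s + 1) + (2 * c - 1 - s) * (s - 1)) *
      gauss_coef (- INR (S n)) (INR (S n) + s) c i
    - 2 * (2 * INR n + s + 3) * (2 * INR n + s + 1) *
      match i with O => 0 | S j => gauss_coef (- INR (S n)) (INR (S n) + s) c j end)
  - 2 * (INR n + 1) * (INR n + 1 + s - c) * (2 * INR n + s + 3) * gauss_coef (- INR n) (INR n + s) c i.
Proof.
  intros Hc. unfold gauss_coef. rewrite (INR_S_C (S n)), (INR_S_C n).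
  set (m := RtoC (INR n)).
  destruct i as [|[|i]].
  - simpl. field.
  - rewrite !poch_S, !poch_0. simpl (fact 1). simpl (fact 0). simpl (INR 1). simpl (INR 0).
    assert (Hc0 : c <> 0) by (intros E; apply (Hc 0%nat); rewrite E; simpl; ring).
    field. exact Hc0.
  - assert (P : forall z, poch z (S (S i)) = z * (z + 1) * poch (z + 1 + 1) i) by (intros z; rewrite !poch_S_l; ring).
    assert (P' : forall z, poch z (S i) = z * poch (z + 1) i) by (intros z; apply poch_S_l).
    (* every symbol in terms of [U] and [V] *)
    set (U := poch (- m) i). set (V := poch (m + 2 + s) i).
    assert (A1 : poch (- (m + 1 + 1)) (S (S i)) = (- (m + 1 + 1)) * (- (m + 1)) * U)
      by (rewrite P; replace (- (m + 1 + 1) + 1 + 1) with (- m) by ring; unfold U; ring).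
    assert (A2 : poch (- (m + 1)) (S (S i)) = (- (m + 1)) * (U * (- m + INR i)))
      by (rewrite poch_S_l; replace (- (m + 1) + 1) with (- m) by ring; reflexivity).
    assert (A3 : poch (- (m + 1)) (S i) = (- (m + 1)) * U)
      by (rewrite poch_S_l; replace (- (m + 1) + 1) with (- m) by ring; reflexivity).
    assert (A4 : poch (- m) (S (S i)) = U * (- m + INR i) * (- m + INR i + 1))
      by (rewrite !poch_S, INR_S_C; unfold U; ring).
    assert (B1 : poch (m + 1 + 1 + s) (S (S i)) = V * (m + 2 + s + INR i) * (m + 2 + s + INR i + 1)).
    { replace (m + 1 + 1 + s) with (m + 2 + s); [rewrite !poch_S, INR_S_C; unfold V; ring|].
      replace (RtoC 2) with (1 + 1) by (rewrite <- RtoC_plus; f_equal). ring. }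
    assert (B2 : poch (m + 1 + s) (S (S i)) = (m + 1 + s) * (V * (m + 2 + s + INR i))).
    { rewrite poch_S_l. replace (m + 1 + s + 1) with (m + 2 + s); [reflexivity|].
      replace (RtoC 2) with (1 + 1) by (rewrite <- RtoC_plus; f_equal). ring. }
    assert (B3 : poch (m + 1 + s) (S i) = (m + 1 + s) * V).
    { rewrite poch_S_l. replace (m + 1 + s + 1) with (m + 2 + s); [reflexivity|].
      replace (RtoC 2) with (1 + 1) by (rewrite <- RtoC_plus; f_equal). ring. }
    assert (B4 : poch (m + s) (S (S i)) = (m + s) * (m + s + 1) * V).
    { rewrite P. replace (m + s + 1 + 1) with (m + 2 + s); [reflexivity|].
      replace (RtoC 2) with (1 + 1) by (rewrite <- RtoC_plus; f_equal). ring. }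
    rewrite A1, A2, A3, A4, B1, B2, B3, B4.
    rewrite ?INR_fact_C, ?(poch_S c), ?INR_S_C. 
    field. repeat split; nz.
Qed.

Lemma jacobi_sum_recurrence (c s w : C) (n : nat) : nonpole c ->
  2 * (INR n + 1 + s) * (2 * INR n + s + 1) * (INR n + 1 + c) * jacobi_sum c s (S (S n)) w =
  (2 * INR n + 2 + s) * ((2 * INR n + s + 3) * (2 * INR n + s + 1) * (1 - 2 * w) + (2 * c - 1 - s) * (s - 1)) *
      jacobi_sum c s (S n) w
  - 2 * (INR n + 1) * (INR n + 1 + s - c) * (2 * INR n + s + 3) * jacobi_sum c s n w.
Proof.
  intros Hc.
  set (f := fun n i => gauss_coef (- INR n) (INR n + s) c i).
  assert (H : forall n, Csums (fun i => f n i * w ^ i) (jacobi_sum c s n w)) by (intros; apply jacobi_sum_Csums).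
  assert (Hsh : Csums (fun i => match i with O => 0 | S j => f (S n) j end * w ^ i) (w * jacobi_sum c s (S n) w)).
  { replace (w * jacobi_sum c s (S n) w) with (0 * w ^ 0 + w * jacobi_sum c s (S n) w) by ring.
    apply (Csums_unshift (fun i => match i with O => 0 | S j => f (S n) j end * w ^ i)).
    apply Csums_ext with (fun i => w * (f (S n) i * w ^ i)); [intros i; rewrite Cpow_S; ring|].
    apply Csums_scal, H. }
  pose proof (Csums_scal (2 * (INR n + 1 + s) * (2 * INR n + s + 1) * (INR n + 1 + c)) _ _ (H (S (S n)))) as HL.
  pose proof (Csums_scal (2 * (INR n + 1) * (INR n + 1 + s - c) * (2 * INR n + s + 3)) _ _ (H n)) as HR2.
  pose proof (Csums_scal ((2 * INR n + 2 + s) * ((2 * INR n + s + 3) * (2 * INR n + s + 1) + (2 * c - 1 - s) * (s - 1))) _ _ (H (S n))) as HR1.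
  pose proof (Csums_scal ((2 * INR n + 2 + s) * (2 * (2 * INR n + s + 3) * (2 * INR n + s + 1))) _ _ Hsh) as HR3.
  pose proof (Csums_minus _ _ _ _ (Csums_minus _ _ _ _ HR1 HR3) HR2) as HR.
  match type of HR with Csums _ ?v => transitivity v end; [|ring].
  apply (Csums_unique _ _ _ HL). apply Csums_ext with (2 := HR). intros i.
  pose proof (f_equal (fun z => z * w ^ i) (jacobi_coef_recurrence c s n i Hc)) as E. cbv beta in E.
  unfold f. etransitivity; [|etransitivity; [symmetry; exact E|ring]].
  destruct i as [|i]; ring.
Qed.

(** For [-1 <= x <= 1] the limiting characteristic roots are [x +- i sqrt(1-x^2)], of modulus 1. *)
Lemma subexp_jacobi_sum (c s x : R) : (-1 < s)%R -> nonpole c -> (-1 <= x <= 1)%R ->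
  subexp (fun n => jacobi_sum c s n ((1 - x) / 2)).
Proof.
  intros Hs Hc Hx.
  set (w := (1 - x) / 2). set (K := (2 * c - 1 - s) * (s - 1)).
  assert (H2 : RtoC 2 <> 0) by (intros E; apply RtoC_inj in E; lra).
  set (l := (x, sqrt (1 - x²))%R : C). set (l' := (x, (- sqrt (1 - x²))%R) : C).
  assert (Hsq : (sqrt (1 - x²) * sqrt (1 - x²) = 1 - x²)%R) by (apply sqrt_sqrt; unfold Rsqr; nra).
  assert (Hnp : forall t : R, (-1 < t)%R -> nonpole (1 + t)) by (intros t Ht; rewrite <- RtoC_plus; apply nonpole_pos; lra).
  assert (Hh : nonpole ((1 + s) / 2)).
  { rewrite <- RtoC_plus, <- RtoC_div by lra. apply nonpole_pos. lra. }
  assert (Hc1 : nonpole (1 + c)).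
  { intros n. replace (1 + c + INR n) with (c + INR (S n)) by (rewrite INR_S_C; ring). apply Hc. }
  apply (subexp_recurrence l l' _
    (fun n => (1 - 2 * w) * 2 * ((INR n + (1 + s / 2)) / (INR n + (1 + s))) * ((INR n + (3 + s) / 2) / (INR n + (1 + c)))
      + K * (1 / 2) * ((INR n + (1 + s / 2)) / (INR n + (1 + s))) * / (INR n + (1 + s) / 2) * / (INR n + (1 + c)))
    (fun n => - (1) * ((INR n + 1) / (INR n + (1 + s))) * ((INR n + (1 + s - c)) / (INR n + (1 + c)))
       * ((INR n + (3 + s) / 2) / (INR n + (1 + s) / 2)))).
  - right. unfold Cmod, l; simpl. rewrite Rmult_1_r, Rmult_1_r, Hsq. unfold Rsqr.
    replace (x * x + (1 - x * x))%R with 1%R by ring. apply sqrt_1.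
  - right. unfold Cmod, l'; simpl. rewrite Rmult_1_r, Rmult_1_r, Rmult_opp_opp, Hsq. unfold Rsqr.
    replace (x * x + (1 - x * x))%R with 1%R by ring. apply sqrt_1.
  - replace (l + l') with ((1 - 2 * w) * 2 * 1 * 1 + K * (1 / 2) * 1 * 0 * 0).
    2:{ replace (l + l') with (2 * RtoC x) by (apply injective_projections; simpl; ring). unfold w. field; exact H2. }
    apply tends_plus.
    + apply tends_mult; [apply tends_mult; [apply tends_const|apply tends_ratio, Hnp, Hs]|apply tends_ratio, Hc1].
    + apply tends_mult; [apply tends_mult; [apply tends_mult; [apply tends_const|apply tends_ratio, Hnp, Hs]|]|]; apply tends_inv_INR.
  - replace (- (l * l')) with (- (1) * 1 * 1 * 1).
    2:{ replace (l * l') with (RtoC 1); [ring|].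
      apply injective_projections; simpl; unfold Rsqr in *; [|ring].
      set (S0 := sqrt (1 - x * x)) in *. lra. }
    apply tends_mult; [apply tends_mult; [apply tends_mult; [apply tends_const|apply tends_ratio, Hnp, Hs]|apply tends_ratio, Hc1]|].
    apply tends_ratio, Hh.
  - intros n. pose proof (jacobi_sum_recurrence c s w n Hc) as E.
    assert (D1 : INR n + 1 + s <> 0).
    { replace (INR n + 1 + s) with (1 + s + INR n) by ring. apply Hnp, Hs. }
    assert (D2 : 2 * INR n + s + 1 <> 0).
    { intros E0. apply (Hh n). replace ((1 + s) / 2 + INR n) with ((2 * INR n + s + 1) / 2) by (field; exact H2).
      rewrite E0. unfold Cdiv. ring. }
    assert (D3 : INR n + 1 + c <> 0).
    { replace (INR n + 1 + c) with (1 + c + INR n) by ring. apply Hc1. }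
    match type of E with ?d * ?v = _ =>
      replace v with (d * v / d) by (field; repeat split; assumption) end.
    rewrite E. unfold K. field. 
    repeat split; try assumption.
    + replace (INR n * 2 + (1 + s)) with (2 * INR n + s + 1) by ring. exact D2.
    + replace (INR n + (1 + c)) with (INR n + 1 + c) by ring. exact D3.
    + replace (INR n + (1 + s)) with (INR n + 1 + s) by ring. exact D1.
Qed.

(** * A terminating very-well-poised sum *)

Definition conn_term (S0 A : C) (N i : nat) : C :=
  (-(1)) ^ i * (S0 + 2 * INR i) / poch (S0 + INR i) (S N) * poch (A + INR N) i * poch (A - S0) (N - i) /
  (INR (fact i) * INR (fact (N - i))).

(** Antidifference in [i] of the left-hand side of [conn_cert_step], found by creative telescoping. *)
Definition conn_cert (S0 A : C) (N i : nat) : C :=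
  match i with
  | O => 0
  | S p => - (2 * INR N + 1 + A) * (-(1)) ^ p / poch (S0 + INR (S p)) (S N) * poch (A + INR N + 1) p *
     poch (A - S0) (N - p) / (INR (fact p) * INR (fact (N - p)))
  end.

Lemma conn_cert_step (S0 A : C) (i m : nat) : nonpole S0 -> let N := (i + m)%nat in
  - (INR N + 1) * conn_term S0 A (S N) i - conn_term S0 A N i = conn_cert S0 A N (S i) - conn_cert S0 A N i.
Proof.
  intros HS N. unfold conn_term, conn_cert.
  replace (S N - i)%nat with (S m) by lia. replace (N - i)%nat with m by lia.
  assert (HN : RtoC (INR N) = INR i + INR m) by apply INR_add_C.
  set (X := poch (S0 + INR i + 1) N).
  assert (HX : X <> 0).
  { apply poch_neq_0. replace (S0 + INR i + 1) with (S0 + INR (S i)) by (rewrite INR_S_C; ring). apply nonpole_shift, HS. }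
  assert (H0 : S0 + INR i <> 0) by apply HS.
  assert (H1 : S0 + INR i + 1 + INR N <> 0).
  { replace (S0 + INR i + 1 + INR N) with (S0 + INR (i + N + 1)) by (rewrite !INR_add_C; simpl; ring). apply HS. }
  assert (E1 : poch (S0 + INR i) (S (S N)) = (S0 + INR i) * (X * (S0 + INR i + 1 + INR N)))
    by (rewrite poch_S_l; reflexivity).
  assert (E2 : poch (S0 + INR i) (S N) = (S0 + INR i) * X) by apply poch_S_l.
  assert (E3 : poch (S0 + INR (S i)) (S N) = X * (S0 + INR i + 1 + INR N)).
  { replace (S0 + INR (S i)) with (S0 + INR i + 1) by (rewrite INR_S_C; ring). reflexivity. }
  rewrite E1, E2, E3. rewrite INR_S_C.
  destruct i as [|p].
  - rewrite ?INR_fact_C, (poch_S (A - S0) m), ?poch_0. simpl (INR 0). simpl (fact 0). simpl (_ ^ 0).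
    simpl (INR 0) in *. rewrite HN in *. simpl (INR 0) in *. field. repeat split; try nz.
    + replace (S0 + 1 + INR m) with (S0 + INR (S m)) by (rewrite INR_S_C; ring). apply HS.
    + replace S0 with (S0 + INR 0) by (simpl; ring). apply HS.
  - replace (N - p)%nat with (S m) by lia.
    rewrite (poch_S_l (A + INR N) p), Cplus_assoc. rewrite (poch_S (A + INR N + 1) p).
    rewrite ?INR_fact_C, ?Cpow_S, (poch_S (A - S0) m), E2, ?INR_S_C. rewrite ?INR_S_C in H0, H1, HN.
    rewrite HN in *. set (Y := poch (A + _ + 1) p). set (Z := poch (A - S0) m).
    field. repeat split; nz.
Qed.

(** Induction on [N]: summing [conn_cert_step] shows that [(N+1)] times the sum for [N+1] is the
    opposite of the sum for [N].  After normalization this evaluates the connection coefficients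
    between Jacobi polynomials that differ in one parameter. *)
Lemma connection_sum (S0 A : C) (N : nat) : nonpole S0 ->
  csum (conn_term S0 A N) (S N) = (-(1)) ^ N / INR (fact N).
Proof.
  intros HS. induction N as [|N IH].
  - unfold conn_term. simpl. field. specialize (HS 0%nat). simpl in HS.
    replace (S0 + 0) with S0 in HS by ring. exact HS.
  - assert (G : forall k, (k <= S N)%nat ->
      csum (fun i => - (INR N + 1) * conn_term S0 A (S N) i - conn_term S0 A N i) k = conn_cert S0 A N k).
    { induction k as [|k IHk]; intros Hk; [reflexivity|].
      simpl csum. rewrite IHk by lia. pose proof (conn_cert_step S0 A k (N - k) HS) as E. cbv zeta in E.
      replace (k + (N - k))%nat with N in E by lia. rewrite E. ring. }
    specialize (G (S N) (le_n _)). rewrite csum_minus, csum_scal, IH in G.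
    assert (HE : - (INR N + 1) * conn_term S0 A (S N) (S N) + conn_cert S0 A N (S N) = 0).
    { unfold conn_term, conn_cert. rewrite !Nat.sub_diag, !poch_0.
      assert (H1 : poch (S0 + INR (S N)) (S N) <> 0) by (apply poch_neq_0, nonpole_shift, HS).
      assert (H2 : S0 + INR (S N) + INR (S N) <> 0).
      { replace (S0 + INR (S N) + INR (S N)) with (S0 + INR (S N + S N)) by (rewrite INR_add_C; ring). apply HS. }
      rewrite (poch_S (S0 + INR (S N)) (S N)), (poch_S (A + INR (S N)) N).
      replace (A + INR (S N)) with (A + INR N + 1) by (rewrite INR_S_C; ring).
      set (X := poch (S0 + INR (S N)) (S N)) in *. set (Y := poch (A + INR N + 1) N).
      rewrite INR_fact_C, Cpow_S, ?INR_S_C. rewrite INR_S_C in H2. simpl (fact 0). simpl (INR 1).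
      field. repeat split; nz. }
    change (csum (conn_term S0 A (S N)) (S (S N))) with (csum (conn_term S0 A (S N)) (S N) + conn_term S0 A (S N) (S N)).
    assert (Hn : INR N + 1 <> 0) by nz.
    set (u := csum (conn_term S0 A (S N)) (S N)) in *. set (v := conn_term S0 A (S N) (S N)) in *.
    assert (E : - (INR N + 1) * (u + v) = (-(1)) ^ N / INR (fact N)).
    { transitivity (- (INR N + 1) * u - (-(1)) ^ N / INR (fact N) + - (INR N + 1) * v + (-(1)) ^ N / INR (fact N)); [ring|].
      rewrite G. rewrite (Cplus_comm (conn_cert _ _ _ _)), HE. ring. }
    replace (u + v) with (- (INR N + 1) * (u + v) / (- (INR N + 1))) by (field; exact Hn).
    rewrite E, INR_fact_C, Cpow_S. field. repeat split; nz.
Qed.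

(** * The double series of the right-hand side *)

(** [(a)_n/(c)_n P_n^(a-c,c-1)(2y-1)], expanded at [y = 0]. *)
Definition gen_coef (a c y : C) (n : nat) : C :=
  csum (fun j => (-(1)) ^ (n - j) * poch a (n + j) / (poch c j * INR (fact j) * INR (fact (n - j))) * y ^ j) (S n).

Definition conn_coef (a c s : C) (k : nat) : C := poch s k * poch a (2 * k) / (poch s (2 * k) * poch c k).

(** [P_k^(s-c,c-1)(2 y - 1)] *)
Definition jacobi_y (c s : C) (k : nat) (y : C) : C :=
  poch (s - c + 1) k / INR (fact k) * jacobi_sum (s - c + 1) s k (1 - y).

Lemma m1_pow_sqr (n : nat) : (-(1)) ^ n * (-(1)) ^ n = 1.
Proof. rewrite <- Cpow_mult_l. replace (-(1) * -(1)) with (RtoC 1) by ring. apply Cpow_1_l. Qed.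

Lemma connection_term (a c s : C) (j i m : nat) : nonpole c -> nonpole s ->
  let k := (j + i)%nat in let n := (k + m)%nat in
  conn_coef a c s k * ((-(1)) ^ k * ((-(1)) ^ j * poch (c + INR j) i * poch (INR k + s) j / (INR (fact j) * INR (fact i))))
   * gauss_coef (a - s) (a + 2 * INR k) (s + 2 * INR k + 1) m =
  poch a (n + j) / (poch c j * INR (fact j)) * conn_term (s + 2 * INR j) (a + 2 * INR j) (i + m) i.
Proof.
  intros Hc Hs k n. unfold conn_coef, gauss_coef, conn_term.
  replace (i + m - i)%nat with m by lia.
  assert (Hk : RtoC (INR k) = INR j + INR i) by apply INR_add_C.
  assert (H2k : RtoC (INR (2 * k)) = 2 * INR k) by (rewrite mult_INR, RtoC_mult; reflexivity).
  assert (E1 : poch c k = poch c j * poch (c + INR j) i) by apply poch_add.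
  assert (E2 : poch s k * poch (INR k + s) j = poch s (k + j)).
  { rewrite poch_add. do 2 f_equal. ring. }
  assert (E3 : poch a (2 * k) * poch (a + 2 * INR k) m = poch a (n + j) * poch (a + 2 * INR j + INR (i + m)) i).
  { rewrite <- H2k, <- poch_add. replace (2 * k + m)%nat with (n + j + i)%nat by (unfold n, k; lia).
    rewrite poch_add. do 2 f_equal. unfold n. rewrite !INR_add_C, Hk. ring. }
  assert (E4 : poch s (2 * k) * (s + 2 * INR k) * poch (s + 2 * INR k + 1) m =
    poch s (k + j) * poch (s + 2 * INR j + INR i) (S (i + m))).
  { transitivity (poch s (2 * k + 1 + m)).
    - rewrite (poch_add s (2 * k + 1) m), Nat.add_1_r, (INR_S_C (2 * k)), (poch_S s (2 * k)), H2k.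
      do 2 f_equal. ring.
    - replace (2 * k + 1 + m)%nat with (k + j + S (i + m))%nat by (unfold k; lia).
      rewrite poch_add. do 2 f_equal. rewrite INR_add_C, Hk. ring. }
  assert (N1 : poch s (2 * k) <> 0) by (apply poch_neq_0, Hs).
  assert (N2 : s + 2 * INR k <> 0) by (rewrite <- H2k; apply Hs).
  assert (N3 : poch (s + 2 * INR k + 1) m <> 0).
  { apply poch_neq_0. rewrite <- H2k. apply (nonpole_shift _ 1). apply nonpole_shift, Hs. }
  assert (N4 : poch s (k + j) <> 0) by (apply poch_neq_0, Hs).
  assert (N5 : poch (s + 2 * INR j + INR i) (S (i + m)) <> 0).
  { intros E0. rewrite E0, Cmult_0_r in E4. revert E4. repeat apply Cmult_neq_0; assumption. }
  assert (N6 : poch c j <> 0) by (apply poch_neq_0, Hc).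
  assert (N7 : poch (c + INR j) i <> 0) by (apply poch_neq_0, nonpole_shift, Hc).
  assert (ES : (-(1)) ^ k * (-(1)) ^ j = (-(1)) ^ i).
  { unfold k. rewrite Cpow_add_r. transitivity (((-(1)) ^ j * (-(1)) ^ j) * (-(1)) ^ i); [ring|]. rewrite m1_pow_sqr. ring. }
  rewrite E1. rewrite <- ES.
  replace (s + 2 * INR j + 2 * INR i) with (s + 2 * INR k) by (rewrite Hk; ring).
  replace (a + 2 * INR j - (s + 2 * INR j)) with (a - s) by ring.
  transitivity ((poch s k * poch (INR k + s) j) * (poch a (2 * k) * poch (a + 2 * INR k) m) * ((-(1)) ^ k * (-(1)) ^ j) *
    (s + 2 * INR k) * poch (a - s) m / ((poch s (2 * k) * (s + 2 * INR k) * poch (s + 2 * INR k + 1) m) * poch c j * INR (fact j) * INR (fact i) * INR (fact m))).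
  - field. repeat split; try assumption; apply fact_neq_0_C.
  - rewrite E2, E3, E4. field. repeat split; try assumption; apply fact_neq_0_C.
Qed.

(** Expanding each Jacobi polynomial at [y = 0] and exchanging the two finite sums leaves, for every
    power of [y], an instance of [connection_sum]. *)
Lemma connection_coef (a c s y : C) (n : nat) : nonpole c -> nonpole s -> nonpole (s - c + 1) ->
  csum (fun k => conn_coef a c s k * jacobi_y c s k y * gauss_coef (a - s) (a + 2 * INR k) (s + 2 * INR k + 1) (n - k)) (S n) =
  gen_coef a c y n.
Proof.
  intros Hc Hs Hsc.
  set (X := fun j i => conn_coef a c s (j + i) * ((-(1)) ^ (j + i) * ((-(1)) ^ j * poch (c + INR j) i * poch (INR (j + i) + s) j / (INR (fact j) * INR (fact i))))
   * gauss_coef (a - s) (a + 2 * INR (j + i)) (s + 2 * INR (j + i) + 1) (n - (j + i)) * y ^ j).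
  transitivity (csum (fun k => csum (fun j => X j (k - j)%nat) (S k)) (S n)).
  - apply csum_ext. intros k Hk. unfold jacobi_y. rewrite jacobi_sum_reflect by exact Hsc.
    rewrite (Cmult_comm (conn_coef a c s k)), <- !Cmult_assoc, (Cmult_comm _ (_ * gauss_coef _ _ _ _)).
    rewrite Cmult_assoc, <- csum_scal. apply csum_ext. intros j Hj. unfold X.
    replace (j + (k - j))%nat with k by lia. replace (s - (s - c + 1) + 1 + INR j) with (c + INR j) by ring.
    unfold Cdiv. ring.
  - rewrite csum_triangle. unfold gen_coef. apply csum_ext. intros j Hj.
    set (N := (n - j)%nat).
    transitivity (poch a (n + j) / (poch c j * INR (fact j)) * y ^ j * csum (conn_term (s + 2 * INR j) (a + 2 * INR j) N) (S N)).
    + rewrite <- csum_scal. apply csum_ext. intros i Hi. unfold X.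
      pose proof (connection_term a c s j i (N - i) Hc Hs) as E. cbv zeta in E.
      replace (n - (j + i))%nat with (N - i)%nat by (unfold N; lia).
      replace (j + i + (N - i) + j)%nat with (n + j)%nat in E by (unfold N; lia).
      replace (i + (N - i))%nat with N in E by lia. rewrite E. ring.
    + assert (H2 : nonpole (s + 2 * INR j)).
      { replace (2 * INR j) with (RtoC (INR (2 * j))) by (rewrite mult_INR, RtoC_mult; reflexivity). apply nonpole_shift, Hs. }
      rewrite connection_sum by exact H2. fold N. field. repeat split; nz.
Qed.

Lemma subexp_const (c : C) : subexp (fun _ => c).
Proof.
  intros q Hq. exists (Cmod c). intros n. rewrite <- (Rmult_1_r (Cmod c)) at 1.
  apply Rmult_le_compat_l; [apply Cmod_ge_0|]. apply pow_R1_Rle. lra.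
Qed.

Lemma subexp_ext (u v : nat -> C) : (forall n, u n = v n) -> subexp u -> subexp v.
Proof. intros E H q Hq. destruct (H q Hq) as [M HM]. exists M. intros n. rewrite <- E. apply HM. Qed.

Lemma subexp_linear (b : C) : nonpole b -> subexp (fun k => b + INR k).
Proof.
  intros Hb. apply subexp_ext with (fun k => b * (poch (b + 1) k / poch b k)).
  - intros k. pose proof (poch_S_l b k) as E. rewrite poch_S in E.
    transitivity (b * poch (b + 1) k / poch b k); [unfold Cdiv; ring|]. rewrite <- E. field. apply poch_neq_0, Hb.
  - apply subexp_mult; [apply subexp_const|apply subexp_poch_ratio, Hb].
Qed.

(** The summands factor into sequences that are subexponential in [k], in [m] and in [2 k + m], so
    the double series converges absolutely for [|z| < 1] and may be summed by powers of [z], where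
    [connection_coef] evaluates the coefficients. *)
Theorem jacobi_double_series (a : C) (c s x : R) (z : C) : (0 < c)%R -> (-1 < s)%R -> s <> 0%R -> (0 < s - c + 1)%R ->
  (-1 <= x <= 1)%R -> (Cmod z < 1)%R -> exists T,
  Csums (fun k => conn_coef a c s k * jacobi_y c s k ((1 + x) / 2) * z ^ k *
     Phi (a - s) (a + 2 * INR k) (s + 2 * INR k + 1) z) T /\
  Csums (fun n => gen_coef a c ((1 + x) / 2) n * z ^ n) T.
Proof.
  intros Hc0 Hs0 Hs1 Hsc0 Hx Hz.
  assert (Hc : nonpole c) by (apply nonpole_pos; lra).
  assert (Hs : nonpole s) by (apply nonpole_real; assumption).
  assert (Hsc : nonpole (s - c + 1)) by (rewrite <- RtoC_minus, <- RtoC_plus; apply nonpole_pos; lra).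
  assert (Hsh : nonpole (s / 2)) by (rewrite <- RtoC_div by lra; apply nonpole_real; lra).
  assert (Hs1c : RtoC s <> 0) by (intros E; apply RtoC_inj in E; lra).
  assert (H2c : RtoC 2 <> 0) by (intros E; apply RtoC_inj in E; lra).
  set (y := (1 + x) / 2).
  set (U := fun k => poch s k / poch c k * (2 * (s / 2 + INR k)) * jacobi_y c s k y).
  set (V := fun m => poch (a - s) m / INR (fact m)).
  set (W := fun N => poch a N / poch (s + 1) N).
  assert (HU : subexp U).
  { apply subexp_mult; [apply subexp_mult|].
    - apply subexp_poch_ratio, Hc.
    - apply subexp_mult; [apply subexp_const|apply subexp_linear, Hsh].
    - unfold jacobi_y. apply subexp_mult; [apply subexp_binom|].
      apply subexp_ext with (fun n => jacobi_sum (s - c + 1)%R s n ((1 - x) / 2)).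
      + intros n. rewrite RtoC_plus, RtoC_minus. f_equal. unfold y. field; exact H2c.
      + apply subexp_jacobi_sum; [exact Hs0|apply nonpole_pos; lra|exact Hx]. }
  assert (HV : subexp V) by apply subexp_binom.
  assert (HW : subexp W) by (apply subexp_poch_ratio, (nonpole_shift s 1), Hs).
  set (Y := fun k m => conn_coef a c s k * jacobi_y c s k y * z ^ k *
     (gauss_coef (a - s) (a + 2 * INR k) (s + 2 * INR k + 1) m * z ^ m)).
  assert (H2k : forall k, RtoC (INR (2 * k)) = 2 * INR k) by (intros; rewrite mult_INR, RtoC_mult; reflexivity).
  assert (HY : forall k m, Y k m = / s * (U k * V m * W (2 * k + m)%nat) * (z ^ k * z ^ m)).
  { intros k m. unfold Y, U, V, W, conn_coef, gauss_coef.
    assert (E1 : poch a (2 * k) * poch (a + 2 * INR k) m = poch a (2 * k + m)) by (rewrite poch_add, H2k; reflexivity).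
    assert (E2 : poch s (2 * k) * (s + 2 * INR k) * poch (s + 2 * INR k + 1) m = s * poch (s + 1) (2 * k + m)).
    { rewrite <- poch_S_l. replace (S (2 * k + m)) with (S (2 * k) + m)%nat by lia.
      rewrite poch_add, poch_S, INR_S_C, H2k. do 2 f_equal. ring. }
    assert (N0 : poch s (2 * k) <> 0) by (apply poch_neq_0, Hs).
    assert (N1 : s + 2 * INR k <> 0) by (rewrite <- H2k; apply Hs).
    assert (N2 : poch (s + 2 * INR k + 1) m <> 0).
    { apply poch_neq_0. rewrite <- H2k. apply (nonpole_shift _ 1), nonpole_shift, Hs. }
    assert (N3 : poch (s + 1) (2 * k + m) <> 0) by (apply poch_neq_0, (nonpole_shift _ 1), Hs).
    assert (N4 : poch c k <> 0) by (apply poch_neq_0, Hc).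
    rewrite <- E1.
    replace (2 * (s / 2 + INR k)) with (s + 2 * INR k) by (field; exact H2c).
    transitivity (poch s k * (poch a (2 * k) * poch (a + 2 * INR k) m) * poch (a - s) m * jacobi_y c s k y * (s + 2 * INR k) /
      ((poch s (2 * k) * (s + 2 * INR k) * poch (s + 2 * INR k + 1) m) * poch c k * INR (fact m)) * (z ^ k * z ^ m)).
    - field. repeat split; try assumption; apply fact_neq_0_C.
    - rewrite E2. field. repeat split; try assumption; apply fact_neq_0_C. }
  set (r := Cmod z) in *. pose proof (Cmod_ge_0 z) as Hr0. fold r in Hr0.
  (* [q ^ 3 * r < 1]: the three factors grow together at most like [q ^ (3 k + 3 m)] *)
  set (t := ((1 - r) / 8)%R). set (q := (1 + t)%R).
  assert (Ht : (0 < t <= 1)%R) by (unfold t; lra).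
  assert (Hq3 : (0 <= q ^ 3 * r < 1)%R).
  { assert (q ^ 3 <= 1 + 7 * t)%R by (unfold q; nra). assert (0 < q ^ 3)%R by (apply pow_lt; unfold q; lra).
    split; [nra|]. apply Rle_lt_trans with ((1 + 7 * t) * r)%R; [apply Rmult_le_compat_r; lra|]. unfold t. nra. }
  assert (Hq1 : (1 < q)%R) by (unfold q; lra).
  destruct (HU q Hq1) as [MU HMU]. destruct (HV q Hq1) as [MV HMV]. destruct (HW q Hq1) as [MW HMW].
  assert (HMp : (0 <= MU)%R /\ (0 <= MV)%R /\ (0 <= MW)%R).
  { specialize (HMU O). specialize (HMV O). specialize (HMW O). simpl in HMU, HMV, HMW.
    pose proof (Cmod_ge_0 (U O)). pose proof (Cmod_ge_0 (V O)). pose proof (Cmod_ge_0 (W O)). lra. }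
  set (th := (q ^ 3 * r)%R) in *. set (M0 := (Cmod (/ s) * (MU * MV * MW))%R).
  assert (HM0 : (0 <= M0)%R).
  { unfold M0. pose proof (Cmod_ge_0 (/ s)). apply Rmult_le_pos; [lra|]. apply Rmult_le_pos; [apply Rmult_le_pos; lra|lra]. }
  assert (HYb : forall k m, (Cmod (Y k m) <= M0 * th ^ k * th ^ m)%R).
  { intros k m. rewrite HY, !Cmod_mult, !Cmod_pow. fold r.
    apply Rle_trans with (Cmod (/ s) * (MU * q ^ k * (MV * q ^ m) * (MW * q ^ (2 * k + m))) * (r ^ k * r ^ m))%R.
    - apply Rmult_le_compat_r; [apply Rmult_le_pos; apply pow_le; lra|].
      apply Rmult_le_compat_l; [apply Cmod_ge_0|].
      apply Rmult_le_compat; [apply Rmult_le_pos; apply Cmod_ge_0|apply Cmod_ge_0| |apply HMW].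
      apply Rmult_le_compat; try apply Cmod_ge_0; [apply HMU|apply HMV].
    - unfold M0, th. rewrite !Rpow_mult_distr, <- !pow_mult.
      assert (Eq : (q ^ k * q ^ m * q ^ (2 * k + m) <= q ^ (3 * k) * q ^ (3 * m))%R).
      { rewrite <- !pow_add. apply Rle_pow; [lra|lia]. }
      assert (Hrk : (0 <= r ^ k * r ^ m)%R) by (apply Rmult_le_pos; apply pow_le; lra).
      replace (Cmod (/ s) * (MU * q ^ k * (MV * q ^ m) * (MW * q ^ (2 * k + m))) * (r ^ k * r ^ m))%R
        with (M0 * (r ^ k * r ^ m) * (q ^ k * q ^ m * q ^ (2 * k + m)))%R by (unfold M0; ring).
      replace (Cmod (/ s) * (MU * MV * MW) * (q ^ (3 * k) * r ^ k) * (q ^ (3 * m) * r ^ m))%R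
        with (M0 * (r ^ k * r ^ m) * (q ^ (3 * k) * q ^ (3 * m)))%R by (unfold M0; ring).
      apply Rmult_le_compat_l; [apply Rmult_le_pos; assumption|exact Eq]. }
  assert (Hrect : rect_bounded Y (M0 / (1 - th) * (1 / (1 - th)))).
  { intros K M.
    assert (Ha : abs_bounded (fun k => RtoC (M0 * th ^ k)) (M0 / (1 - th))).
    { apply abs_bounded_geom; [exact Hq3|]. intros n. rewrite Cmod_R, Rabs_pos_eq; [lra|]. apply Rmult_le_pos; [lra|apply pow_le; lra]. }
    assert (Hb : abs_bounded (fun m => RtoC (th ^ m)) (1 / (1 - th))).
    { apply abs_bounded_geom; [exact Hq3|]. intros n. rewrite Cmod_R, Rabs_pos_eq; [lra|]. apply pow_le; lra. }
    eapply Rle_trans; [|apply (rect_bounded_prod _ _ _ _ Ha Hb K M)].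
    apply rsum_le. intros k _. apply rsum_le. intros m _. rewrite <- RtoC_mult, Cmod_R, Rabs_pos_eq; [apply HYb|].
    apply Rmult_le_pos; [apply Rmult_le_pos; [lra|]|]; apply pow_le; lra. }
  destruct (Csums_antidiagonal Y _ (fun k => conn_coef a c s k * jacobi_y c s k y * z ^ k *
     Phi (a - s) (a + 2 * INR k) (s + 2 * INR k + 1) z) Hrect) as [T [H1 H2]].
  { intros k. apply Csums_scal, Phi_Csums; [|exact Hz].
    rewrite <- H2k. apply (nonpole_shift _ 1), nonpole_shift, Hs. }
  exists T. split; [exact H1|]. apply Csums_ext with (2 := H2). intros n.
  rewrite <- (connection_coef a c s y n Hc Hs Hsc), Cmult_comm, <- csum_scal. apply csum_ext. intros k Hk. unfold Y.
  replace (z ^ n) with (z ^ k * z ^ (n - k)) by (rewrite <- Cpow_add_r; f_equal; lia). ring.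
Qed.

(** Chu-Vandermonde once more: the coefficient identity behind the quadratic transformation
    [F(a/2,(a+1)/2;c;4z/(1+z)^2) = (1+z)^a F(a,a-c+1;c;z)]. *)
Lemma quadratic_coef (a c : C) (n : nat) : nonpole c ->
  binom_coef (fun j => (-(1)) ^ j * poch a (2 * j) / (poch c j * INR (fact j))) a 2 n * (-(1)) ^ n = gauss_coef (a - c + 1) a c n.
Proof.
  intros Hc. unfold binom_coef, gauss_coef.
  pose proof (poch_reflect (a - c + 1) n) as E.
  replace (1 - (a - c + 1) - INR n) with (c - (a + INR n)) by ring.
  assert (E2 : poch (a - c + 1) n = (-(1)) ^ n * poch (c - (a + INR n)) n).
  { replace (c - (a + INR n)) with (1 - (a - c + 1) - INR n) by ring. rewrite E, Cmult_assoc, m1_pow_sqr. ring. }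
  rewrite E2.
  replace ((-(1)) ^ n * poch (c - (a + INR n)) n * poch a n / (poch c n * INR (fact n))) with
    (poch a n * (poch (c - (a + INR n)) n / (poch c n * INR (fact n))) * (-(1)) ^ n) by (unfold Cdiv; ring).
  f_equal. rewrite <- (chu_vandermonde (a + INR n) c n Hc), <- csum_scal. apply csum_ext. intros j Hj.
  assert (E3 : poch a n * poch (a + INR n) j = poch a (2 * j) * poch (a + INR 2 * INR j) (n - j)).
  { rewrite <- poch_add. replace (INR 2 * INR j) with (RtoC (INR (2 * j))) by (rewrite mult_INR, RtoC_mult; reflexivity).
    rewrite <- poch_add. f_equal. lia. }
  transitivity ((-(1)) ^ j * (poch a (2 * j) * poch (a + INR 2 * INR j) (n - j)) / (poch c j * INR (fact j) * INR (fact (n - j)))).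
  - field. repeat split; nz.
  - rewrite <- E3. field. repeat split; nz.
Qed.

Lemma gen_coef_binom (a c y : C) (n : nat) : nonpole c ->
  binom_coef (fun j => (-(1)) ^ j * poch a (2 * j) / (poch c j * INR (fact j)) * y ^ j) a 2 n * (-(1)) ^ n = gen_coef a c y n.
Proof.
  intros Hc. unfold binom_coef, gen_coef. rewrite Cmult_comm, <- csum_scal. apply csum_ext. intros j Hj.
  assert (E3 : poch a (n + j) = poch a (2 * j) * poch (a + INR 2 * INR j) (n - j)).
  { replace (INR 2 * INR j) with (RtoC (INR (2 * j))) by (rewrite mult_INR, RtoC_mult; reflexivity).
    rewrite <- poch_add. f_equal. lia. }
  assert (E4 : (-(1)) ^ n * (-(1)) ^ j = (-(1)) ^ (n - j)).
  { replace n with (n - j + j)%nat at 1 by lia. rewrite Cpow_add_r, <- Cmult_assoc, m1_pow_sqr. ring. }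
  rewrite E3, <- E4. field. repeat split; nz.
Qed.

(** * The closed form of the generating function *)

Definition root (rho : C) (x : R) : C := Csqrt (1 + rho ^ 2 - 2 * rho * x).

Definition zeta (rho : C) (x : R) : C := (1 + rho - root rho x) / (1 + rho + root rho x).

Lemma Re_radicand (rho : C) (x : R) :
  Re (1 + rho ^ 2 - 2 * rho * x) = (1 + Re rho ^ 2 - Im rho ^ 2 - 2 * Re rho * x)%R.
Proof. destruct rho as [p q]. simpl. ring. Qed.

Lemma Im_radicand (rho : C) (x : R) :
  Im (1 + rho ^ 2 - 2 * rho * x) = (2 * Im rho * (Re rho - x))%R.
Proof. destruct rho as [p q]. simpl. ring. Qed.

Lemma disk_sqr (rho : C) : (Cmod rho < 1)%R -> (Re rho ^ 2 + Im rho ^ 2 < 1)%R.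
Proof. intros H. rewrite <- Cmod_sqr. pose proof (Cmod_ge_0 rho). nra. Qed.

Lemma radicand_slit (rho : C) (x : R) : (Cmod rho < 1)%R -> (-1 <= x <= 1)%R -> slit (1 + rho ^ 2 - 2 * rho * x).
Proof.
  intros Hr Hx. apply disk_sqr in Hr. unfold slit. rewrite Re_radicand, Im_radicand.
  generalize dependent (Im rho). generalize dependent (Re rho). intros p q Hr.
  destruct (Req_dec (2 * q * (p - x)) 0) as [E|E]; [left|right; exact E].
  apply Rmult_integral in E. destruct E as [E|E].
  - assert (Hq : q = 0%R) by lra. rewrite Hq in *. assert (-1 < p < 1)%R by (split; nra).
    assert (0 < (1 - p) ^ 2)%R by (apply pow_lt; lra). assert (0 < (1 + p) ^ 2)%R by (apply pow_lt; lra).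
    replace (1 + p ^ 2 - 0 ^ 2 - 2 * p * x)%R with ((1 + x) / 2 * (1 - p) ^ 2 + (1 - x) / 2 * (1 + p) ^ 2)%R by field.
    destruct (Rle_or_lt 0 x);
      [apply Rplus_lt_le_0_compat|apply Rplus_le_lt_0_compat];
      first [apply Rmult_lt_0_compat; lra|apply Rmult_le_pos; lra].
  - assert (p = x) by lra. nra.
Qed.

Lemma root_Re_pos (rho : C) (x : R) (Hrho : (Cmod rho < 1)%R) (Hx : (-1 <= x <= 1)%R) :
  (0 < Re (root rho x))%R.
Proof. apply Csqrt_Re_pos, radicand_slit; assumption. Qed.

Lemma root_sqr (rho : C) (x : R) (Hrho : (Cmod rho < 1)%R) (Hx : (-1 <= x <= 1)%R) :
  root rho x * root rho x = 1 + rho ^ 2 - 2 * rho * x.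
Proof. apply Csqrt_sqr, slit_neq_0, radicand_slit; assumption. Qed.

Lemma root_Re_eq (rho : C) (x : R) (Hrho : (Cmod rho < 1)%R) (Hx : (-1 <= x <= 1)%R) :
  (Re (root rho x) ^ 2 - Im (root rho x) ^ 2 = (Re rho - x) ^ 2 - Im rho ^ 2 + (1 - x ^ 2))%R.
Proof.
  pose proof (f_equal Re (root_sqr rho x Hrho Hx)) as E. rewrite Re_radicand, Re_mult in E. nra.
Qed.

Lemma root_Im_eq (rho : C) (x : R) (Hrho : (Cmod rho < 1)%R) (Hx : (-1 <= x <= 1)%R) :
  (Re (root rho x) * Im (root rho x) = Im rho * (Re rho - x))%R.
Proof.
  pose proof (f_equal Im (root_sqr rho x Hrho Hx)) as E. rewrite Im_radicand, Im_mult in E. lra.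
Qed.

(** The real part of [sqrt (v^2 + w)] is at least [|Re v|] for [w >= 0]; here [v = rho - x]. *)
Lemma root_Re_ge (rho : C) (x : R) (Hrho : (Cmod rho < 1)%R) (Hx : (-1 <= x <= 1)%R) :
  (x - Re rho <= Re (root rho x))%R.
Proof.
  pose proof (root_Re_pos rho x Hrho Hx) as HA. pose proof (root_Re_eq rho x Hrho Hx) as E1. pose proof (root_Im_eq rho x Hrho Hx) as E2.
  set (A := Re (root rho x)) in *. set (B := Im (root rho x)) in *. set (p := Re rho) in *. set (q := Im rho) in *.
  apply Rnot_lt_le. intros Hlt.
  assert (H1 : (A ^ 2 < (p - x) ^ 2)%R) by nra.
  assert (H2 : (q ^ 2 <= B ^ 2)%R).
  { assert ((A * B) ^ 2 = q ^ 2 * (p - x) ^ 2)%R by (rewrite E2; ring).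
    apply Rnot_lt_le. intros Hq. assert (A ^ 2 * B ^ 2 < (p - x) ^ 2 * q ^ 2)%R.
    { apply Rle_lt_trans with (A ^ 2 * q ^ 2)%R; [apply Rmult_le_compat_l; nra|].
      apply Rmult_lt_compat_r; [nra|exact H1]. }
    nra. }
  nra.
Qed.

(** This is what puts [zeta] in the unit disk.  With [p + i q = rho] and [A + i B = root rho x] the claim
    is [(1+p) A + q B > 0], or [(1+p) A^2 + q^2 (p-x) > 0] after multiplication by [A]; its failure
    would bound [A^2 - B^2] below the value given by [root_Re_eq]. *)
Lemma ratio_Re_pos (rho : C) (x : R) (Hrho : (Cmod rho < 1)%R) (Hx : (-1 <= x <= 1)%R) :
  (0 < Re ((1 + rho) / root rho x))%R.
Proof.
  pose proof (root_Re_pos rho x Hrho Hx) as HA. pose proof (root_Re_eq rho x Hrho Hx) as E1. pose proof (root_Im_eq rho x Hrho Hx) as E2.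
  pose proof (disk_sqr rho Hrho) as Hd.
  set (A := Re (root rho x)) in *. set (B := Im (root rho x)) in *. set (p := Re rho) in *. set (q := Im rho) in *.
  assert (Hp : (-1 < p < 1)%R) by (split; nra).
  assert (Hkey : (0 < (1 + p) * A + q * B)%R).
  { apply Rmult_lt_reg_l with A; [exact HA|]. rewrite Rmult_0_r.
    replace (A * ((1 + p) * A + q * B))%R with ((1 + p) * A ^ 2 + q * (A * B))%R by ring. rewrite E2.
    apply Rnot_le_lt. intros Hle.
    assert (HX : (0 < A ^ 2)%R) by nra.
    assert (Hxp : (0 < x - p)%R) by nra.
    (* [B^2] is then bounded below by [(x - p) (1 + p)] *)
    assert (HB : ((x - p) * (1 + p) <= B ^ 2)%R).
    { apply Rmult_le_reg_l with (A ^ 2)%R; [exact HX|].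
      replace (A ^ 2 * B ^ 2)%R with ((A * B) ^ 2)%R by ring. rewrite E2. nra. }
    assert (H3 : ((1 + p) * A ^ 2 <= q ^ 2 * (x - p))%R) by lra.
    assert (H4 : ((1 + p) * ((p - x) ^ 2 - q ^ 2 + (1 - x ^ 2)) <= q ^ 2 * (x - p) - (1 + p) * ((x - p) * (1 + p)))%R).
    { rewrite <- E1. nra. }
    assert (H5 : ((1 + x) * (1 - p ^ 2 - q ^ 2) <= 0)%R) by nra.
    nra. }
  assert (Hn : root rho x <> 0) by (apply slit_neq_0; left; exact HA).
  apply Cmod_gt_0 in Hn as Hm. apply Rmult_lt_reg_r with (Cmod (root rho x) ^ 2)%R; [nra|]. rewrite Rmult_0_l.
  rewrite Cmod_sqr. fold A B.
  replace (Re ((1 + rho) / root rho x) * (A ^ 2 + B ^ 2))%R with ((1 + p) * A + q * B)%R; [exact Hkey|].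
  fold A B in Hm. assert (HQ : (A ^ 2 + B ^ 2 <> 0)%R) by nra.
  assert (E : Re ((1 + rho) / root rho x) = (((1 + p) * A + q * B) / (A ^ 2 + B ^ 2))%R).
  { unfold Cdiv, Cinv. rewrite Re_mult. change (fst (root rho x)) with A. change (snd (root rho x)) with B.
    rewrite Re_plus, Im_plus. simpl (Re 1). simpl (Im 1). fold p q. simpl (Re (_, _)). simpl (Im (_, _)). field. exact HQ. }
  rewrite E. field. exact HQ.
Qed.

Lemma one_plus_Re_pos (rho : C) (Hrho : (Cmod rho < 1)%R) : (0 < Re (1 + rho)%C)%R.
Proof.
  pose proof (disk_sqr rho Hrho) as Hd. rewrite Re_plus. simpl (Re 1). nra.
Qed.

Lemma denom_Re_pos (rho : C) (x : R) (Hrho : (Cmod rho < 1)%R) (Hx : (-1 <= x <= 1)%R) :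
  (0 < Re (1 + rho + root rho x)%C)%R.
Proof. rewrite Re_plus. pose proof (one_plus_Re_pos rho Hrho). pose proof (root_Re_pos rho x Hrho Hx). lra. Qed.

Lemma root_neq_0 (rho : C) (x : R) (Hrho : (Cmod rho < 1)%R) (Hx : (-1 <= x <= 1)%R) :
  root rho x <> 0.
Proof. apply slit_neq_0. left. apply (root_Re_pos rho x Hrho Hx). Qed.

Lemma denom_neq_0 (rho : C) (x : R) (Hrho : (Cmod rho < 1)%R) (Hx : (-1 <= x <= 1)%R) :
  1 + rho + root rho x <> 0.
Proof. apply slit_neq_0. left. apply (denom_Re_pos rho x Hrho Hx). Qed.

Lemma zeta_disk (rho : C) (x : R) (Hrho : (Cmod rho < 1)%R) (Hx : (-1 <= x <= 1)%R) :
  (Cmod (zeta rho x) < 1)%R.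
Proof.
  destruct (Cayley_disk ((1 + rho) / root rho x) (ratio_Re_pos rho x Hrho Hx)) as [_ H].
  replace (zeta rho x) with (((1 + rho) / root rho x - 1) / ((1 + rho) / root rho x + 1)); [exact H|].
  unfold zeta. field. split; [exact (denom_neq_0 rho x Hrho Hx)|exact (root_neq_0 rho x Hrho Hx)].
Qed.

(** [(1+rho+R)^2/rho] avoids the cut, in the strong sense that its logarithm is the obvious one:
    [Im (1+rho+R)] has the sign of [Im rho]. *)
Lemma Carg_denom (rho : C) (x : R) (Hrho : (Cmod rho < 1)%R) (Hx : (-1 <= x <= 1)%R) :
  slit rho ->
  (- PI < 2 * Carg (1 + rho + root rho x) - Carg rho < PI)%R.
Proof.
  intros Hs. pose proof (Carg_slit rho Hs) as H1. pose proof (Carg_Re_pos _ (denom_Re_pos rho x Hrho Hx)) as H2.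
  pose proof (root_Re_pos rho x Hrho Hx) as HA. pose proof (root_Im_eq rho x Hrho Hx) as E2. pose proof (root_Re_ge rho x Hrho Hx) as HG.
  set (A := Re (root rho x)) in *. set (B := Im (root rho x)) in *. set (p := Re rho) in *. set (q := Im rho) in *.
  assert (HIm : (A * Im (1 + rho + root rho x)%C = q * (A + p - x))%R).
  { rewrite !Im_plus. simpl (Im 1). fold q B. nra. }
  destruct (Rlt_or_le q 0) as [Hq|Hq].
  - pose proof (Carg_Im_neg rho Hq) as H3.
    destruct (Rlt_or_le (Im (1 + rho + root rho x)%C) 0) as [Hi|Hi].
    + pose proof (Carg_Im_neg _ Hi). lra.
    + assert (Hz : Im (1 + rho + root rho x)%C = 0%R) by nra.
      assert (E : 1 + rho + root rho x = RtoC (Re (1 + rho + root rho x)%C)).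
      { apply injective_projections; simpl; [reflexivity|exact Hz]. }
      rewrite E, Carg_pos_real by exact (denom_Re_pos rho x Hrho Hx). lra.
  - assert (Hi : (0 <= Im (1 + rho + root rho x)%C)%R).
    { apply Rmult_le_reg_l with A; [exact HA|]. rewrite HIm. nra. }
    pose proof (Carg_Im_nonneg _ Hi). pose proof (Carg_Im_nonneg rho Hq). lra.
Qed.

Definition gen_fun (a c rho : C) (x : R) : C :=
  Cpower ((1 + rho + root rho x) / 2) (- a) * Phi (a - c + 1) a c (zeta rho x).

Lemma two_neq_0 : RtoC 2 <> 0.
Proof. intros E. apply RtoC_inj in E. lra. Qed.

Lemma half_Re_pos (z : C) : (0 < Re z)%R -> (0 < Re (z / 2)%C)%R.
Proof.
  intros H. replace (z / 2) with (RtoC (/ 2) * z) by (rewrite RtoC_inv by lra; unfold Cdiv; ring).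
  rewrite Re_scal. lra.
Qed.

Lemma root_analytic (rho : C) (x : R) : (Cmod rho < 1)%R -> (-1 <= x <= 1)%R -> analytic_at (fun z => root z x) rho.
Proof.
  intros Hr Hx. apply Csqrt_analytic; [apply radicand_slit; assumption|].
  apply analytic_at_minus.
  - apply analytic_at_plus; [apply analytic_at_const|].
    apply (analytic_at_ext (fun z => z * z)); [intros; simpl; ring|].
    apply analytic_at_mult; apply analytic_at_id.
  - apply analytic_at_mult; [|apply analytic_at_const].
    apply analytic_at_mult; [apply analytic_at_const|apply analytic_at_id].
Qed.

Lemma zeta_analytic (rho : C) (x : R) : (Cmod rho < 1)%R -> (-1 <= x <= 1)%R -> analytic_at (fun z => zeta z x) rho.
Proof.
  intros Hr Hx. pose proof (root_analytic rho x Hr Hx) as HR.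
  assert (H1 : analytic_at (fun z => 1 + z) rho) by (apply analytic_at_plus; [apply analytic_at_const|apply analytic_at_id]).
  apply analytic_at_div; [apply denom_neq_0; assumption|apply analytic_at_minus|apply analytic_at_plus]; assumption.
Qed.

Lemma gen_fun_analytic (a c rho : C) (x : R) : nonpole c -> (Cmod rho < 1)%R -> (-1 <= x <= 1)%R ->
  analytic_at (fun z => gen_fun a c z x) rho.
Proof.
  intros Hc Hr Hx. apply analytic_at_mult.
  - apply analytic_at_Cpower; [left; apply half_Re_pos, denom_Re_pos; assumption|].
    apply analytic_at_div; [exact two_neq_0| |apply analytic_at_const].
    apply analytic_at_plus; [|apply root_analytic; assumption].
    apply analytic_at_plus; [apply analytic_at_const|apply analytic_at_id].
  - apply (analytic_at_comp (Phi (a - c + 1) a c) (fun z => zeta z x)); [|apply zeta_analytic; assumption].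
    apply Phi_analytic; [exact Hc|apply zeta_disk; assumption].
Qed.

Lemma zeta_quadratic (rho : C) (x : R) : (Cmod rho < 1)%R -> (-1 <= x <= 1)%R ->
  zeta rho x / (1 + zeta rho x) ^ 2 = (1 + x) / 2 * (rho / (1 + rho) ^ 2) /\
  (1 + rho + root rho x) / 2 * (1 + zeta rho x) = 1 + rho.
Proof.
  intros Hr Hx. pose proof (root_sqr rho x Hr Hx) as E. pose proof (denom_neq_0 rho x Hr Hx) as Hd.
  pose proof (slit_neq_0 _ (Re_pos_slit _ (one_plus_Re_pos rho Hr))) as H1.
  unfold zeta. set (w := root rho x) in *. pose proof two_neq_0 as H2.
  assert (E1 : 1 + (1 + rho - w) / (1 + rho + w) = 2 * (1 + rho) / (1 + rho + w)) by (field; exact Hd).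
  rewrite E1. split; [|field; assumption].
  transitivity (((1 + rho) ^ 2 - w * w) / (4 * (1 + rho) ^ 2)).
  - simpl. field. repeat split; assumption.
  - rewrite E. simpl. field. repeat split; assumption.
Qed.

Lemma zeta_at_0 (x : R) : zeta 0 x = 0.
Proof.
  unfold zeta, root, Csqrt. replace (1 + 0 ^ 2 - 2 * 0 * x) with (RtoC 1) by ring.
  rewrite half_RtoC, Cpower_pos_real by lra. rewrite ln_1, Rmult_0_r, exp_0. unfold Cdiv. ring.
Qed.

(** Let [W = zeta/(1+zeta)^2 = y rho/(1+rho)^2].  For small [rho], the sum of the left-hand series and
    [gen_fun] both equal [(1+rho)^(-a) sum_j (a)_{2j}/((c)_j j!) W^j]: expand in powers of [rho] for
    the former, in powers of [zeta] for the latter. *)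
Lemma gen_fun_near_0 (a c : C) (x : R) : nonpole c -> (-1 <= x <= 1)%R -> exists e, (0 < e)%R /\
  forall rho, (Cmod rho < e)%R -> Csums (fun n => gen_coef a c ((1 + x) / 2) n * rho ^ n) (gen_fun a c rho x).
Proof.
  intros Hc Hx. set (y := (1 + x) / 2).
  assert (Hy : (Cmod y <= 1)%R).
  { unfold y. rewrite <- RtoC_plus, <- RtoC_div, Cmod_R, Rabs_pos_eq by lra. lra. }
  set (p1 := fun j => (-(1)) ^ j * poch a (2 * j) / (poch c j * INR (fact j))).
  assert (Hp1 : exists M, forall j, (Cmod (p1 j) <= M * 8 ^ j)%R).
  { (* [(a)_{2j}/j! = 4^j (a/2)_j ((a+1)/2)_j / j!] *)
    assert (Ep : forall j, poch a (2 * j) = 4 ^ j * poch (a / 2) j * poch ((a + 1) / 2) j).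
    { induction j as [|j IH]; [simpl; ring|].
      replace (2 * S j)%nat with (S (S (2 * j))) by lia. rewrite !poch_S, IH, Cpow_S, INR_S_C.
      rewrite mult_INR, RtoC_mult. rewrite INR_2_C. field. }
    destruct (subexp_gauss (a / 2) ((a + 1) / 2) c Hc 2%R ltac:(lra)) as [M HM]. exists M. intros j.
    unfold p1. rewrite Ep.
    replace ((-(1)) ^ j * (4 ^ j * poch (a / 2) j * poch ((a + 1) / 2) j) / (poch c j * INR (fact j)))
      with ((-(4)) ^ j * gauss_coef (a / 2) ((a + 1) / 2) c j).
    2:{ replace (-(4)) with (-(1) * 4) by ring. rewrite Cpow_mult_l. unfold gauss_coef, Cdiv. ring. }
    rewrite Cmod_mult, Cmod_pow, Cmod_opp, Cmod_R, Rabs_pos_eq by lra.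
    replace (M * 8 ^ j)%R with (4 ^ j * (M * 2 ^ j))%R
      by (replace 8%R with (4 * 2)%R by ring; rewrite Rpow_mult_distr; ring).
    apply Rmult_le_compat_l; [apply pow_le; lra|apply HM]. }
  destruct Hp1 as [M HM].
  destruct (binomial_substitution p1 a 2 M 8 ltac:(lra) HM) as [e1 [He1 Hs1]].
  destruct (binomial_substitution (fun j => p1 j * y ^ j) a 2 M 8) as [e2 [He2 Hs2]]; [lra| |].
  { intros j. rewrite Cmod_mult, Cmod_pow. rewrite <- (Rmult_1_r (M * 8 ^ j)).
    apply Rmult_le_compat; [apply Cmod_ge_0|apply pow_le, Cmod_ge_0|apply HM|].
    rewrite <- (pow1 j). apply pow_incr. split; [apply Cmod_ge_0|exact Hy]. }
  assert (H00 : (Cmod 0 < 1)%R) by (rewrite Cmod_0; lra).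
  destruct (analytic_at_continuous (fun z => zeta z x) 0 (zeta_analytic 0 x H00 Hx) e1 ltac:(lra)) as [d [Hd Hcont]].
  exists (Rmin d e2). split; [apply Rmin_pos; lra|]. intros rho Hrho.
  pose proof (Rmin_l d e2). pose proof (Rmin_r d e2).
  assert (Hr1 : (Cmod rho < 1)%R) by lra.
  assert (Hz : (Cmod (- zeta rho x) < e1)%R).
  { rewrite Cmod_opp. specialize (Hcont rho). rewrite zeta_at_0 in Hcont.
    replace (zeta rho x - 0) with (zeta rho x) in Hcont by ring. apply Hcont.
    replace (rho - 0) with rho by ring. lra. }
  destruct (Hs1 _ Hz) as [s1 [A1 A2]].
  destruct (Hs2 (- rho) ltac:(rewrite Cmod_opp; lra)) as [s2 [B1 B2]].
  destruct (zeta_quadratic rho x Hr1 Hx) as [Q1 Q2].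
  replace (1 - - zeta rho x) with (1 + zeta rho x) in A1, A2 by ring.
  replace (1 - - rho) with (1 + rho) in B1, B2 by ring.
  assert (Hzd : (Cmod (zeta rho x) < 1)%R) by (apply zeta_disk; assumption).
  assert (Hz1 : (0 < Re (1 + zeta rho x)%C)%R).
  { replace (1 + zeta rho x) with (1 - - zeta rho x) by ring. apply disk_1_minus. rewrite Cmod_opp. exact Hzd. }
  assert (Es : s2 = s1).
  { apply (Csums_unique _ _ _ B1). apply Csums_ext with (2 := A1). intros j.
    replace (- zeta rho x / (1 + zeta rho x) ^ 2) with (y * (- rho / (1 + rho) ^ 2)).
    - rewrite Cpow_mult_l. ring.
    - replace (- zeta rho x / (1 + zeta rho x) ^ 2) with (- (zeta rho x / (1 + zeta rho x) ^ 2)) by (unfold Cdiv; ring).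
      rewrite Q1. fold y. unfold Cdiv. ring. }
  assert (EP : Phi (a - c + 1) a c (zeta rho x) = Cpower (1 + zeta rho x) (- a) * s1).
  { apply Csums_CSeries. apply Csums_ext with (2 := A2). intros n. rewrite <- quadratic_coef by exact Hc.
    fold p1. replace (- zeta rho x) with (-(1) * zeta rho x) by ring. rewrite Cpow_mult_l. ring. }
  assert (EG : gen_fun a c rho x = Cpower (1 + rho) (- a) * s2).
  { unfold gen_fun. rewrite EP, Es.
    transitivity (Cpower ((1 + rho + root rho x) / 2 * (1 + zeta rho x)) (- a) * s1); [|rewrite Q2; reflexivity].
    rewrite Cpower_mult; [ring|apply half_Re_pos, denom_Re_pos; assumption|exact Hz1]. }
  rewrite EG. apply Csums_ext with (2 := B2). intros n.
  pose proof (gen_coef_binom a c y n Hc) as EB.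
  change (binom_coef (fun j => p1 j * y ^ j) a 2 n * (-(1)) ^ n = gen_coef a c y n) in EB. rewrite <- EB.
  replace (- rho) with (-(1) * rho) by ring. rewrite Cpow_mult_l. ring.
Qed.

(** The identity theorem in the unit disk, from [gen_fun_near_0]. *)
Theorem gen_fun_expansion (a c : C) (x : R) : nonpole c -> (-1 <= x <= 1)%R ->
  (forall z, (Cmod z < 1)%R -> exists T, Csums (fun n => gen_coef a c ((1 + x) / 2) n * z ^ n) T) ->
  forall rho, (Cmod rho < 1)%R -> Csums (fun n => gen_coef a c ((1 + x) / 2) n * rho ^ n) (gen_fun a c rho x).
Proof.
  intros Hc Hx Hconv.
  set (f := fun z => CSeries (fun n => gen_coef a c ((1 + x) / 2) n * z ^ n)).
  assert (Hf : forall z, (Cmod z < 1)%R -> Csums (fun n => gen_coef a c ((1 + x) / 2) n * z ^ n) (f z)).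
  { intros z Hz. destruct (Hconv z Hz) as [T HT]. unfold f. rewrite (Csums_CSeries _ _ HT). exact HT. }
  destruct (gen_fun_near_0 a c x Hc Hx) as [e [He Hnear]].
  assert (E : forall z, (Cmod z < 1)%R -> f z = gen_fun a c z x).
  { apply (analytic_identity (fun z => (Cmod z < 1)%R) f (fun z => gen_fun a c z x) e); try assumption.
    - intros; apply disk_star; assumption.
    - intros z Hz. apply (analytic_at_pseries _ 1 f z Hf Hz).
    - intros z Hz. apply gen_fun_analytic; assumption.
    - intros z Hz. apply Csums_CSeries, Hnear, Hz. }
  intros rho Hr. rewrite <- E by exact Hr. apply Hf, Hr.
Qed.

(** * Legendre functions *)

Lemma gauss_coef_sym (a b c : C) : gauss_coef a b c = gauss_coef b a c.
Proof.
  apply functional_extensionality. intros n.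
  unfold gauss_coef. rewrite (Cmult_comm (poch a n)). reflexivity.
Qed.

Lemma hyp2F1_sym (a b c z : C) : hyp2F1 a b c z = hyp2F1 b a c z.
Proof. unfold hyp2F1, is_gauss_continuation, is_gauss_series. rewrite gauss_coef_sym. reflexivity. Qed.

Lemma Clog_mult_pos (x : R) (z : C) : (0 < x)%R -> z <> 0 -> Clog (x * z) = RtoC (ln x) + Clog z.
Proof.
  intros Hx Hz.
  assert (Hn : RtoC x <> 0) by (intros E; apply RtoC_inj in E; lra).
  rewrite Clog_mult; [|exact Hn|exact Hz|rewrite Carg_pos_real by exact Hx; pose proof (Carg_bounds z Hz); lra].
  f_equal. unfold Clog. rewrite Carg_pos_real, Cmod_R, Rabs_pos_eq by lra. reflexivity.
Qed.

(** Since [(1+rho-R)(1+rho+R) = 2 rho (1+t)], the base is [(z+1)/(z-1) = D^2 * (2/(1+t)) / rho], and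
    [Carg_denom] makes its principal logarithm the sum of the obvious ones. *)
Lemma Cpower_legendre_base (rho : C) (t : R) (p : C) : (Cmod rho < 1)%R -> slit rho -> (-1 < t <= 1)%R ->
  let D := (1 + rho + root rho t) / 2 in
  let z := (1 + rho) / root rho t in
  Cpower (1 + t) p * Cpower ((z + 1) / (z - 1)) p = Cpower 2 p * Cpower D (2 * p) * Cpower rho (- p).
Proof.
  intros Hr Hs Ht D z. assert (Ht' : (-1 <= t <= 1)%R) by lra.
  pose proof (root_sqr rho t Hr Ht') as ER. pose proof (denom_neq_0 rho t Hr Ht') as Hd.
  pose proof (root_neq_0 rho t Hr Ht') as HR. pose proof (slit_neq_0 rho Hs) as Hrho.
  pose proof (Carg_denom rho t Hr Ht' Hs) as HA.
  pose proof two_neq_0 as H2.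
  assert (H1t : 1 + RtoC t <> 0) by (rewrite <- RtoC_plus; intros E; apply RtoC_inj in E; lra).
  assert (HD : D <> 0) by (apply slit_neq_0; left; apply half_Re_pos, denom_Re_pos; assumption).
  assert (E2 : D = RtoC (/ 2) * (1 + rho + root rho t)) by (unfold D; rewrite RtoC_inv by lra; unfold Cdiv; ring).
  assert (HargD : Carg D = Carg (1 + rho + root rho t)).
  { pose proof (Clog_mult_pos (/ 2) (1 + rho + root rho t) ltac:(lra) Hd) as E.
    rewrite <- E2 in E. apply (f_equal Im) in E. rewrite Im_plus in E. simpl in E. lra. }
  assert (EW : (z + 1) / (z - 1) = D * D * (RtoC (2 / (1 + t)) * / rho)).
  { assert (Hm : (1 + rho - root rho t) * (1 + rho + root rho t) = 2 * rho * (1 + t)).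
    { transitivity ((1 + rho) ^ 2 - root rho t * root rho t); [simpl; ring|]. rewrite ER. simpl. ring. }
    assert (Hm0 : 1 + rho - root rho t <> 0).
    { intros E. rewrite E, Cmult_0_l in Hm. symmetry in Hm. revert Hm.
      repeat apply Cmult_neq_0; assumption. }
    rewrite RtoC_div, RtoC_plus by lra.
    transitivity ((1 + rho + root rho t) / (1 + rho - root rho t)).
    - unfold z. field. repeat split; assumption.
    - transitivity ((1 + rho + root rho t) * (1 + rho + root rho t) / ((1 + rho - root rho t) * (1 + rho + root rho t))).
      + field. split; assumption.
      + rewrite Hm. unfold D. field. repeat split; assumption. }
  assert (HinvL : Clog (/ rho) = - Clog rho) by (apply Clog_inv, Hs).
  assert (Hq : (0 < 2 / (1 + t))%R) by (apply Rdiv_lt_0_compat; lra).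
  assert (HW : Clog ((z + 1) / (z - 1)) = 2 * Clog D + (RtoC (ln (2 / (1 + t))) - Clog rho)).
  { apply Clog_unique.
    - rewrite Cexp_plus. replace (2 * Clog D) with (Clog D + Clog D) by ring.
      rewrite Cexp_plus, Cexp_Clog by exact HD.
      replace (RtoC (ln (2 / (1 + t))) - Clog rho) with (Clog (RtoC (2 / (1 + t)) * / rho)).
      + rewrite Cexp_Clog; [symmetry; exact EW|]. apply Cmult_neq_0; [|apply Cinv_neq_0, Hrho].
        intros E; apply RtoC_inj in E; lra.
      + rewrite Clog_mult_pos, HinvL; [reflexivity|exact Hq|apply Cinv_neq_0, Hrho].
    - rewrite Im_plus, Im_minus, Im_scal. simpl (Im (Clog _)). simpl (Im (RtoC _)). rewrite HargD. lra. }
  assert (HWn : (z + 1) / (z - 1) <> 0).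
  { rewrite EW. apply Cmult_neq_0; [apply Cmult_neq_0; exact HD|].
    apply Cmult_neq_0; [intros E; apply RtoC_inj in E; lra|apply Cinv_neq_0, Hrho]. }
  rewrite <- RtoC_plus.
  rewrite !Cpower_E; try assumption; [|rewrite RtoC_plus; exact H1t].
  rewrite HW, <- !Cexp_plus. f_equal.
  assert (L : forall v : R, (0 < v)%R -> Clog v = RtoC (ln v)).
  { intros v Hv. unfold Clog. rewrite Carg_pos_real, Cmod_R, Rabs_pos_eq by lra. reflexivity. }
  rewrite (L (1 + t)%R), (L 2%R) by lra.
  replace (ln (2 / (1 + t))) with (ln 2 - ln (1 + t))%R by (unfold Rdiv; rewrite ln_mult, ln_Rinv; try lra; apply Rinv_0_lt_compat; lra).
  rewrite RtoC_minus. ring.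
Qed.

Definition lhs_const (beta : R) (rho : C) : C :=
  Cpower rho (beta / 2) / (CGamma (beta + 1) * Cpower 2 (beta / 2)).

(** Here [(1-z)/2 = -zeta/(1-zeta)] for [z = (1+rho)/R]; [pfaff] is applied with the roles of the two
    numerator parameters exchanged, which produces the power [(1-zeta)^(alpha+1)] that cancels
    against [R^(alpha+1)]. *)
Lemma legendre_generating (alpha : C) (beta : R) (rho : C) (t : R) : (-1 < beta)%R ->
  (Cmod rho < 1)%R -> slit rho -> (-1 < t <= 1)%R ->
  let r := Csqrt (1 + rho ^ 2 - 2 * rho * t) in
  Cpower (1 + t) (- beta / 2) / Cpower r (alpha + 1) * legendreP alpha (- beta) ((1 + rho) / r) =
  lhs_const beta rho * gen_fun (alpha + beta + 1) (beta + 1) rho t.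
Proof.
  intros Hb Hr Hs Ht r. assert (Ht' : (-1 <= t <= 1)%R) by lra.
  change r with (root rho t). clear r.
  pose proof (Cpower_legendre_base rho t (- beta / 2) Hr Hs Ht) as HB. cbv zeta in HB.
  pose proof (denom_neq_0 rho t Hr Ht') as Hd. pose proof (root_neq_0 rho t Hr Ht') as HR.
  pose proof (zeta_disk rho t Hr Ht') as Hz. pose proof (disk_1_minus _ Hz) as H1z.
  pose proof (half_Re_pos _ (denom_Re_pos rho t Hr Ht')) as HDp.
  pose proof (slit_neq_0 rho Hs) as Hrho. pose proof two_neq_0 as H2.
  assert (Hc : nonpole (beta + 1)) by (rewrite <- RtoC_plus; apply nonpole_pos; lra).
  set (R0 := root rho t) in *. set (D := (1 + rho + R0) / 2) in *. set (ze := zeta rho t) in *.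
  unfold legendreP.
  replace (1 - - beta) with (beta + 1) by ring.
  assert (Earg : (1 - (1 + rho) / R0) / 2 = - ze / (1 - ze)).
  { unfold ze, zeta. fold R0. field. repeat split; try assumption.
    replace (1 + rho + R0 - (1 + rho - R0)) with (2 * R0) by ring. apply Cmult_neq_0; assumption. }
  assert (ERD : R0 = (1 - ze) * D) by (unfold ze, zeta, D; fold R0; field; assumption).
  rewrite Earg, hyp2F1_sym, pfaff by assumption.
  replace (beta + 1 - - alpha) with (alpha + beta + 1) by ring.
  unfold gen_fun, lhs_const. fold R0 D ze.
  replace (alpha + beta + 1 - (beta + 1) + 1) with (alpha + 1) by ring.
  set (F := Phi (alpha + 1) (alpha + beta + 1) (beta + 1) ze).
  assert (EP : Cpower R0 (alpha + 1) = Cpower (1 - ze) (alpha + 1) * Cpower D (alpha + 1)).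
  { rewrite ERD at 1. apply Cpower_mult; assumption. }
  assert (N1 : 1 - ze <> 0) by (apply slit_neq_0; left; exact H1z).
  assert (N2 : D <> 0) by (apply slit_neq_0; left; exact HDp).
  set (W := ((1 + rho) / R0 + 1) / ((1 + rho) / R0 - 1)) in *.
  assert (NG : CGamma (beta + 1) <> 0) by (rewrite <- RtoC_plus; apply CGamma_neq_0; lra).
  pose proof (Cpower_neq_0 (1 - ze) (alpha + 1) N1) as N3. pose proof (Cpower_neq_0 D (alpha + 1) N2) as N4.
  pose proof (Cpower_neq_0 2 (beta / 2) H2) as N5.
  rewrite EP.
  transitivity ((Cpower (1 + t) (- beta / 2) * Cpower W (- beta / 2)) / (CGamma (beta + 1) * Cpower D (alpha + 1)) * F).
  { field. repeat split; assumption. }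
  rewrite HB.
  replace (- (- beta / 2)) with (beta / 2) by (field; exact H2).
  replace (2 * (- beta / 2)) with (- RtoC beta) by (field; exact H2).
  replace (- beta / 2) with (- (beta / 2)) by (field; exact H2).
  rewrite (Cpower_opp 2) by exact H2.
  replace (- (alpha + beta + 1)) with (- beta + - (alpha + 1)) by ring.
  rewrite (Cpower_plus D (- beta) (- (alpha + 1))), (Cpower_opp D (alpha + 1)) by exact N2.
  field. repeat split; assumption.
Qed.

(** Needed at the endpoint [x = -1] only, where the left-hand side of the theorem is a limit. *)
Lemma gen_fun_continuous_x (a c rho : C) (x : R) : nonpole c -> (Cmod rho < 1)%R -> (-1 <= x <= 1)%R ->
  forall eps, (0 < eps)%R -> exists d, (0 < d)%R /\ forall t : R, (Rabs (t - x) < d)%R ->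
    (Cmod (gen_fun a c rho t - gen_fun a c rho x) < eps)%R.
Proof.
  intros Hc Hr Hx eps He.
  (* the same expression for complex values of the variable *)
  set (rt := fun w : C => Csqrt (1 + rho ^ 2 - 2 * rho * w)).
  set (g := fun w : C => Cpower ((1 + rho + rt w) / 2) (- a) * Phi (a - c + 1) a c ((1 + rho - rt w) / (1 + rho + rt w))).
  assert (Hrt : analytic_at rt x).
  { apply Csqrt_analytic; [apply radicand_slit; assumption|].
    apply analytic_at_minus; [apply analytic_at_const|].
    apply analytic_at_mult; [apply analytic_at_const|apply analytic_at_id]. }
  assert (Hg : analytic_at g x).
  { apply analytic_at_mult.
    - apply analytic_at_Cpower; [left; apply half_Re_pos; apply (denom_Re_pos rho x Hr Hx)|].
      apply analytic_at_div; [exact two_neq_0| |apply analytic_at_const].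
      apply analytic_at_plus; [apply analytic_at_const|exact Hrt].
    - apply (analytic_at_comp (Phi (a - c + 1) a c) (fun w => (1 + rho - rt w) / (1 + rho + rt w))).
      + apply Phi_analytic; [exact Hc|]. apply (zeta_disk rho x Hr Hx).
      + apply analytic_at_div; [apply (denom_neq_0 rho x Hr Hx)| |].
        * apply analytic_at_minus; [apply analytic_at_const|exact Hrt].
        * apply analytic_at_plus; [apply analytic_at_const|exact Hrt]. }
  destruct (analytic_at_continuous g x Hg eps He) as [d [Hd Hcont]]. exists d. split; [exact Hd|].
  intros t Ht. apply (Hcont (RtoC t)). rewrite <- RtoC_minus, Cmod_R. exact Ht.
Qed.

(** For [z = (1+rho)/(1-rho)] one has [(z+1)/(z-1) = 1/rho] and [(1-z)/2 = -rho/(1-rho)]. *)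
Lemma legendreP_unit_disk (alpha : C) (beta gamma : R) (rho : C) (k : nat) :
  (-1 < gamma + beta + 1)%R -> (gamma + beta + 1 <> 0)%R -> (Cmod rho < 1)%R -> slit rho ->
  let s := (gamma + beta + 1)%R in
  legendreP (gamma - alpha) (- gamma - beta - 2 * INR k - 1) ((1 + rho) / (1 - rho)) =
  Cpower (1 - rho) (alpha - gamma) * Cpower rho (s / 2) * rho ^ k / (poch s (S (2 * k)) * CGamma s) *
  Phi (alpha - gamma) (alpha + beta + 1 + 2 * INR k) (s + 2 * INR k + 1) rho.
Proof.
  intros Hs0 Hs1 Hr Hsl s. pose proof two_neq_0 as H2. pose proof (slit_neq_0 rho Hsl) as Hrho.
  assert (H1r : 1 - rho <> 0) by (apply slit_neq_0; left; apply disk_1_minus, Hr).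
  assert (Hs : nonpole s) by (apply nonpole_real; assumption).
  assert (H2k : RtoC (INR (S (2 * k))) = 2 * INR k + 1) by (rewrite INR_S_C, mult_INR, RtoC_mult; reflexivity).
  assert (Es : RtoC s = gamma + beta + 1) by (unfold s; rewrite !RtoC_plus; reflexivity).
  assert (Hsk : nonpole (s + 2 * INR k + 1)).
  { replace (s + 2 * INR k + 1) with (s + INR (S (2 * k))) by (rewrite H2k; ring). apply nonpole_shift, Hs. }
  unfold legendreP.
  replace (1 - (- gamma - beta - 2 * INR k - 1)) with (s + 2 * INR k + 1) by (rewrite Es; ring).
  replace ((1 - (1 + rho) / (1 - rho)) / 2) with (- rho / (1 - rho)) by (field; repeat split; assumption).
  rewrite pfaff by assumption.
  replace (- (gamma - alpha)) with (alpha - gamma) by ring.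
  replace (s + 2 * INR k + 1 - (gamma - alpha + 1)) with (alpha + beta + 1 + 2 * INR k) by (rewrite Es; ring).
  replace (((1 + rho) / (1 - rho) + 1) / ((1 + rho) / (1 - rho) - 1)) with (/ rho).
  2:{ field. repeat split; try assumption. replace (1 + rho - (1 - rho)) with (2 * rho) by ring. apply Cmult_neq_0; assumption. }
  rewrite Cpower_inv by exact Hsl.
  replace (- ((- gamma - beta - 2 * INR k - 1) / 2)) with (s / 2 + 1 * INR k) by (rewrite Es; field; exact H2).
  rewrite Cpower_plus, Cpower_nat, Cpower_1 by exact Hrho.
  replace (s + 2 * INR k + 1) with (s + INR (S (2 * k))) at 1 by (rewrite H2k; ring).
  rewrite CGamma_add by assumption.
  pose proof (CGamma_neq_0 s Hs0 Hs1). pose proof (poch_neq_0 s (S (2 * k)) Hs).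
  field. split; assumption.
Qed.

Theorem theorem4 (alpha : C) (beta gamma : R) (rho : C) (x : R)
  (hbeta : (-1 < beta)%R) (hgamma : (-1 < gamma)%R)
  (hbg : (beta < 0)%R -> (gamma < 0)%R -> (beta + gamma + 1)%R <> 0%R)
  (hrho : (Cmod rho < 1)%R)
  (hrho_cut : ~ (Im rho = 0%R /\ (-1 < Re rho <= 0)%R))
  (hx : (-1 <= x <= 1)%R) :
  let lhs := fun t : R =>
    let r := Csqrt (1 + rho ^ 2 - 2 * rho * t) in
    Cpower (1 + t) (- beta / 2) / Cpower r (alpha + 1) *
    legendreP alpha (- beta) ((1 + rho) / r) in
  let prefactor :=
    CGamma (gamma + beta + 1) /
    (Cpower 2 (beta / 2) * CGamma (beta + 1) *
     Cpower (1 - rho) (alpha - gamma) * Cpower rho ((gamma + 1) / 2)) in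
  let term := fun k : nat =>
    (2 * INR k + gamma + beta + 1) * poch (gamma + beta + 1) k *
    poch (alpha + beta + 1) (2 * k) / poch (beta + 1) k *
    legendreP (gamma - alpha) (- gamma - beta - 2 * INR k - 1)
      ((1 + rho) / (1 - rho)) *
    jacobiP k gamma beta x in
  exists s : C,
    is_series (K := C_AbsRing) (V := C_NormedModule) term s /\
    ((-1 < x)%R -> lhs x = prefactor * s) /\
    (x = (-1)%R ->
     filterlim lhs (at_right (-1)) (locally (T := C_UniformSpace) (prefactor * s))).
Proof.
  intros lhs prefactor term.
  set (s := (gamma + beta + 1)%R). set (a := alpha + beta + 1). set (c := (beta + 1)%R).
  assert (Hs0 : (-1 < s)%R) by (unfold s; lra).
  assert (Hs1 : s <> 0%R).
  { intros E. apply hbg; unfold s in E; lra. }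
  assert (Hsl : slit rho).
  { unfold slit. destruct (Req_dec (Im rho) 0) as [E|E]; [left|right; exact E].
    apply Rnot_le_lt. intros Hle. apply hrho_cut. split; [exact E|].
    pose proof (Re_Cmod_le rho) as H. apply Rabs_le_between in H. lra. }
  assert (Es : RtoC s = gamma + beta + 1) by (unfold s; rewrite !RtoC_plus; reflexivity).
  assert (Ec : RtoC c = beta + 1) by (unfold c; rewrite RtoC_plus; reflexivity).
  assert (Hs : nonpole s) by (apply nonpole_real; assumption).
  assert (Hc : nonpole c) by (apply nonpole_pos; unfold c; lra).
  pose proof two_neq_0 as H2. pose proof (slit_neq_0 rho Hsl) as Hrho.
  assert (H1r : 1 - rho <> 0) by (apply slit_neq_0; left; apply disk_1_minus, hrho).
  assert (Hsum : forall z, (Cmod z < 1)%R -> exists T,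
    Csums (fun k => conn_coef a c s k * jacobi_y c s k ((1 + x) / 2) * z ^ k *
       Phi (a - s) (a + 2 * INR k) (s + 2 * INR k + 1) z) T /\
    Csums (fun n => gen_coef a c ((1 + x) / 2) n * z ^ n) T).
  { intros z Hz. apply jacobi_double_series; try assumption; unfold s, c; lra. }
  destruct (Hsum rho hrho) as [T [HT1 HT2]].
  assert (ET : T = gen_fun a c rho x).
  { apply (Csums_unique _ _ _ HT2). apply gen_fun_expansion; try assumption.
    intros z Hz. destruct (Hsum z Hz) as [T' [_ HT']]. exists T'. exact HT'. }
  set (E := Cpower (1 - rho) (alpha - gamma) * Cpower rho (s / 2) / CGamma s).
  pose proof (CGamma_neq_0 s Hs0 Hs1) as NG.
  assert (NGc : CGamma c <> 0) by (apply CGamma_neq_0; unfold c; lra).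
  assert (Hterm : forall k, E * (conn_coef a c s k * jacobi_y c s k ((1 + x) / 2) * rho ^ k *
       Phi (a - s) (a + 2 * INR k) (s + 2 * INR k + 1) rho) = term k).
  { intros k. unfold term. rewrite legendreP_unit_disk by assumption. fold s a.
    rewrite jacobiP_sum. rewrite <- Es, <- Ec.
    unfold jacobi_y, conn_coef, E.
    replace (s - c + 1) with (gamma + 1) by (rewrite Es, Ec; ring).
    replace (1 - (1 + x) / 2) with ((1 - x) / 2) by (field; exact H2).
    replace (a - s) with (alpha - gamma) by (unfold a; rewrite Es; ring).
    replace (2 * INR k + gamma + beta + 1) with (s + 2 * INR k) by (rewrite Es; ring).
    rewrite (poch_S s (2 * k)). rewrite mult_INR, RtoC_mult, INR_2_C.
    pose proof (poch_neq_0 s (2 * k) Hs). pose proof (poch_neq_0 c k Hc).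
    assert (s + 2 * INR k <> 0).
    { replace (2 * INR k) with (RtoC (INR (2 * k))) by (rewrite mult_INR, RtoC_mult; reflexivity). apply Hs. }
    field. repeat split; try assumption. apply fact_neq_0_C. }
  assert (Hpre : prefactor * (E * T) = lhs_const beta rho * gen_fun a c rho x).
  { unfold prefactor, E, lhs_const. rewrite <- Es, <- Ec, ET.
    replace (s / 2) with (beta / 2 + (gamma + 1) / 2) by (rewrite Es; field; exact H2).
    rewrite Cpower_plus by exact Hrho.
    pose proof (Cpower_neq_0 rho ((gamma + 1) / 2) Hrho). pose proof (Cpower_neq_0 (1 - rho) (alpha - gamma) H1r).
    pose proof (Cpower_neq_0 2 (beta / 2) H2).
    field. repeat split; assumption. }
  assert (Hlhs : forall t, (-1 < t <= 1)%R -> lhs t = lhs_const beta rho * gen_fun a c rho t).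
  { intros t Ht. rewrite Ec. unfold lhs. apply legendre_generating; assumption. }
  exists (E * T). split; [|split].
  - apply Csums_is_series. apply (Csums_ext _ _ _ Hterm). apply Csums_scal, HT1.
  - intros Hx. rewrite Hpre. apply Hlhs. lra.
  - intros Hx. rewrite Hpre. intros P HP.
    apply (proj1 (locally_C _ _)) in HP. destruct HP as [eps Heps].
    set (L := lhs_const beta rho) in *. pose proof (Cmod_ge_0 L) as HL.
    destruct (gen_fun_continuous_x a c rho x Hc hrho hx (eps / (Cmod L + 1))%R) as [d [Hd Hcont]].
    { apply Rdiv_lt_0_compat; [apply cond_pos|lra]. }
    assert (Hd' : (0 < Rmin d 1)%R) by (apply Rmin_pos; lra).
    exists (mkposreal _ Hd'). intros t Ht Ht1.
    assert (Hb : (Rabs (t - -1) < Rmin d 1)%R) by exact Ht.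
    pose proof (Rmin_l d 1). pose proof (Rmin_r d 1).
    assert (Ht2 : (t <= 1)%R) by (apply Rabs_def2 in Hb; lra).
    apply Heps, Cmod_ball. rewrite Hlhs by lra.
    replace (L * gen_fun a c rho t - L * gen_fun a c rho x) with (L * (gen_fun a c rho t - gen_fun a c rho x)) by ring.
    rewrite Cmod_mult. specialize (Hcont t). rewrite Hx in Hcont at 1. specialize (Hcont ltac:(lra)).
    pose proof (Cmod_ge_0 (gen_fun a c rho t - gen_fun a c rho x)).
    pose proof (cond_pos eps).
    apply Rle_lt_trans with (Cmod L * (eps / (Cmod L + 1)))%R; [apply Rmult_le_compat_l; lra|].
    assert (0 < eps / (Cmod L + 1))%R by (apply Rdiv_lt_0_compat; lra).
    replace (pos eps) with ((Cmod L + 1) * (eps / (Cmod L + 1)))%R at 2 by (field; lra). nra.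
Qed.
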